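(* Let $1\le p<+\infty$ and let $\Omega\subset\mathbb{R}^n$ be open and bounded. (i) Let $\{Y_k\}_{k\in\mathbb{N}}\subset L^p(\Omega;\mathbb{R}^{n\times n})$ and $\{Y_k^{-1}\}_{k\in\mathbb{N}}\subset L^p(\Omega;\mathbb{R}^{n\times n})$ both be bounded sequences. Then there is a subsequence of $\{Y_k\}_{k\in\mathbb{N}}$ (not relabeled) and $\nu=\{\nu_x\}_{x\in\Omega}\in\mathcal{Y}^{p,-p}(\Omega;\mathbb{R}^{n\times n})$ such that for every $g\in L^\infty(\Omega)$ and every $v\in C_{p,-p}(\mathbb{R}^{n\times n}_{\rm inv})$ $$\lim_{k\to\infty}\int_\Omega v(Y_k(x))g(x)\,\mathrm{d}x=\int_\Omega\int_{\mathbb{R}^{n\times n}_{\rm inv}} v(s)\,\nu_x(\mathrm{d}s)\,g(x)\,\mathrm{d}x .\qquad( * )$$ (ii) Conversely, if $\nu\in\mathcal{Y}^{p,-p}(\Omega;\mathbb{R}^{n\times n})$, then there is a bounded sequence $\{Y_k\}_{k\in\mathbb{N}}\subset L^p(\Omega;\mathbb{R}^{n\times n})$ such that $\{Y_k^{-1}\}_{k\in\mathbb{N}}\subset L^p(\Omega;\mathbb{R}^{n\times n})$ is also bounded and $( * )$ holds for all $g\in L^\infty(\Omega)$ and all $v\in C_{p,-p}(\mathbb{R}^{n\times n}_{\rm inv})$.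
   Context: $|A|$ is the Frobenius norm on $\mathbb{R}^{n\times n}$. $\mathbb{R}^{n\times n}_{\rm inv}$ is the set of invertible matrices in $\mathbb{R}^{n\times n}$. $Y_k^{-1}$ denotes the pointwise matrix inverse $x\mapsto (Y_k(x))^{-1}$ (so $Y_k(x)$ is invertible for a.a. $x$). Young measures: $\mathrm{rca}(\mathbb{R}^{n\times n})\cong C_0(\mathbb{R}^{n\times n})^*$ is the space of Radon measures. A Young measure is a family $\nu=\{\nu_x\}_{x\in\Omega}$ of probability measures in $\mathrm{rca}(\mathbb{R}^{n\times n})$ such that $x\mapsto\int v\,\mathrm{d}\nu_x$ is measurable for every $v\in C_0(\mathbb{R}^{n\times n})$; the set of these is $\mathcal{Y}(\Omega;\mathbb{R}^{n\times n})$. Let $C_p(\mathbb{R}^{n\times n})=\{v\in C(\mathbb{R}^{n\times n}):\lim_{|s|\to\infty}v(s)/|s|^p=0\}$. A sequence $\{Y_k\}$ generates $\nu$ if for every $v\in C_p(\mathbb{R}^{n\times n})$, $v\circ Y_k\rightharpoonup \int v(s)\nu_x(\mathrm{d}s)$ weakly in $L^1(\Omega)$. $\mathcal{Y}^p(\Omega;\mathbb{R}^{n\times n})$ is the set of Young measures generated in this sense by some bounded sequence in $L^p(\Omega;\mathbb{R}^{n\times n})$. $\mathcal{Y}^{p,-p}(\Omega;\mathbb{R}^{n\times n})$ is the set of $\nu\in\mathcal{Y}^p(\Omega;\mathbb{R}^{n\times n})$ with $\int_\Omega\int_{\mathbb{R}^{n\times n}_{\rm inv}}(|s|^p+|s^{-1}|^p)\,\nu_x(\mathrm{d}s)\,\mathrm{d}x<+\infty$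 and $\nu_x(\mathbb{R}^{n\times n}_{\rm inv})=1$ for a.a. $x\in\Omega$. $C_{p,-p}(\mathbb{R}^{n\times n}_{\rm inv})=\{v\in C(\mathbb{R}^{n\times n}_{\rm inv}):\lim_{|s|+|s^{-1}|\to\infty}\frac{v(s)}{|s|^p+|s^{-1}|^p}=0\}$. *)

(* Defs.v *)
From HB Require Import structures.
From mathcomp Require Import all_boot all_order all_algebra.
From mathcomp Require Import all_classical all_reals all_analysis.
From mathcomp Require Import measurable_realfun.

Set Implicit Arguments.
Unset Strict Implicit.
Unset Printing Implicit Defensive.

Import Order.TTheory GRing.Theory Num.Theory.
Import numFieldNormedType.Exports.

Local Open Scope classical_set_scope.
Local Open Scope ring_scope.

(* Borel sigma-algebra on real matrices, hence also on R^n = 'rV[R]_n. *)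
HB.instance Definition _ (R : realType) (m n : nat) :=
  @isMeasurable.Build (sigma_display (@open 'M[R]_(m, n))) 'M[R]_(m, n)
    <<s @open 'M[R]_(m, n) >> (@sigma_algebra0 _ setT open)
    (@sigma_algebraC _ open) (@sigma_algebra_bigcup _ setT open).

Section lebesgue_rV.
Variable R : realType.

Lemma open_rat_ball m n (U : set 'M[R]_(m, n)) : open U ->
  U = \bigcup_(k in [set k : 'M[rat]_(m, n) * nat |
         ball (map_mx ratr k.1 : 'M[R]_(m, n)) k.2.+1%:R^-1 `<=` U])
      ball (map_mx ratr k.1 : 'M[R]_(m, n)) k.2.+1%:R^-1.
Proof.
move=> oU; apply/seteqP; split => [M UM|M [k kU]]; last exact: kU.
have /nbhs_ballP[e /= e0 eU] : nbhs M U by exact: open_nbhs_nbhs.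
have [N NE] : exists N : nat, N.+1%:R^-1 <= e / 2.
  have [N _ /(_ N (leqnn N)) /ltW NE] :=
    near_infty_natSinv_lt (PosNum (divr_gt0 e0 (ltr0n R 2))).
  by exists N.
have q_ i j : exists q : rat, ball (M i j) N.+1%:R^-1 (ratr q : R).
  suff : ball (M i j) N.+1%:R^-1 `&` range (@ratr R) !=set0.
    by move=> [_ [] /[swap] [[q _ <-]] ?]; exists q.
  apply: dense_rat; last exact: ball_open.
  by exists (M i j); apply: ballxx; rewrite invr_gt0.
pose q := \matrix_(i < m, j < n) projT1 (cid (q_ i j)).
have Mq : ball M N.+1%:R^-1 (map_mx ratr q : 'M[R]_(m, n)).
  split; first by rewrite invr_gt0.
  by move=> i j; rewrite !mxE; case: cid.
exists (q, N); last exact: ball_sym.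
move=> K /= qK; apply: eU; rewrite (splitr e).
exact: ball_triangle (le_ball NE Mq) (le_ball NE qK).
Qed.

Lemma measurable_fun_mx d (T : measurableType d) m n (f : T -> 'M[R]_(m, n)) :
  (forall i j, measurable_fun setT (fun x => f x i j : measurableTypeR R)) ->
  measurable_fun setT f.
Proof.
move=> mf; apply: (@measurability _ _ _ _ _ _ (@open 'M[R]_(m, n))) => //.
move=> _ [U oU <-]; rewrite setTI (open_rat_ball oU) preimage_bigcup.
rewrite bigcup_mkcond; apply: countable_bigcupT_measurable => //.
move=> k; case: ifP => // _.
rewrite (_ : _ @^-1` _ = \bigcap_(ij in [set: 'I_m * 'I_n])
  ((fun x => f x ij.1 ij.2) @^-1`
    ball (ratr (k.1 ij.1 ij.2) : R) k.2.+1%:R^-1)); last first.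
  apply/seteqP; split => [x [_ fx] [i j] _ /=|x fx].
    by have := fx i j; rewrite mxE.
  split; first by rewrite invr_gt0.
  by move=> i j; rewrite mxE; exact: (fx (i, j) I).
apply: fin_bigcap_measurable => // -[i j] _.
rewrite -[X in measurable X]setTI; apply: mf => //.
exact: open_measurable (ball_open _ _).
Qed.

Definition consrV n (x : 'rV[R]_n * measurableTypeR R) : 'rV[R]_n.+1 :=
  row_mx (x.2)%:M x.1.

Lemma measurable_coord m n i j :
  measurable_fun setT (fun M : 'M[R]_(m, n) => M i j : measurableTypeR R).
Proof.
apply: (measurability _ (RGenOInfty.measurableE R)) => _ [_ [r ->] <-].
apply: sub_sigma_algebra; rewrite setTI.
apply: open_comp; last exact: rray_open.
by move=> M _; exact: coord_continuous.
Qed.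

Lemma consrV0 n x i : @consrV n x i ord0 = x.2.
Proof.
rewrite /consrV (_ : ord0 = lshift n (ord0 : 'I_1)); last exact: val_inj.
by rewrite (row_mxEl (x.2)%:M) mxE !ord1 eqxx mulr1n.
Qed.

Lemma consrVS n x i k : @consrV n x i (lift ord0 k) = x.1 i k.
Proof.
rewrite /consrV (_ : lift ord0 k = rshift 1 k); last exact: val_inj.
by rewrite (row_mxEr (x.2)%:M).
Qed.

Lemma measurable_consrV n : measurable_fun setT (@consrV n).
Proof.
apply: measurable_fun_mx => i j; have [k ->|->] := unliftP ord0 j.
  under eq_fun do rewrite consrVS.
  exact: measurableT_comp (@measurable_coord 1 n i k) measurable_fst.
by under eq_fun do rewrite consrV0; exact: measurable_snd.
Qed.

(* Lebesgue measure on R^n: the image of the product of the measure on R^(n-1)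
   with the one on R; lebesgue_rV_box below gives its value on boxes. *)
Fixpoint lebesgue_rV n : {measure set 'rV[R]_n -> \bar R} :=
  match n with
  | 0 => \d_(0 : 'rV[R]_0)
  | n'.+1 => measure_function_pushforward__canonical__measure_function_Measure
      (lebesgue_rV n' \x @lebesgue_measure R)%E (@measurable_consrV n')
  end.

Lemma measurable_rV_box n (A : 'I_n -> set (measurableTypeR R)) :
  (forall i, measurable (A i)) ->
  measurable [set x : 'rV[R]_n | forall i, A i (x 0 i)].
Proof.
move=> mA; rewrite (_ : mkset _ =
    \bigcap_(i in [set: 'I_n]) ((fun x : 'rV[R]_n => x 0 i) @^-1` A i)).
  apply: fin_bigcap_measurable => // i _.
  by rewrite -[X in measurable X]setTI; exact: measurable_coord.
by apply/seteqP; split => [x Ax i _|x Ax i]; [exact: Ax|exact: (Ax i I)].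
Qed.

Lemma lebesgue_rV_box n (A : 'I_n -> set (measurableTypeR R)) :
  (forall i, measurable (A i)) ->
  lebesgue_rV n [set x | forall i, A i (x 0 i)] =
    (\prod_(i < n) lebesgue_measure (A i))%E.
Proof.
elim: n A => [|n IHn] A mA.
  by rewrite big_ord0 /= diracE mem_set// => -[].
rewrite big_ord_recl muleC -IHn//=.
rewrite -(product_measure1E _ _ (measurable_rV_box (fun i => mA (lift ord0 i)))
  (mA ord0)).
rewrite /pushforward; congr (product_measure1 _ _ _).
apply/seteqP; split => [[v r]/= Avr|[v r]/= [Av Ar] i].
  by split => [i|]; [have := Avr (lift ord0 i)|have := Avr ord0];
    rewrite ?consrVS ?consrV0.
by have [k ->|->] := unliftP ord0 i; rewrite ?consrVS ?consrV0.
Qed.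

End lebesgue_rV.

Section young_measures.
Context {R : realType} {n : nat}.
Implicit Types (Omega : set 'rV[R]_n) (p : R) (nu : 'rV[R]_n -> probability 'M[R]_n R).

Local Notation leb := (lebesgue_rV R n).

(* The library norm on matrices is the max norm; |.| is the Frobenius norm. *)
Definition frob (s : 'M[R]_n) : R := Num.sqrt (\sum_i \sum_j s i j ^+ 2).

Definition invertible : set 'M[R]_n := [set s | s \in unitmx].

(* Measurability with respect to the Lebesgue (completed Borel) sigma-algebra
   of Omega: almost everywhere equal to a Borel function. The library integral
   of a nonnegative function is a supremum over the simple functions below it,
   hence is also the usual one on such functions. *)
Definition lebesgue_measurable_fun d (T : measurableType d) Omega
    (f : 'rV[R]_n -> T) :=
  exists2 h : 'rV[R]_n -> T, measurable_fun Omega h &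
    {ae leb, forall x, Omega x -> f x = h x}.

(* The norm of L^p(Omega); elements of L^p(Omega) are represented by functions
   on R^n whose values outside Omega are ignored. *)
Definition Lpnorm Omega (p : \bar R) (f : 'rV[R]_n -> R) : \bar R :=
  ('N[leb]_p [EFin \o (f \_ Omega)])%E.

Definition in_Lp Omega (p : \bar R) (f : 'rV[R]_n -> R) :=
  lebesgue_measurable_fun Omega f /\ (Lpnorm Omega p f < +oo)%E.

Definition LpnormM Omega p (Y : 'rV[R]_n -> 'M[R]_n) : \bar R :=
  Lpnorm Omega p%:E (frob \o Y).

Definition in_LpM Omega p (Y : 'rV[R]_n -> 'M[R]_n) :=
  lebesgue_measurable_fun Omega Y /\ (LpnormM Omega p Y < +oo)%E.

Definition bounded_seq_LpM Omega p (Y : nat -> 'rV[R]_n -> 'M[R]_n) :=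
  (forall k, in_LpM Omega p (Y k)) /\
  exists C : R, forall k, (LpnormM Omega p (Y k) <= C%:E)%E.

Definition ae_invertible Omega (Y : 'rV[R]_n -> 'M[R]_n) :=
  {ae leb, forall x, Omega x -> invertible (Y x)}.

(* The filter "|s| -> oo" on matrices. *)
Definition at_infty : set_system 'M[R]_n :=
  filter_from [set: R] (fun r => [set s | r < frob s]).

(* The filter "|s| + |s^-1| -> oo" on invertible matrices. *)
Definition at_infty_inv : set_system 'M[R]_n :=
  filter_from [set: R]
    (fun r => [set s | invertible s /\ r < frob s + frob (invmx s)]).

Definition C0 (v : 'M[R]_n -> R) :=
  continuous v /\ v s @[s --> at_infty] --> (0 : R).

Definition Cp p (v : 'M[R]_n -> R) :=
  continuous v /\ (v s / frob s `^ p) @[s --> at_infty] --> (0 : R).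

(* A function on the open set of invertible matrices is represented by a total
   function whose values elsewhere are ignored. *)
Definition Cpinv p (v : 'M[R]_n -> R) :=
  {within invertible, continuous v} /\
  (v s / (frob s `^ p + frob (invmx s) `^ p)) @[s --> at_infty_inv] --> (0 : R).

(* Families indexed by Omega are represented by families indexed by R^n. *)
Definition young_measure Omega nu :=
  forall v, C0 v ->
    lebesgue_measurable_fun Omega (fun x => \int[nu x]_(s in setT) v s).

Definition weakly_cvg_L1 Omega (f_ : nat -> 'rV[R]_n -> R)
    (f : 'rV[R]_n -> R) :=
  [/\ forall k, in_Lp Omega 1%E (f_ k), in_Lp Omega 1%E f &
    forall g, in_Lp Omega +oo%E g ->
      \int[leb]_(x in Omega) (f_ k x * g x) @[k --> \oo] -->
      \int[leb]_(x in Omega) (f x * g x)].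

(* The integrability clause makes \int[nu x]_s v s meaningful: the real-valued
   integral is 0 by convention when the integral is infinite. *)
Definition generates Omega p (Y : nat -> 'rV[R]_n -> 'M[R]_n) nu :=
  forall v, Cp p v ->
    {ae leb, forall x, Omega x -> (nu x).-integrable setT (EFin \o v)} /\
    weakly_cvg_L1 Omega (fun k => v \o Y k)
      (fun x => \int[nu x]_(s in setT) v s).

Definition Yp Omega p nu :=
  young_measure Omega nu /\
  exists Y, bounded_seq_LpM Omega p Y /\ generates Omega p Y nu.

Definition Ypinv Omega p nu :=
  [/\ Yp Omega p nu,
    (\int[leb]_(x in Omega) \int[nu x]_(s in invertible)
      (frob s `^ p + frob (invmx s) `^ p)%:E < +oo)%E &
    {ae leb, forall x, Omega x -> nu x invertible = 1%E}].

(* v o Y_k converges to x |-> \int v dnu_x against every g in L^oo(Omega). *)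
Definition generates_inv Omega p (Y : nat -> 'rV[R]_n -> 'M[R]_n) nu :=
  forall g v, in_Lp Omega +oo%E g -> Cpinv p v ->
    \int[leb]_(x in Omega) (v (Y k x) * g x) @[k --> \oo] -->
    \int[leb]_(x in Omega) ((\int[nu x]_(s in invertible) v s) * g x).

End young_measures.

(* Main.v *)
(* Scalar sequences with values in [0, 1] are handled by quantiles: along a
   subsequence the indicators of [Z_k < a], a rational, converge weakly-* to
   densities F_a, and the generalized inverse T(x, .) of a |-> F_a(x) pushes the
   uniform law on [0, 1] to the Young measure at x. Matrices are coded by points
   of [0, 1]: Schoenberg's space-filling curve is continuous, hence turns
   continuous test functions of matrices into continuous functions on [0, 1],
   and it has a Borel right inverse, which codes the sequence. The bound on
   |Y|^p + |Y^-1|^p keeps all the mass on the invertible matrices and extends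
   the convergence from compactly supported functions v eta_j, with eta_j
   increasing to the indicator of the invertible matrices, to all v in C_{p,-p}.
   Conversely, for a generating sequence Y_k of nu, replace the values where
   eta_j(Y_k) < 1/2 by the identity and let j grow slowly with k. The moments
   stay bounded, so the first part yields a Young measure nu'; it has the same
   integrals of compactly supported functions as nu, hence of all C_{p,-p}. *)

From HB Require Import structures.
Require Import Defs.
From mathcomp Require Import all_boot all_order all_algebra.
From mathcomp Require Import perm.
From mathcomp Require Import all_classical all_reals all_analysis.
From mathcomp Require Import measurable_realfun ess_sup_inf ring lra.

Import Order.TTheory GRing.Theory Num.Theory.
Import numFieldNormedType.Exports.

Local Open Scope classical_set_scope.
Local Open Scope ring_scope.
Set Implicit Arguments.
Unset Strict Implicit.

(** * Convergent subsequences *)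

(** Compactness of Young measures usually rests on the duality of L^1(Omega; C_0) with
    measure-valued maps. Coding matrices by points of [0, 1] reduces it to scalar facts: a law on
    [0, 1] is given by countably many numbers F_a(x), which are Radon-Nikodym densities of limits of
    set functions, and monotonicity in a suffices to rebuild the law. Since the kernel is then the
    image of a fixed law under a Borel map [S (x, t)], its measurability in x and all exchanges of
    integrals are instances of Fubini's theorem. The growth allowed in C_{p,-p} yields uniform
    integrability in a pointwise form: |v - v eta_j| <= e psi on the invertible matrices for all
    large j, where psi(s) = |s|^p + |s^-1|^p has bounded integrals along the sequence and in the
    limit. Null sets shape the converse. Two Young measures are compared for one v at a time,
    through countably many test functions: the products of the eta_j with the positive and negative
    parts of v. Functions on Omega equal Borel functions only almost everywhere, hence the choices
    of representatives wherever the hypotheses enter. *)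

Lemma ltn_homo_step (phi : nat -> nat) :
  (forall k, (phi k < phi k.+1)%N) -> {homo phi : i j / (i < j)%N}.
Proof.
move=> hphi i; elim=> // j IHj; rewrite ltnS leq_eqVlt => /predU1P[->//|].
by move/IHj/ltn_trans; apply.
Qed.

Lemma homo_cvg_infty (phi : nat -> nat) :
  {homo phi : i j / (i < j)%N} -> phi k @[k --> \oo] --> \oo.
Proof.
move=> hphi; have le_phi k : (k <= phi k)%N.
  by elim: k => // k /leq_ltn_trans; apply; exact: hphi.
by move=> A [N _ NA]; exists N => //= k /= Nk; apply: NA; exact: leq_trans (le_phi k).
Qed.

(** An ultrafilter finer than [\oo] makes all the bounded sequences converge at once, by compactness
    of the intervals [- M i, M i]. One subsequence is then read off: at stage m an index is picked
    where the sequences 0, ..., m are within 1 / (m + 1) of their limits. *)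
Lemma nat_diagonal_subsequence (R : realType) (u : nat -> R^nat) (M : R^nat) :
  (forall i k, `|u i k| <= M i) ->
  exists2 phi : nat -> nat, {homo phi : i j / (i < j)%N} &
    forall i, cvgn (u i \o phi).
Proof.
move=> uM; have [U [UU subU]] := @ultraFilterLemma _ (\oo : set_system nat) _.
have limU i : exists l : R, u i @ U --> l.
  have FF : ProperFilter (u i @ U) by exact: fmap_proper_filter.
  have [|l [_ cl]] := @segment_compact R (- M i) (M i) (u i @ U) FF.
    have : U (u i @^-1` `[- M i, M i]); last by [].
    by apply: filterE => k; rewrite /= in_itv/= -ler_norml.
  exists l => V lV.
  have [//|UV] := in_ultra_setVsetC (u i @^-1` V) UU.
  by have [x [nVx Vx]] := cl (~` V) V UV lV.
have {limU} /choice[l ul] := limU.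
pose close m := [set k | forall i, (i <= m)%N -> `|l i - u i k| < m.+1%:R^-1].
have close_ex m N : exists k, (N < k)%N /\ close m k.
  have Um j : U [set k | forall i, (i < j)%N -> `|l i - u i k| < m.+1%:R^-1].
    elim: j => [|j IHj]; first by apply: filterE.
    have /cvgrPdist_lt/(_ m.+1%:R^-1) := ul j.
    rewrite invr_gt0 ltr0n => /(_ isT) Uj.
    apply: filterS (filterI IHj Uj) => k [/= ik jk] i.
    by rewrite ltnS leq_eqVlt => /predU1P[->//|]; exact: ik.
  have UN : U [set k | (N < k)%N] by apply: subU; exists N.+1.
  have [k [Nk mk]] := filter_ex (filterI UN (Um m.+1)).
  by exists k; split => // i; rewrite -ltnS; exact: mk.
(* The state is the pair of the stage and the last index picked. The initial state need not be
   [close], hence the shift by one in the subsequence below. *)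
have [v [_ vrel]] : {v : nat -> nat * nat | v 0%N = (0, 0)%N /\
    forall k, [/\ (v k).2 < (v k.+1).2, (v k.+1).1 = (v k).1.+1
      & close (v k.+1).1 (v k.+1).2]%N}.
  apply: (dependent_choice (R := fun x y : nat * nat =>
    [/\ x.2 < y.2, y.1 = x.1.+1 & close y.1 y.2]%N)) => -[m N].
  have [k [Nk mk]] := cid (close_ex m.+1 N).
  by exists (m.+1, k).
have v1 k : ((v k.+1).1 >= k)%N.
  by elim: k => // k IHk; have [_ -> _] := vrel k.+1.
exists (fun k => (v k.+1).2).
  by apply: ltn_homo_step => k; have [] := vrel k.+1.
move=> i; apply/cvg_ex; exists (l i); apply/cvgrPdist_lt => e e0; near=> k.
have [_ _ /(_ i)/=] := vrel k.
have ik : (i <= (v k.+1).1)%N.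
  by rewrite (leq_trans _ (v1 k))//; near: k; exact: nbhs_infty_ge.
move=> /(_ ik) /lt_le_trans; apply.
suff /ltW : k.+1%:R^-1 < e.
  apply: le_trans; rewrite lef_pV2 ?posrE ?ltr0n// ler_nat ltnS.
  exact: v1.
by near: k; apply: (near_infty_natSinv_lt (PosNum e0)).
Unshelve. all: by end_near. Qed.

Lemma diagonal_subsequence (R : realType) (I : countType) (u : I -> R^nat)
    (M : I -> R) :
  (forall i k, `|u i k| <= M i) ->
  exists2 phi : nat -> nat, {homo phi : i j / (i < j)%N} &
    forall i, cvgn (u i \o phi).
Proof.
move=> uM.
have [|phi hphi cphi] := @nat_diagonal_subsequence R
  (fun m => if unpickle m is Some i then u i else cst 0)
  (fun m => if unpickle m is Some i then M i else 0).
  by move=> m k; case: unpickle => [i|]; rewrite ?normr0.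
by exists phi => // i; have := cphi (pickle i); rewrite pickleK.
Qed.

(** * Weak-* compactness of bounded densities *)

Section dominated_additive.
Context d (T : measurableType d) (R : realType).
Variable mu : {finite_measure set T -> \bar R}.

(** Finite additivity and the bound by [mu] both survive pointwise limits, and together they imply
    countable additivity. Limits of A |-> \int_A f_k are therefore measures with a density. *)
Definition dominated_additive (r : set T -> R) :=
  (forall A B, measurable A -> measurable B -> [disjoint A & B] ->
    r (A `|` B) = r A + r B) /\
  (forall A, measurable A -> 0 <= r A <= fine (mu A)).

Lemma measure_tail_cvg (F : (set T)^nat) :
  (forall n, measurable (F n)) -> trivIset setT F ->
  fine (mu (\bigcup_n F n)) - \sum_(0 <= i < n) fine (mu (F i))
    @[n --> \oo] --> (0 : R).
Proof.
move=> mF tF.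
have := @measure_semi_sigma_additive _ _ _ mu F mF tF (bigcup_measurable (fun k _ => mF k)).
have fmu A : measurable A -> mu A \is a fin_num by exact: fin_num_measure.
have E n : (\sum_(0 <= i < n) mu (F i))%E = (\sum_(0 <= i < n) fine (mu (F i)))%:E.
  by rewrite -sumEFin; apply: eq_bigr => i _; rewrite fineK ?fmu.
rewrite (funext E).
have mU : measurable (\bigcup_n F n) by apply: bigcup_measurable => k _; exact: mF.
rewrite -[X in _ --> X]fineK ?fmu// => /fine_cvgP[_ cv].
rewrite -[X in _ --> X](subrr (fine (mu (\bigcup_n F n)))).
by apply: cvgB; [exact: cvg_cst|exact: cv].
Qed.

(** Finite additivity turns the difference into the value of [r] on the tail of the union, which
    [mu] dominates. The bound does not depend on [r], as the Dynkin argument below requires. *)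
Lemma dominated_additive_tail (r : set T -> R) (F : (set T)^nat) n :
  dominated_additive r -> (forall n, measurable (F n)) -> trivIset setT F ->
  `|r (\bigcup_n F n) - \sum_(0 <= i < n) r (F i)| <=
  fine (mu (\bigcup_n F n)) - \sum_(0 <= i < n) fine (mu (F i)).
Proof.
move=> [radd rmu] mF tF.
have fmu A : measurable A -> mu A \is a fin_num by exact: fin_num_measure.
have muadd A B : measurable A -> measurable B -> [disjoint A & B] ->
    fine (mu (A `|` B)) = fine (mu A) + fine (mu B).
  move=> mA mB /disj_set2P AB; rewrite measureU// fineD ?fmu//.
have mbig m : measurable (\big[setU/set0]_(i < m) F i).
  by apply: bigsetU_measurable => i _; exact: mF.
have sumE (s : set T -> R) m : s set0 = 0 ->
   (forall A B, measurable A -> measurable B -> [disjoint A & B] ->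
    s (A `|` B) = s A + s B) ->
   \sum_(0 <= i < m) s (F i) = s (\big[setU/set0]_(i < m) F i).
  move=> s0 sadd; elim: m => [|m IHm]; first by rewrite big_nil big_ord0 s0.
  rewrite big_nat_recr//= IHm big_ord_recr/= sadd//; first exact: mbig.
  apply/disj_set2P; apply: (@trivIset_bigsetUI _ predT) => //.
  exact: sub_trivIset tF.
have r0 : r set0 = 0.
  by have := rmu _ measurable0; rewrite measure0/= -eq_le => /eqP.
rewrite (sumE r)// (sumE (fine \o mu))//=; last by rewrite measure0.
set U := \bigcup_n F n; set B := \big[setU/set0]_(i < n) F i.
have mU : measurable U by apply: bigcup_measurable => k _; exact: mF.
have BU : B `<=` U by rewrite /B -bigcup_mkord => x [i _ Fx]; exists i.
have UE : U = B `|` (U `\` B) by rewrite setDUK.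
have dB : [disjoint B & U `\` B] by apply/disj_set2P; rewrite setDIK.
have mD : measurable (U `\` B) by apply: measurableD => //; exact: mbig.
have mB : measurable B by exact: mbig.
have rU : r U = r B + r (U `\` B) by rewrite {1}UE radd.
have mUE : fine (mu U) = fine (mu B) + fine (mu (U `\` B)) by rewrite {1}UE muadd.
rewrite rU mUE [r B + _]addrC addrK [fine (mu B) + _]addrC addrK.
by have /andP[r1 r2] := rmu _ mD; rewrite ger0_norm.
Qed.

Section radon_nikodym_dominated.
Variables (r : set T -> R) (hr : dominated_additive r).

(** The absolute value makes [lam] nonnegative on nonmeasurable sets too, where nothing is known
    about [r]; on measurable sets it changes nothing. *)
Let lam (A : set T) : \bar R := `|r A|%:E.

Let lamE A : measurable A -> lam A = (r A)%:E.
Proof. by move=> mA; rewrite /lam ger0_norm//; have [_ /(_ A mA)/andP[]] := hr. Qed.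

Let lam0 : lam set0 = 0%E.
Proof.
rewrite lamE//; have [_ /(_ _ measurable0)] := hr.
by rewrite measure0/= -eq_le => /eqP <-.
Qed.

Let lam_ge0 A : (0 <= lam A)%E. Proof. by rewrite lee_fin. Qed.

Let lam_sigma_additive : semi_sigma_additive lam.
Proof.
move=> F mF tF mU; rewrite lamE//.
under eq_fun do under eq_bigr do rewrite lamE//.
rewrite (_ : (fun n => _) = EFin \o (fun n => \sum_(0 <= i < n) r (F i))); last first.
  by apply/funext => n; rewrite /= -sumEFin.
apply: cvg_EFin; first exact: nearW.
apply/cvgrPdist_le => e e0.
have /cvgrPdist_le/(_ e e0) := measure_tail_cvg mF tF.
apply: filterS => n; rewrite sub0r normrN; apply: le_trans.
apply: le_trans (dominated_additive_tail n hr mF tF) _; exact: ler_norm.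
Qed.

HB.instance Definition _ := isMeasure.Build _ _ _ lam lam0 lam_ge0
  lam_sigma_additive.

Let lam_fin : fin_num_fun lam. Proof. by []. Qed.

HB.instance Definition _ := Measure_isFinite.Build _ _ _ lam lam_fin.

Lemma dominated_additive_density : exists F : T -> R,
  [/\ measurable_fun setT F, mu.-integrable setT (EFin \o F) &
    forall A, measurable A -> r A = \int[mu]_(x in A) F x].
Proof.
have lam_mu : lam `<< mu.
  apply/null_content_dominatesP => A mA muA; rewrite lamE//.
  have [_ /(_ A mA)] := hr; rewrite muA/= -eq_le => /eqP <-//.
pose F := Radon_Nikodym (charge_of_finite_measure lam) mu.
have Ffin x : F x \is a fin_num by exact: Radon_Nikodym_fin_num.
have FE : EFin \o (fine \o F) = F by apply/funext => x /=; rewrite fineK.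
have iF : mu.-integrable setT F by exact: Radon_Nikodym_integrable.
exists (fine \o F); split.
- by apply/measurable_EFinP; rewrite FE; exact: measurable_int iF.
- by rewrite FE.
- move=> A mA; rewrite /Rintegral; under eq_integral do rewrite fineK//.
  rewrite -Radon_Nikodym_integral// -[RHS]/(fine (lam A)) lamE//.
Qed.

End radon_nikodym_dominated.
End dominated_additive.

Section weak_star_limits.
Context d (T : measurableType d) (R : realType).
Variable mu : {finite_measure set T -> \bar R}.

Lemma fin_measure_integrable_bounded (A : set T) (f : T -> R) (M : R) :
  measurable A -> measurable_fun A f -> (forall x, `|f x| <= M) ->
  mu.-integrable A (EFin \o f).
Proof.
move=> mA mf fM; apply: (@le_integrable _ _ _ mu A mA _ (EFin \o cst M)).
- exact/measurable_EFinP.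
- move=> x _ /=; rewrite lee_fin (le_trans (fM x))// ler_norm//.
- exact: finite_measure_integrable_cst.
Qed.

Lemma Rintegral_dominated_additive (f : T -> R) : measurable_fun setT f ->
  (forall x, 0 <= f x <= 1) ->
  dominated_additive mu (fun A => \int[mu]_(x in A) f x).
Proof.
move=> mf f01.
have f1 x : `|f x| <= 1 by have /andP[f0 ?] := f01 x; rewrite ger0_norm.
have intf A : measurable A -> mu.-integrable A (EFin \o f).
  move=> mA; apply: (fin_measure_integrable_bounded mA _ f1).
  exact: measurable_funTS.
split=> [A B mA mB AB|A mA].
  by rewrite Rintegral_setU//; apply: intf; exact: measurableU.
apply/andP; split; first by apply: Rintegral_ge0 => x _; have /andP[] := f01 x.
rewrite -[leRHS]mul1r -Rintegral_cst//; apply: le_Rintegral => //.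
- exact: intf.
- exact: finite_measure_integrable_cst.
- by move=> x _; have /andP[] := f01 x.
Qed.

Lemma dominated_additive_lim (r : nat -> set T -> R) :
  (forall k, dominated_additive mu (r k)) ->
  (forall A, measurable A -> cvgn (r ^~ A)) ->
  dominated_additive mu (fun A => limn (r ^~ A)).
Proof.
move=> hr cr; split=> [A B mA mB AB|A mA].
  rewrite -limD; [|exact: cr..]; congr (limn _); apply/funext => k /=.
  by have [-> ] := hr k.
apply/andP; split.
  apply: limr_ge; first exact: cr.
  by apply: nearW => k; have [_ /(_ _ mA)/andP[]] := hr k.
apply: limr_le; first exact: cr.
by apply: nearW => k; have [_ /(_ _ mA)/andP[]] := hr k.
Qed.

(** The sets on which [r k] converges form a Dynkin system: complements are taken in [setT], and for
    disjoint unions the tails are small uniformly in [k]. Convergence on a generating pi-system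
    therefore gives it on all measurable sets. *)
Lemma dominated_additive_cvg_dynkin (G : set (set T)) (r : nat -> set T -> R) :
  @measurable _ T = <<s G >> -> setI_closed G ->
  (forall k, dominated_additive mu (r k)) ->
  cvgn (r ^~ setT) -> (forall A, G A -> cvgn (r ^~ A)) ->
  forall A, measurable A -> cvgn (r ^~ A).
Proof.
move=> GE GI hr rT rG A; rewrite GE.
apply: (@dynkin_induction _ T G (fun A => cvgn (r ^~ A))) => //.
  move=> S mS rS; rewrite (_ : r ^~ (~` S) = fun k => r k setT - r k S).
    exact: is_cvgB.
  apply/funext => k; have [radd _] := hr k.
  rewrite -(setUv S) radd//; first by rewrite addrAC subrr add0r.
  exact: measurableC.
  by apply/disj_set2P; rewrite setICr.
move=> F mF tF rF; apply/cauchy_cvgP/cauchy_exP => e e0.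
have e4 : 0 < e / 4 by rewrite divr_gt0.
have /cvgrPdist_lt/(_ _ e4) [N _ /(_ N (leqnn N))] := measure_tail_cvg mu mF tF.
rewrite sub0r normrN => tauN.
have tailN k : `|r k (\bigcup_n F n) - \sum_(0 <= i < N) r k (F i)| < e / 4.
  apply: le_lt_trans (dominated_additive_tail N (hr k) mF tF) _.
  exact: le_lt_trans (ler_norm _) tauN.
have : cvgn (fun k => \sum_(0 <= i < N) r k (F i)).
  elim: (N) => [|m IHm].
    by under eq_fun do rewrite big_nil; exact: is_cvg_cst.
  under eq_fun do rewrite big_nat_recr//=.
  exact: is_cvgD.
move=> /cvg_ex[l /cvgrPdist_lt/(_ _ e4) rl]; exists l.
apply: filterS rl => k /= kl; rewrite /ball/= distrC.
have := tailN k; rewrite distrC in kl.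
have := ler_normD (r k (\bigcup_n F n) - \sum_(0 <= i < N) r k (F i))
  (\sum_(0 <= i < N) r k (F i) - l).
rewrite addrA subrK => /le_lt_trans h1 h2; apply: h1; lra.
Qed.

Lemma weak_star_compactness (J I : countType) (G : J -> set T)
    (f : I -> nat -> T -> R) :
  @measurable _ T = <<s range G >> -> setI_closed (range G) ->
  (forall i k, measurable_fun setT (f i k)) ->
  (forall i k x, 0 <= f i k x <= 1) ->
  exists2 phi : nat -> nat, {homo phi : i j / (i < j)%N} &
  exists F : I -> T -> R, forall i,
  [/\ measurable_fun setT (F i), mu.-integrable setT (EFin \o F i) &
    forall A, measurable A -> \int[mu]_(x in A) f i (phi k) x @[k --> \oo] -->
      \int[mu]_(x in A) F i x].
Proof.
move=> GE GI mf f01.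
have hr i k : dominated_additive mu (fun A => \int[mu]_(x in A) f i k x).
  exact: Rintegral_dominated_additive.
have mG j : measurable (G j).
  by rewrite GE; apply: sub_sigma_algebra; exists j.
(* [None] adds the whole space to the generators, since complements need it. *)
pose D (oj : option J) := if oj is Some j then G j else setT.
have mD oj : measurable (D oj) by case: oj => [j|] /=; [exact: mG|exact: measurableT].
have [|phi hphi cphi] := @diagonal_subsequence R (I * option J)%type
  (fun ij k => \int[mu]_(x in D ij.2) f ij.1 k x) (fun ij => fine (mu (D ij.2))).
  move=> [i oj] k /=; have [_ /(_ _ (mD oj)) /andP[h1 h2]] := hr i k.
  by rewrite ger0_norm.
exists phi => //.
have cA i A : measurable A ->
    cvgn (fun k => \int[mu]_(x in A) f i (phi k) x).
  move: A; apply: (@dominated_additive_cvg_dynkin (range G)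
    (fun k A => \int[mu]_(x in A) f i (phi k) x)) => //.
    exact: (cphi (i, None)).
  by move=> _ [j _ <-]; exact: (cphi (i, Some j)).
have /choice[F HF] : forall i, exists F, [/\ measurable_fun setT F,
    mu.-integrable setT (EFin \o F) & forall A, measurable A ->
    limn (fun k => \int[mu]_(x in A) f i (phi k) x) = \int[mu]_(x in A) F x].
  move=> i; apply: (@dominated_additive_density _ _ _ mu
    (fun A => limn (fun k => \int[mu]_(x in A) f i (phi k) x))).
  by apply: (@dominated_additive_lim (fun k A => \int[mu]_(x in A) f i (phi k) x)) => //; exact: cA.
exists F => i; have [mF iF FE] := HF i; split => // A mA.
by rewrite -FE//; exact: cA.
Qed.

End weak_star_limits.

(** * Young measures of scalar sequences *)

Section bounded_measurable.
Context d (T : measurableType d) (R : realType).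
Variable mu : {finite_measure set T -> \bar R}.
Implicit Types f g : T -> R.

Definition bounded_measurable f :=
  measurable_fun setT f /\ exists M, forall x, `|f x| <= M.

Lemma bounded_measurable_cst c : bounded_measurable (cst c).
Proof. by split; [exact: measurable_cst|exists `|c|]. Qed.

Lemma bounded_measurableD f g :
  bounded_measurable f -> bounded_measurable g -> bounded_measurable (f \+ g).
Proof.
move=> [mf [M fM]] [mg [N gN]]; split; first exact: measurable_funD.
by exists (M + N) => x; rewrite (le_trans (ler_normD _ _))// lerD.
Qed.

Lemma bounded_measurableM f g :
  bounded_measurable f -> bounded_measurable g -> bounded_measurable (f \* g).
Proof.
move=> [mf [M fM]] [mg [N gN]]; split; first exact: measurable_funM.
by exists (M * N) => x; rewrite normrM ler_pM.
Qed.

Lemma bounded_measurableB f g :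
  bounded_measurable f -> bounded_measurable g -> bounded_measurable (f \- g).
Proof.
move=> [mf [M fM]] [mg [N gN]]; split; first exact: measurable_funB.
by exists (M + N) => x; rewrite (le_trans (ler_normB _ _))// lerD.
Qed.

Lemma bounded_measurable_bool (b : T -> bool) : measurable_fun setT b ->
  bounded_measurable (fun x => (b x)%:R).
Proof.
move=> mb; split.
  rewrite (_ : (fun x => _) = (fun x => if b x then 1 else 0)).
    exact: measurable_fun_ifT.
  by apply/funext => x; case: (b x).
by exists 1 => x; case: (b x); rewrite ?normr1 ?normr0.
Qed.

Lemma bounded_measurable_integrable f A : measurable A ->
  bounded_measurable f -> mu.-integrable A (EFin \o f).
Proof.
move=> mA [mf [M fM]]; apply: (fin_measure_integrable_bounded _ mA _ fM).
exact: measurable_funTS.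
Qed.

Lemma Rintegral_dist_le f g e : bounded_measurable f -> bounded_measurable g ->
  0 <= e -> {ae mu, forall x, `|f x - g x| <= e} ->
  `|\int[mu]_x f x - \int[mu]_x g x| <= e * fine (mu setT).
Proof.
move=> bf bg e0 fg.
have ifg := bounded_measurable_integrable measurableT (bounded_measurableB bf bg).
rewrite -RintegralB//; [|exact: bounded_measurable_integrable..].
apply: le_trans (le_normr_Rintegral measurableT ifg) _.
rewrite -lee_fin /Rintegral fineK; last first.
  apply: integrable_fin_num => //.
  exact: integrable_norm.
rewrite EFinM fineK; last exact: fin_num_measure.
rewrite -integral_cst//.
apply: ae_ge0_le_integral => //.
- apply/measurable_EFinP; apply: measurableT_comp => //.
  by apply: measurable_funB; [case: bf|case: bg].
- by apply: filterS fg => x fgx _; rewrite lee_fin.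
Qed.

(** Over the set where g < f, the integral of the positive function f - g is at most 0, so this set
    is null. *)
Lemma ae_le_of_Rintegral f g : measurable_fun setT f -> measurable_fun setT g ->
  mu.-integrable setT (EFin \o f) -> mu.-integrable setT (EFin \o g) ->
  (forall A, measurable A -> \int[mu]_(x in A) f x <= \int[mu]_(x in A) g x) ->
  {ae mu, forall x, f x <= g x}.
Proof.
move=> mf mg intf intg fg; pose A := [set x | g x < f x].
have mA : measurable A.
  have := measurable_fun_ltr mg mf; move=> /(_ measurableT [set true]).
  by rewrite setTI; apply.
have iA h : mu.-integrable setT (EFin \o h) -> mu.-integrable A (EFin \o h).
  by apply: integrableS => //.
have /ae_eq_integral_abs : (\int[mu]_(x in A) `|(f x - g x)%:E| = 0)%E.
  rewrite (eq_integral (EFin \o (f \- g))); last first.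
    by move=> x; rewrite inE /A/= => xA; rewrite ger0_norm// subr_ge0 ltW.
  have ifg : mu.-integrable A (EFin \o (f \- g)).
    have := integrableB mA (iA _ intf) (iA _ intg).
    by apply: eq_integrable => // x _ /=; rewrite EFinB.
  apply/eqP; rewrite eq_le; apply/andP; split; last first.
    by apply: integral_ge0 => x /= xA; rewrite lee_fin subr_ge0 ltW.
  rewrite -[leLHS]fineK; last exact: integrable_fin_num.
  rewrite lee_fin -/(Rintegral mu A (f \- g)) RintegralB//; [|exact: iA..].
  by rewrite subr_le0 fg.
move=> /(_ mA); case.
  apply/measurable_EFinP; apply: measurable_funTS; exact: measurable_funB.
move=> N [mN N0 AN]; exists N; split => // x /= xfg; apply: AN => /= fg0.
apply: xfg; rewrite leNgt; apply/negP => gfx.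
by have [/eqP] := fg0 gfx; rewrite subr_eq0 => /eqP fgx; rewrite fgx ltxx in gfx.
Qed.

End bounded_measurable.

Section weak_limit.
Context d d' (T : measurableType d) (T' : measurableType d') (R : realType).
Variables (mu : {finite_measure set T -> \bar R})
          (mu' : {finite_measure set T' -> \bar R}).
Variables (g : nat -> T -> R) (g' : T' -> R).
Hypotheses (bg : forall k, bounded_measurable (g k))
  (ubg : exists M, forall k x, `|g k x| <= M) (bg' : bounded_measurable g').

(** The two sides may live on different spaces: a Young measure is tested on a product, weak-star
    convergence on the space itself. The relation is closed under linear combinations and uniform
    approximation, so it need only be checked on indicators. *)
Definition weak_limit (u : nat -> T -> R) (w : T' -> R) :=
  [/\ forall k, bounded_measurable (u k), bounded_measurable w &
    \int[mu]_x (u k x * g k x) @[k --> \oo] --> \int[mu']_y (w y * g' y)].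

Lemma weak_limitD u1 w1 u2 w2 : weak_limit u1 w1 -> weak_limit u2 w2 ->
  weak_limit (fun k => u1 k \+ u2 k) (w1 \+ w2).
Proof.
move=> [bu1 bw1 c1] [bu2 bw2 c2]; split.
- by move=> k; exact: bounded_measurableD.
- exact: bounded_measurableD.
- under eq_fun do under eq_Rintegral do rewrite mulrDl.
  under eq_Rintegral do rewrite mulrDl.
  have intM d0 (S : measurableType d0) (m : {finite_measure set S -> \bar R}) u h :
      bounded_measurable u -> bounded_measurable h ->
      m.-integrable setT (EFin \o (fun x => u x * h x)).
    move=> bu bh; apply: bounded_measurable_integrable => //.
    exact: bounded_measurableM.
  rewrite RintegralD//; [|exact: intM..].
  rewrite (_ : (fun k => _) = (fun k => \int[mu]_x (u1 k x * g k x) +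
    \int[mu]_x (u2 k x * g k x))); first exact: cvgD.
  by apply/funext => k; rewrite RintegralD//; exact: intM.
Qed.

Lemma weak_limitZ c u w : weak_limit u w ->
  weak_limit (fun k x => c * u k x) (fun y => c * w y).
Proof.
move=> [bu bw cu]; split.
- by move=> k; exact: (bounded_measurableM (bounded_measurable_cst _ c) (bu k)).
- exact: (bounded_measurableM (bounded_measurable_cst _ c) bw).
- under eq_fun do under eq_Rintegral do rewrite -mulrA.
  under eq_Rintegral do rewrite -mulrA.
  rewrite RintegralZl//; last first.
    by apply: bounded_measurable_integrable => //; exact: bounded_measurableM.
  rewrite (_ : (fun k => _) = (fun k => c * \int[mu]_x (u k x * g k x))).
    by apply: cvgM => //; exact: cvg_cst.
  apply/funext => k; rewrite RintegralZl//.
  by apply: bounded_measurable_integrable => //; exact: bounded_measurableM.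
Qed.

Lemma eq_weak_limit u w u1 w1 : (forall k, u1 k =1 u k) -> w1 =1 w ->
  weak_limit u w -> weak_limit u1 w1.
Proof.
move=> uu1 ww1; have -> : u1 = u by apply/funext => k; apply/funext/uu1.
by have -> : w1 = w by apply/funext/ww1.
Qed.

Lemma weak_limit_sum I (s : seq I) u w : weak_limit (fun _ => cst 1) (cst 1) ->
  (forall i, weak_limit (u i) (w i)) ->
  weak_limit (fun k x => \sum_(i <- s) u i k x) (fun y => \sum_(i <- s) w i y).
Proof.
move=> c1 uw; elim: s => [|i s IHs].
  apply: eq_weak_limit (weak_limitZ 0 c1) => [k x|y].
    by rewrite big_nil mul0r.
  by rewrite big_nil mul0r.
apply: eq_weak_limit (weak_limitD (uw i) IHs) => [k x|y]; by rewrite big_cons.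
Qed.

Lemma weak_limit_approx u w :
  (forall k, bounded_measurable (u k)) -> bounded_measurable w ->
  (forall e, 0 < e -> exists u' w', [/\ weak_limit u' w',
     forall k, {ae mu, forall x, `|u k x - u' k x| <= e} &
     {ae mu', forall y, `|w y - w' y| <= e}]) ->
  weak_limit u w.
Proof.
move=> bu bw uw; split => //; apply/cvgrPdist_lt => e e0.
have [G gG] := ubg; have [_ [G' gG']] := bg'.
(* [K] bounds the total mass of both weights, and the summand 1 keeps it positive. An approximation
   within e / 4 / K costs e / 4 on each side, and e / 4 is left for the convergence. *)
have [K [K0 GK GK']] : exists K, [/\ 0 < K, `|G| * fine (mu setT) <= K &
    `|G'| * fine (mu' setT) <= K].
  exists (`|G| * fine (mu setT) + `|G'| * fine (mu' setT) + 1); split.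
  - by rewrite ltr_wpDl// addr_ge0// mulr_ge0// fine_ge0.
  - by rewrite -addrA lerDl addr_ge0// mulr_ge0// fine_ge0.
  - by rewrite addrAC lerDr addr_ge0// mulr_ge0// fine_ge0.
pose c := e / 4 / K.
have c0 : 0 < c by rewrite !divr_gt0.
have [u' [w' [[bu' bw' cu'] uu' ww']]] := uw _ c0.
have cK : c * K = e / 4 by rewrite /c divfK// gt_eqF.
have h d0 (S : measurableType d0) (m : {finite_measure set S -> \bar R}) v v' h H :
    bounded_measurable v -> bounded_measurable v' -> bounded_measurable h ->
    (forall x, `|h x| <= H) -> `|H| * fine (m setT) <= K ->
    {ae m, forall x, `|v x - v' x| <= c} ->
    `|\int[m]_x (v x * h x) - \int[m]_x (v' x * h x)| <= e / 4.
  move=> bv bv' bh hH HK vv'; rewrite -cK.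
  apply: le_trans (_ : c * `|H| * fine (m setT) <= _); last first.
    by rewrite -mulrA ler_pM2l.
  apply: Rintegral_dist_le.
  - exact: bounded_measurableM.
  - exact: bounded_measurableM.
  - by rewrite mulr_ge0// ltW.
  - apply: filterS vv' => x vv'.
    by rewrite -mulrBl normrM ler_pM// (le_trans (hH x))// ler_norm.
have hw := h _ _ mu' _ _ _ _ bw bw' bg' gG' GK' ww'.
move/cvgrPdist_lt : cu' => /(_ (e / 4)); rewrite divr_gt0// => /(_ isT).
apply: filterS => k cu'.
have hu := h _ _ mu _ _ _ _ (bu k) (bu' k) (bg k) (gG k) GK (uu' k).
move: hw cu' hu; rewrite !ltr_norml !ler_norml => /andP[? ?] /andP[? ?] /andP[? ?].
apply/andP; split; lra.
Qed.

End weak_limit.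

Lemma ae_forall_countable d (T : measurableType d) (R : realType)
    (mu : {measure set T -> \bar R}) (I : countType) (P : I -> T -> Prop) :
  (forall i, \forall x \ae mu, P i x) -> \forall x \ae mu, forall i, P i x.
Proof.
move=> aeP; have := @ae_foralln _ _ _ mu
  (fun k x => if unpickle k is Some i then P i x else True).
move=> []; first by move=> k; case: unpickle => [i|]; [exact: aeP|exact: aeW].
by move=> N [mN N0 PN]; exists N; split => // x /= nP; apply: PN => /= h; apply: nP => i;
  have := h (pickle i); rewrite pickleK.
Qed.

Lemma unit_interval_modulus (R : realType) (f : R -> R) e : continuous f -> 0 < e ->
  exists m : nat, forall y z, 0 <= y <= 1 -> 0 <= z <= 1 ->
    `|y - z| <= m.+1%:R^-1 -> `|f y - f z| <= e.
Proof.
move=> cf e0; have /compact_near_coveringP := @segment_compact R 0 1.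
move=> /(_ nat \oo (fun m y => forall z, `|y - z| <= m.+1%:R^-1 -> `|f y - f z| <= e)) [].
  move=> y _.
  have e2 : 0 < e / 2 by rewrite divr_gt0.
  have /cvgrPdist_lt/(_ _ e2)/nbhs_ballP[r /= r0 fr] := cf y.
  have r2 : 0 < r / 2 by rewrite divr_gt0.
  near=> y' m => z y'z.
  have yy' : `|y - y'| < r / 2 by near: y'; apply/nbhs_ballP; exists (r / 2).
  have mr : m.+1%:R^-1 < r / 2 by near: m; exact: (near_infty_natSinv_lt (PosNum r2)).
  have fy' : `|f y - f y'| < e / 2.
    by apply: fr; rewrite /ball/= (lt_trans yy')// ltr_pdivrMr// ltr_pMr// ltr1n.
  have fz : `|f y - f z| < e / 2.
    apply: fr; rewrite /ball/= -(subrKA y') (le_lt_trans (ler_normD _ _))//.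
    by rewrite [ltRHS]splitr ltrD// (le_lt_trans y'z).
  rewrite -(subrKA (f y)) (le_trans (ler_normD _ _))// [leRHS]splitr lerD//.
    by rewrite distrC ltW.
  exact: ltW.
move=> M _ MP; exists M => y z y01 z01; apply: (MP M (leqnn M)).
by rewrite /= in_itv.
Unshelve. all: by end_near. Qed.

(* The sum telescopes up to the largest [i] with [b i]. *)
Lemma step_approximation (R : realType) (f : R -> R) m e (b : nat -> bool) y :
  (forall y z, 0 <= y <= 1 -> 0 <= z <= 1 ->
    `|y - z| <= m.+1%:R^-1 -> `|f y - f z| <= e) ->
  0 <= y <= 1 -> b 0 -> (forall i j, (i <= j)%N -> b j -> b i) ->
  (forall i, (i <= m.+1)%N -> b i -> i%:R / m.+1%:R <= y) ->
  (forall i, (i <= m.+1)%N -> ~~ b i -> y <= i%:R / m.+1%:R) ->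
  `|f y - (f 0 + \sum_(0 <= i < m.+1)
      (f (i.+1%:R / m.+1%:R) - f (i%:R / m.+1%:R)) * (b i.+1)%:R)| <= e.
Proof.
move=> fe y01 b0 bdown blow bup.
have [j [jm bj bj1 ->]] : exists j, [/\ (j <= m.+1)%N, b j,
    j = m.+1 \/ ~~ b j.+1 & f 0 + \sum_(0 <= i < m.+1)
      (f (i.+1%:R / m.+1%:R) - f (i%:R / m.+1%:R)) * (b i.+1)%:R
    = f (j%:R / m.+1%:R)].
  move: {1 2 3}m.+1 => k; elim: k => [|k [j [jk bj bj1 IHk]]].
    by exists 0%N; split => //; [left|rewrite big_nil addr0 mul0r].
  rewrite big_nat_recr//= addrA IHk; have [bk|bk] := boolP (b k.+1).
    exists k.+1; split => //; first by left.
    case: bj1 => [->|]; first by rewrite mulr1 addrC subrK.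
    have [->|jk1] := eqVneq j k; first by rewrite bk.
    by rewrite (bdown _ k.+1)// ltnS.
  exists j; split => //; first exact: leqW; last by rewrite mulr0 addr0.
  by right; case: bj1 => [->|].
have jy := blow _ jm bj.
apply: fe => //; first by rewrite divr_ge0//= ler_pdivrMr// mul1r ler_nat.
rewrite ger0_norm ?subr_ge0//.
case: bj1 => [jE|bj1].
  rewrite jE divff// in jy *; have /andP[_ y1] := y01.
  by rewrite (le_trans _ (_ : 0 <= _))// ?invr_ge0// subr_le0.
have [jE|jneq] := eqVneq j m.+1.
  rewrite jE divff// in jy *; have /andP[_ y1] := y01.
  by rewrite (le_trans _ (_ : 0 <= _))// ?invr_ge0// subr_le0.
have := bup j.+1; rewrite ltn_neqAle jneq jm => /(_ isT bj1).
by rewrite -natr1 mulrDl mul1r lerBlDl.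
Qed.

(** The hypothesis is the case where [g] is an indicator. A bounded [g] is an affine image of a
    function with values in [0, 1], which is a uniform limit of step functions. *)
Lemma weak_star_bounded d (T : measurableType d) (R : realType)
    (mu : {finite_measure set T -> \bar R}) (h : nat -> T -> R) (F g : T -> R) :
  (forall k, measurable_fun setT (h k)) -> (forall k x, 0 <= h k x <= 1) ->
  bounded_measurable F ->
  (forall A, measurable A ->
    \int[mu]_(x in A) h k x @[k --> \oo] --> \int[mu]_(x in A) F x) ->
  bounded_measurable g ->
  \int[mu]_x (h k x * g x) @[k --> \oo] --> \int[mu]_x (F x * g x).
Proof.
move=> mh h01 bF hF bg.
have ubh : exists M, forall k x, `|h k x| <= M.
  by exists 1 => k x; have /andP[h0 ?] := h01 k x; rewrite ger0_norm.
have bh k : bounded_measurable (h k).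
  by split => //; have [M hM] := ubh; exists M => x; exact: hM.
(* Here [h] is the weight of [weak_limit] and the test function [g] its integrand. *)
suff : weak_limit mu mu h F (fun _ => g) g.
  by move=> [_ _]; under eq_fun do under eq_Rintegral do rewrite mulrC;
    under [in X in _ --> X -> _]eq_Rintegral do rewrite mulrC.
have bind A : measurable A -> bounded_measurable (\1_A : T -> R).
  move=> mA; split; first exact: measurable_indic.
  by exists 1 => x; rewrite indicE; case: (_ \in _); rewrite ?normr1 ?normr0.
have indP A : measurable A -> weak_limit mu mu h F (fun _ => \1_A) \1_A.
  move=> mA; split; [by move=> _; exact: bind|exact: bind|].
  have E u : \int[mu]_x (\1_A x * u x) = \int[mu]_(x in A) u x.
    rewrite [RHS]Rintegral_mkcond; apply: eq_Rintegral => x _.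
    by rewrite patchE indicE; case: (_ \in _); rewrite ?mul1r ?mul0r.
  by rewrite E; under eq_fun do rewrite E; exact: hF.
have cstP c : weak_limit mu mu h F (fun _ => cst c) (cst c).
  apply: eq_weak_limit (weak_limitZ bh bF c (indP _ measurableT)) => [k x|y];
    by rewrite indicT mulr1.
have [mg [M0 gM0]] := bg.
pose M := `|M0| + 1; have M0' : 0 < M by rewrite ltr_wpDl.
have gM x : `|g x| <= M.
  by rewrite (le_trans (gM0 x))// (le_trans (ler_norm _))// lerDl.
pose y x := (g x + M) / (2 * M).
have M2 : 0 < 2 * M by rewrite mulr_gt0.
have y01 x : 0 <= y x <= 1.
  have := gM x; rewrite ler_norml => /andP[g1 g2]; rewrite /y.
  by rewrite divr_ge0 ?ler_pdivrMr//=; lra.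
have my : measurable_fun setT y.
  by apply: measurable_funM => //; exact: measurable_funD.
have gE x : g x = - M + 2 * M * y x.
  by rewrite /y mulrC divfK ?gt_eqF// addrC addrK.
suff yP : weak_limit mu mu h F (fun _ => y) y.
  apply: eq_weak_limit (weak_limitD bh bF (cstP (- M)) (weak_limitZ bh bF (2 * M) yP)).
    by move=> k x; rewrite gE.
  by move=> x; rewrite gE.
have by_ : bounded_measurable y.
  by split => //; exists 1 => x; have /andP[? ?] := y01 x; rewrite ger0_norm.
apply: weak_limit_approx => // e e0.
have [m _ /(_ m (leqnn m))/= me] := near_infty_natSinv_lt (PosNum e0).
pose b x i := i%:R / m.+1%:R <= y x.
pose c i : R := i.+1%:R / m.+1%:R - i%:R / m.+1%:R.
(* This is [y x] rounded down to a multiple of 1 / (m + 1), that is, [step_approximation] for the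
   identity function. *)
pose s x := 0 + \sum_(0 <= i < m.+1) c i * (b x i.+1)%:R.
exists (fun _ => s), s.
have sP : weak_limit mu mu h F (fun _ => s) s.
  apply: (weak_limitD bh bF (cstP 0)).
  apply: (weak_limit_sum bh bF _ (cstP 1)) => i.
  apply: (weak_limitZ bh bF).
  have mA : measurable [set x | i.+1%:R / m.+1%:R <= y x].
    have := measurable_fun_ler (@measurable_cst _ _ T R setT (i.+1%:R / m.+1%:R)) my.
    by move=> /(_ measurableT [set true]); rewrite setTI; apply.
  apply: eq_weak_limit (indP _ mA) => [k x|x]; rewrite indicE /b.
    by case: (boolP (_ <= y x)) => yx; [rewrite mem_set|rewrite memNset//; exact/negP].
  by case: (boolP (_ <= y x)) => yx; [rewrite mem_set|rewrite memNset//; exact/negP].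
have ys x : `|y x - s x| <= e.
  apply: le_trans (ltW me).
  apply: (@step_approximation R id m m.+1%:R^-1 (b x)) => //.
  - by rewrite /b mul0r; have /andP[] := y01 x.
  - move=> i j ij; apply: le_trans.
    by rewrite ler_pM2r ?invr_gt0// ler_nat.
  - by move=> i _; rewrite /b -ltNge => /ltW.
by split => // [k|]; exact: aeW.
Qed.

Section finite_product.
Context d1 d2 (T1 : measurableType d1) (T2 : measurableType d2) (R : realType).
Variables (m1 : {finite_measure set T1 -> \bar R})
          (m2 : {finite_measure set T2 -> \bar R}).

Definition finite_product : set (T1 * T2) -> \bar R := (m1 \x m2)%E.

HB.instance Definition _ := Measure.on finite_product.

Let finite_product_fin : fin_num_fun finite_product.
Proof.
apply: lty_fin_num_fun; change ((m1 \x m2) setT < +oo)%E.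
rewrite -setXTT product_measure1E//.
apply: lte_mul_pinfty => //; first exact: fin_num_measure.
by rewrite -ge0_fin_numE//; exact: fin_num_measure.
Qed.

HB.instance Definition _ := Measure_isFinite.Build _ _ _ finite_product
  finite_product_fin.

End finite_product.

Section young_1D.
Context d (T : measurableType d) (R : realType).
Variables (mu : {finite_measure set T -> \bar R})
          (P : probability (measurableTypeR R) R).
Hypothesis P_unif : forall a, 0 <= a <= 1 -> P [set t | a < t] = (1 - a)%:E.

Local Notation muP := (finite_product mu P).

(** Serves at the threshold 0, where F_0 = 0 almost everywhere: F_0(x) < t then holds for almost
    every (x, t). *)
Lemma ae_snd_gt0 : {ae muP, forall z, 0 < z.2}.
Proof.
pose A : set (measurableTypeR R) := [set t | 0 < t].
have mA : measurable A by rewrite /A -set_itvoy.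
have PA : P (~` A) = 0%E.
  by rewrite probability_setC// P_unif ?lexx ?ler01// subr0 subee.
have mX : measurable ([set: T] `*` ~` A).
  by apply: measurableX => //; exact: measurableC.
exists (setT `*` ~` A); split => //.
- change ((mu \x P) (setT `*` ~` A) = 0)%E.
  rewrite product_measure1E; [|exact: measurableT|exact: measurableC].
  by rewrite [X in (_ * X)%E]PA mule0.
Qed.

Lemma measurable_fst_lt (F : T -> R) : measurable_fun setT F ->
  measurable_fun setT (fun z : T * measurableTypeR R => F z.1 < z.2).
Proof.
move=> mF; apply: measurable_fun_ltr; last exact: measurable_snd.
exact: measurableT_comp mF measurable_fst.
Qed.

Lemma bounded_measurable_fst (g : T -> R) : bounded_measurable g ->
  bounded_measurable (fun z : T * measurableTypeR R => g z.1).
Proof.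
move=> [mg [M gM]]; split; last by exists M.
exact: measurableT_comp mg measurable_fst.
Qed.

(** [P] gives [F x < t] the mass 1 - F x. For F = F_a this is the limit density of the indicators of
    [a <= Z_k]. *)
Lemma Rintegral_fst_lt (F g : T -> R) : measurable_fun setT F ->
  (forall x, 0 <= F x <= 1) -> bounded_measurable g ->
  \int[muP]_z ((F z.1 < z.2)%R%:R * g z.1) = \int[mu]_x ((1 - F x) * g x).
Proof.
move=> mF F01 bg; rewrite /Rintegral; congr fine.
rewrite -(integral12_prod_meas1 (m1 := mu) (m2 := P)
  (f := fun z => ((F z.1 < z.2)%R%:R * g z.1)%:E)); last first.
  have H := bounded_measurable_integrable muP measurableT (bounded_measurableM
    (bounded_measurable_bool R (measurable_fst_lt mF)) (bounded_measurable_fst bg)).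
  exact: H.
apply: eq_integral => x _; rewrite /fubini_F/=.
have mA : measurable [set t : measurableTypeR R | F x < t] by rewrite -set_itvoy.
rewrite (eq_integral (fun t : measurableTypeR R =>
  ((g x)%:E * (\1_[set t | F x < t] t)%:E)%E)); last first.
  move=> t _; rewrite indicE mulrC EFinM.
  have [Fxt|Fxt] := boolP (F x < t); first by rewrite mem_set.
  by rewrite memNset//; exact/negP.
rewrite integralZl//; last exact: integrable_indic.
rewrite integral_indic// setIT mulrC [RHS]EFinM; congr (_ * _)%E.
exact: P_unif.
Qed.

Lemma Rintegral_fst (g : T -> R) : bounded_measurable g ->
  \int[muP]_z g z.1 = \int[mu]_x g x.
Proof.
move=> bg; rewrite /Rintegral; congr fine.
rewrite -(integral12_prod_meas1 (m1 := mu) (m2 := P) (f := fun z => (g z.1)%:E)).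
  apply: eq_integral => x _; rewrite /fubini_F/= (@integral_cst _ _ _ P)//.
  by rewrite [X in (_ * X)%E](@probability_setT _ _ _ P) mule1.
exact: (bounded_measurable_integrable muP measurableT (bounded_measurable_fst bg)).
Qed.

Lemma ae_fst (Q : T -> Prop) : {ae mu, forall x, Q x} -> {ae muP, forall z, Q z.1}.
Proof.
move=> [N [mN N0 QN]]; exists (N `*` setT); split.
- exact: measurableX.
- change ((mu \x P) (N `*` setT) = 0)%E.
  by rewrite product_measure1E// [X in (X * _)%E]N0 mul0e.
- by move=> z /= Qz; split => //; exact: QN.
Qed.

Variables (F : rat -> T -> R).
Hypotheses (mF : forall q, measurable_fun setT (F q))
  (F01 : forall q x, 0 <= F q x <= 1).

(** An enumeration of the rationals q in [0, 1] with F_q(x) < t; their supremum is the generalized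
    inverse of a |-> F_a(x) at t. A countable supremum is measurable in (x, t), and the filler 0 is
    harmless because the inverse is nonnegative. *)
Definition quantile_seq (m : nat) (z : T * measurableTypeR R) : R :=
  if (unpickle m : option rat) is Some q then
    if (0 <= q <= 1) && (F q z.1 < z.2) then ratr q else 0
  else 0.

Definition quantile (z : T * measurableTypeR R) : R := sups (quantile_seq ^~ z) 0.

Lemma quantile_seq01 m z : 0 <= quantile_seq m z <= 1.
Proof.
rewrite /quantile_seq; case: unpickle => [q|]; last by rewrite lexx ler01.
case: ifPn; last by rewrite lexx ler01.
by move=> /andP[/andP[q0 q1] _]; rewrite ler0q q0 -[leRHS](rmorph1 (@ratr R)) ler_rat.
Qed.

Let quantile_seq_ub z : has_ubound (range (quantile_seq ^~ z)).
Proof. by exists 1 => _ [m _ <-]; have /andP[] := quantile_seq01 m z. Qed.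

Let sup_quantile z : quantile z = sup (range (quantile_seq ^~ z)).
Proof.
rewrite /quantile /sups /sdrop; congr sup; apply/seteqP.
by split=> [_ [m _ <-]|_ [m _ <-]]; exists m.
Qed.

Lemma measurable_quantile : measurable_fun setT quantile.
Proof.
apply: measurable_fun_sups => // m; rewrite /quantile_seq.
case: unpickle => [q|]; last exact: measurable_cst.
case: (0 <= q <= 1) => /=; last exact: measurable_cst.
by apply: measurable_fun_ifT => //; exact: measurable_fst_lt.
Qed.

Lemma quantile_ge q z : 0 <= q <= 1 -> F q z.1 < z.2 -> ratr q <= quantile z.
Proof.
move=> q01 Fq; rewrite sup_quantile; apply: sup_ubound => //.
by exists (pickle q) => //; rewrite /quantile_seq pickleK q01 Fq.
Qed.

Lemma quantile_le a z : 0 <= a ->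
  (forall q, 0 <= q <= 1 -> F q z.1 < z.2 -> ratr q <= a) -> quantile z <= a.
Proof.
move=> a0 Fa; rewrite sup_quantile; apply: ge_sup => //.
  by exists (quantile_seq 0 z); exists 0%N.
move=> _ [m _ <-]; rewrite /quantile_seq; case: unpickle => [q|//].
by case: ifPn => // /andP[q01 Fq]; exact: Fa.
Qed.

Lemma quantile01 z : 0 <= quantile z <= 1.
Proof.
apply/andP; split.
  rewrite sup_quantile; have /andP[h _] := quantile_seq01 0 z.
  by apply: le_trans h _; apply: sup_ubound => //; exists 0%N.
by apply: quantile_le => // q /andP[_ q1] _; rewrite -[leRHS](rmorph1 (@ratr R)) ler_rat.
Qed.

End young_1D.

Lemma ae_eq_Rintegral d (T : measurableType d) (R : realType)
    (mu : {measure set T -> \bar R}) (A : set T) (f g : T -> R) :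
  measurable A -> measurable_fun setT f -> measurable_fun setT g ->
  {ae mu, forall x, f x = g x} -> \int[mu]_(x in A) f x = \int[mu]_(x in A) g x.
Proof.
move=> mA mf mg fg; rewrite /Rintegral; congr fine; apply: ae_eq_integral => //.
- by apply/measurable_EFinP; exact: measurable_funTS.
- by apply/measurable_EFinP; exact: measurable_funTS.
- by apply: filterS fg => x -> _.
Qed.

Lemma continuous_unit_interval_bounded (R : realType) (f : R -> R) : continuous f ->
  exists M, forall y, 0 <= y <= 1 -> `|f y| <= M.
Proof.
move=> cf; have [|c _ fc] := @EVT_max R (Num.norm \o f) 0 1 ler01.
  apply: continuous_subspaceT => y.
  by apply: continuous_comp; [exact: cf|exact: norm_continuous].
by exists `|f c| => y y01; apply: fc; rewrite in_itv.
Qed.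

(** [a <= Z_k] and [F_a < t] are threshold events: when they occur, Z_k, respectively tau, is at
    least a, and otherwise at most a. Hence f(Z_k) and f(tau) are uniformly close to the same
    combination of such indicators, whose integrals converge by the choice of F_a. Only weak
    inequalities enter, so jumps of a |-> F_a(x) need no care. *)
Theorem young_measure_1D d (T : measurableType d) (R : realType)
    (mu : {finite_measure set T -> \bar R})
    (P : probability (measurableTypeR R) R)
    (P_unif : forall a, 0 <= a <= 1 -> P [set t | a < t] = (1 - a)%:E)
    (J : countType) (G : J -> set T) (Z : nat -> T -> R) :
  @measurable _ T = <<s range G>> -> setI_closed (range G) ->
  (forall k, measurable_fun setT (Z k)) -> (forall k x, 0 <= Z k x <= 1) ->
  exists2 phi : nat -> nat, {homo phi : i j / (i < j)%N} &
  exists2 tau : T * measurableTypeR R -> R,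
    measurable_fun setT tau & forall g f, bounded_measurable g -> continuous f ->
      weak_limit mu (finite_product mu P) (fun _ => g) (fun z => g z.1)
        (fun k x => f (Z (phi k) x)) (fun z => f (tau z)).
Proof.
move=> GE GI mZ Z01; set muP := finite_product mu P.
pose f0 (q : rat) k x : R := (Z k x < ratr q)%R%:R.
have mf0 q k : measurable_fun setT (f0 q k).
  have [] // := bounded_measurable_bool R (b := fun x => Z k x < ratr q).
  by apply: measurable_fun_ltr => //; exact: measurable_cst.
have f001 q k x : 0 <= f0 q k x <= 1 by rewrite /f0 ler0n lern1; case: (_ < _).
have [phi hphi [F0 /all_and3[mF0 iF0 cF0]]] := weak_star_compactness mu GE GI mf0 f001.
exists phi => //.
have f0P q k := Rintegral_dominated_additive mu (mf0 q k) (f001 q k).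
(* Clipping makes the bounds 0 and 1 hold everywhere; monotonicity in q and F_0 = 0 will hold only
   almost everywhere. *)
pose F q x := Num.min 1 (Num.max 0 (F0 q x)).
have mF q : measurable_fun setT (F q).
  by apply: measurable_minr => //; exact: measurable_maxr.
have F01 q x : 0 <= F q x <= 1.
  by rewrite /F ge_min lexx/= le_min ler01 le_max lexx.
have ae_F q : {ae mu, forall x, F q x = F0 q x}.
  have h0 : {ae mu, forall x, 0 <= F0 q x}.
    apply: (ae_le_of_Rintegral (mu := mu) (f := cst 0)) => //.
      exact: finite_measure_integrable_cst.
    move=> A mA; rewrite Rintegral_cst// mul0r.
    apply: cvgr_to_ge (cF0 q _ mA) _.
    by apply: nearW => k; have [_ /(_ _ mA)/andP[]] := f0P q (phi k).
  have h1 : {ae mu, forall x, F0 q x <= 1}.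
    apply: (ae_le_of_Rintegral (mu := mu) (g := cst 1)) => //.
      exact: finite_measure_integrable_cst.
    move=> A mA; rewrite Rintegral_cst// mul1r.
    apply: cvgr_to_le (cF0 q _ mA) _.
    by apply: nearW => k; have [_ /(_ _ mA)/andP[]] := f0P q (phi k).
  apply: filterS2 h0 h1 => x h0 h1.
  by rewrite /F max_r// min_r.
have ae_F_homo : {ae mu, forall x, forall qr : rat * rat, qr.1 <= qr.2 ->
    F qr.1 x <= F qr.2 x}.
  apply: ae_forall_countable => -[q r] /=.
  have [qr|] := boolP (q <= r); last by move=> _; exact: aeW.
  suff h : {ae mu, forall x, F0 q x <= F0 r x}.
    by apply: filterS3 h (ae_F q) (ae_F r) => x h -> -> _.
  apply: ae_le_of_Rintegral => // A mA.
  apply: ler_cvg_to (cF0 q _ mA) (cF0 r _ mA) _.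
  apply: nearW => k; apply: le_Rintegral => //.
  - apply: bounded_measurable_integrable => //; split => //.
    by exists 1 => x; have /andP[h0 ?] := f001 q (phi k) x; rewrite ger0_norm.
  - apply: bounded_measurable_integrable => //; split => //.
    by exists 1 => x; have /andP[h0 ?] := f001 r (phi k) x; rewrite ger0_norm.
  - move=> x _; rewrite /f0 ler_nat.
    case: (boolP (_ < ratr q)) => // Zq.
    by rewrite (lt_le_trans Zq)// ler_rat.
have ae_F_0 : {ae mu, forall x, F 0 x = 0}.
  suff h : {ae mu, forall x, F0 0 x <= 0}.
    apply: filterS2 h (ae_F 0) => x h E; apply/eqP.
    by rewrite eq_le {1}E h; have /andP[->] := F01 0 x.
  apply: (ae_le_of_Rintegral (mu := mu) (g := cst 0)) => //.
    exact: finite_measure_integrable_cst.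
  move=> A mA; rewrite Rintegral_cst// mul0r.
  apply: cvgr_to_le (cF0 0 _ mA) _; apply: nearW => k.
  rewrite (@eq_Rintegral _ _ _ mu A (cst 0)); first by rewrite Rintegral_cst// mul0r.
  move=> x _; rewrite /f0 rmorph0 ltNge; have /andP[-> _] := Z01 (phi k) x.
  by [].
pose tau := quantile F.
exists tau; first exact: measurable_quantile.
move=> g f bg cf.
have bgm k : bounded_measurable ((fun _ : nat => g) k) by [].
have ubg : exists M, forall (k : nat) x, `|g x| <= M.
  by have [_ [M gM]] := bg; exists M.
have bg1 : bounded_measurable (fun z : T * measurableTypeR R => g z.1).
  exact: bounded_measurable_fst.
have mtau : measurable_fun setT tau by exact: measurable_quantile.
have tau01 z : 0 <= tau z <= 1 by exact: quantile01.
have bb h : bounded_measurable h -> mu.-integrable setT (EFin \o h).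
  exact: bounded_measurable_integrable.
have bf0 q k : bounded_measurable (f0 q k).
  split => //; exists 1 => x.
  by have /andP[h0 ?] := f001 q k x; rewrite ger0_norm.
have bF q : bounded_measurable (F q).
  split => //; exists 1 => x.
  by have /andP[h0 ?] := F01 q x; rewrite ger0_norm.
have cstP c : weak_limit mu muP (fun _ => g) (fun z => g z.1) (fun _ => cst c) (cst c).
  suff h1 : weak_limit mu muP (fun _ => g) (fun z => g z.1) (fun _ => cst 1) (cst 1).
    by apply: eq_weak_limit (weak_limitZ bgm bg1 c h1) => [k x|x] /=; rewrite mulr1.
  split; [by move=> _; exact: bounded_measurable_cst|exact: bounded_measurable_cst|].
  under eq_fun do under eq_Rintegral do rewrite mul1r.
  have -> : \int[muP]_y (cst 1 y * g y.1) = \int[mu]_x g x.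
    by under eq_Rintegral do rewrite mul1r; exact: Rintegral_fst.
  exact: cvg_cst.
have indP q : weak_limit mu muP (fun _ => g) (fun z => g z.1)
    (fun k x => (ratr q <= Z (phi k) x)%R%:R) (fun z => (F q z.1 < z.2)%R%:R).
  split.
  - move=> k; apply: bounded_measurable_bool.
    by apply: measurable_fun_ler => //; exact: measurable_cst.
  - by apply: bounded_measurable_bool; exact: measurable_fst_lt.
  - rewrite Rintegral_fst_lt//.
    have E (h : T -> R) : bounded_measurable h ->
        \int[mu]_x ((1 - h x) * g x) = \int[mu]_x g x - \int[mu]_x (h x * g x).
      move=> bh; under eq_Rintegral do rewrite mulrBl mul1r.
      by rewrite RintegralB//; apply: bb => //; exact: bounded_measurableM.
    rewrite E//; have : \int[mu]_x (f0 q (phi k) x * g x) @[k --> \oo] -->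
        \int[mu]_x (F q x * g x).
      apply: weak_star_bounded => // A mA.
      by rewrite (ae_eq_Rintegral mA (mF q) (mF0 q) (ae_F q)); exact: cF0.
    move=> cv; rewrite (_ : (fun k => _) = (fun k => \int[mu]_x g x -
        \int[mu]_x (f0 q (phi k) x * g x))).
      by apply: cvgB => //; exact: cvg_cst.
    apply/funext => k; rewrite -E//; apply: eq_Rintegral => x _.
    by rewrite /f0 leNgt; case: (_ < _); rewrite ?subrr ?subr0.
apply: weak_limit_approx => //.
- move=> k; split.
    by apply: measurableT_comp; [exact: continuous_measurable_fun|exact: mZ].
  have [M fM] := continuous_unit_interval_bounded cf.
  by exists M => x; exact: fM.
- split.
    by apply: measurableT_comp; [exact: continuous_measurable_fun|exact: mtau].
  have [M fM] := continuous_unit_interval_bounded cf.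
  by exists M => x; exact: fM.
move=> e e0; have [m fm] := unit_interval_modulus cf e0.
pose aq i : rat := i%:R / m.+1%:R.
have aqE i : ratr (aq i) = i%:R / m.+1%:R :> R.
  by rewrite /aq fmorph_div !rmorph_nat.
have aq01 i : (i <= m.+1)%N -> 0 <= aq i <= 1.
  by move=> im; rewrite divr_ge0//= ler_pdivrMr// mul1r ler_nat.
pose c i := f (i.+1%:R / m.+1%:R) - f (i%:R / m.+1%:R).
exists (fun k x => f 0 + \sum_(0 <= i < m.+1) c i * (ratr (aq i.+1) <= Z (phi k) x)%R%:R).
exists (fun z => f 0 + \sum_(0 <= i < m.+1) c i * (F (aq i.+1) z.1 < z.2)%R%:R).
split.
- have sP := weak_limit_sum bgm bg1 (index_iota 0 m.+1) (cstP 1)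
    (fun i => weak_limitZ bgm bg1 (c i) (indP (aq i.+1))).
  exact: (weak_limitD bgm bg1 (cstP (f 0)) sP).
- move=> k; apply: aeW => x.
  apply: (step_approximation (b := fun i => ratr (aq i) <= Z (phi k) x)) => //.
  + by rewrite aqE mul0r; have /andP[] := Z01 (phi k) x.
  + move=> i j ij; apply: le_trans.
    by rewrite !aqE ler_pM2r ?invr_gt0// ler_nat.
  + by move=> i _; rewrite aqE.
  + by move=> i _; rewrite aqE -ltNge => /ltW.
- apply: filterS3 (ae_fst P ae_F_homo) (ae_fst P ae_F_0) (ae_snd_gt0 mu P_unif).
  move=> z Fhomo F0' z0.
  apply: (step_approximation (b := fun i => F (aq i) z.1 < z.2)) => //.
  + by rewrite /aq mul0r F0'.
  + move=> i j ij; apply: le_lt_trans; apply: (Fhomo (_, _)) => /=.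
    by rewrite ler_pM2r ?invr_gt0// ler_nat.
  + by move=> i im Fz; rewrite -aqE; apply: quantile_ge => //; exact: aq01.
  (* A rational q counted in the supremum has F_q < t, while t is at most the value of F at the grid
     point; monotonicity keeps q below that point. *)
  + move=> i im; rewrite -leNgt => zF; apply: quantile_le; first exact: divr_ge0.
    move=> q _ Fq; rewrite -aqE ler_rat leNgt; apply/negP => iq.
    have := Fhomo (aq i, q) (ltW iq); rewrite leNgt => /negP; apply.
    exact: lt_le_trans Fq zF.
Qed.

(** * Schoenberg's space-filling curve *)

Section expansion.
Variable (R : realType).
Implicit Types (r : R) (d : R^nat).

(** The factor 1 - r gives the weights the total mass 1, so digits in [0, 1] produce a value in
    [0, 1]. With r = 1/2 this is the binary expansion; with r = 1/3 the digits 0 and 1 stand for the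
    ternary digits 0 and 2, so the values lie in the Cantor set. *)
Definition expansion_sum r d N : R := \sum_(0 <= q < N) (1 - r) * r ^+ q * d q.

Definition expansion r d : R := limn (expansion_sum r d).

Lemma expansion_sum_ge r d N M : 0 <= r <= 1 -> (forall q, 0 <= d q <= 1) ->
  (N <= M)%N -> expansion_sum r d N <= expansion_sum r d M.
Proof.
move=> /andP[r0 r1] d01 NM; rewrite /expansion_sum (big_cat_nat (leq0n N) NM)/= lerDl.
apply: sumr_ge0 => q _; have /andP[dq0 _] := d01 q.
by rewrite !mulr_ge0 ?subr_ge0 ?exprn_ge0.
Qed.

(** The weights telescope: (1 - r) r^q = r^q - r^(q+1). *)
Lemma expansion_sum_le r d N M : 0 <= r <= 1 -> (forall q, 0 <= d q <= 1) ->
  (N <= M)%N -> expansion_sum r d M <= expansion_sum r d N + r ^+ N - r ^+ M.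
Proof.
move=> /andP[r0 r1] d01 /subnKC <-; elim: (M - N)%N => [|k IHk].
  by rewrite addn0 addrK.
rewrite addnS /expansion_sum big_nat_recr//= -/(expansion_sum _ _ _).
have /andP[_ d1] := d01 (N + k)%N.
have ht : (1 - r) * r ^+ (N + k) * d (N + k)%N <= r ^+ (N + k) - r ^+ (N + k).+1.
  have -> : r ^+ (N + k) - r ^+ (N + k).+1 = (1 - r) * r ^+ (N + k).
    by rewrite exprS mulrBl mul1r.
  rewrite ler_piMr//.
  by rewrite mulr_ge0 ?subr_ge0 ?exprn_ge0.
by rewrite (le_trans (lerD IHk ht))// addrA subrK.
Qed.

Lemma is_cvg_expansion_sum r d : 0 <= r <= 1 -> (forall q, 0 <= d q <= 1) ->
  cvgn (expansion_sum r d).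
Proof.
move=> r01 d01; apply: nondecreasing_is_cvgn.
  by move=> N M NM; exact: expansion_sum_ge.
exists 1 => _ [M _ <-]; have := expansion_sum_le r01 d01 (leq0n M).
rewrite {2}/expansion_sum big_nil add0r expr0 => /le_trans; apply.
by rewrite gerBl exprn_ge0//; have /andP[] := r01.
Qed.

Lemma expansion_tail r d N : 0 <= r <= 1 -> (forall q, 0 <= d q <= 1) ->
  expansion_sum r d N <= expansion r d <= expansion_sum r d N + r ^+ N.
Proof.
move=> r01 d01; have cd := is_cvg_expansion_sum r01 d01.
apply/andP; split.
  apply: limr_ge => //; exists N => // M /=; exact: expansion_sum_ge.
apply: limr_le => //; exists N => // M /= NM.
apply: le_trans (expansion_sum_le r01 d01 NM) _.
by rewrite gerBl exprn_ge0//; have /andP[] := r01.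
Qed.

Lemma expansion01 r d : 0 <= r <= 1 -> (forall q, 0 <= d q <= 1) ->
  0 <= expansion r d <= 1.
Proof.
move=> r01 d01; have := expansion_tail 0 r01 d01.
by rewrite /expansion_sum big_nil add0r expr0.
Qed.

Lemma expansion_shift r d : 0 <= r <= 1 -> (forall q, 0 <= d q <= 1) ->
  expansion r d = (1 - r) * d 0 + r * expansion r (d \o S).
Proof.
move=> r01 d01; apply: cvg_lim => //; rewrite -cvg_shiftS/=.
rewrite (_ : (fun N => _) = (fun N => (1 - r) * d 0 + r * expansion_sum r (d \o S) N)).
  apply: cvgD; first exact: cvg_cst.
  apply: cvgM; first exact: cvg_cst.
  by apply: is_cvg_expansion_sum => // q; exact: d01.
apply/funext => N; rewrite /expansion_sum big_nat_recl//= expr0 mulr1; congr (_ + _).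
by rewrite mulr_sumr; apply: eq_bigr => q _; rewrite exprS; ring.
Qed.

Lemma expansion_cvg_unique r d y : 0 <= r < 1 -> (forall q, 0 <= d q <= 1) ->
  (forall N, expansion_sum r d N <= y <= expansion_sum r d N + r ^+ N) ->
  expansion r d = y.
Proof.
move=> /andP[r0 r1] d01 hy; apply: cvg_lim => //; apply/cvgrPdist_le => e e0.
have : r ^+ N @[N --> \oo] --> 0 by apply: cvg_expr; rewrite ger0_norm.
move/cvgrPdist_le => /(_ e e0); apply: filterS => N.
rewrite sub0r normrN ger0_norm ?exprn_ge0// => rN; have /andP[h1 h2] := hy N.
by rewrite ger0_norm ?subr_ge0// lerBlDl (le_trans h2)// lerD2l.
Qed.

End expansion.

Section schoenberg.
Variable R : realType.
Implicit Types (z y : R).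

Definition clamp z : R := Num.min 1 (Num.max 0 z).

Lemma clamp01 z : 0 <= clamp z <= 1.
Proof. by rewrite /clamp ge_min lexx/= le_min ler01 le_max lexx. Qed.

Lemma clamp_eq0 z : z <= 0 -> clamp z = 0.
Proof. by move=> z0; rewrite /clamp max_l// min_r. Qed.

Lemma clamp_eq1 z : 1 <= z -> clamp z = 1.
Proof. by move=> z1; rewrite /clamp min_l// le_max z1 orbT. Qed.

Lemma continuous_clamp : continuous clamp.
Proof.
move=> z; apply: continuous_min; first exact: cvg_cst.
by apply: continuous_max; [exact: cvg_cst|exact: cvg_id].
Qed.

(** It is 0 up to 1/3 and 1 from 2/3 on, hence half the first ternary digit of a point of the Cantor
    set; the slope over the middle third makes it continuous. *)
Definition ternary_head z := clamp (3 * z - 1).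

(* On the Cantor set this shifts ternary digits; it is continuous everywhere. *)
Definition ternary_shift z := 3 * z - 2 * ternary_head z.

Definition ternary_digit k z := ternary_head (iter k ternary_shift z).

Lemma continuous_ternary_head : continuous ternary_head.
Proof.
move=> z; apply: (@continuous_comp _ _ _ (fun z => 3 * z - 1) clamp).
  by apply: cvgB; [apply: cvgM; [exact: cvg_cst|exact: cvg_id]|exact: cvg_cst].
exact: continuous_clamp.
Qed.

Lemma continuous_ternary_shift : continuous ternary_shift.
Proof.
move=> z; apply: cvgB; apply: cvgM; [exact: cvg_cst|exact: cvg_id|exact: cvg_cst|].
exact: continuous_ternary_head.
Qed.

Lemma continuous_ternary_digit k : continuous (ternary_digit k).
Proof.
elim: k => [|k IHk] z; first exact: continuous_ternary_head.
rewrite (_ : ternary_digit k.+1 = ternary_digit k \o ternary_shift); last first.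
  by apply/funext => y; rewrite /ternary_digit iterSr.
by apply: continuous_comp; [exact: continuous_ternary_shift|exact: IHk].
Qed.

Let third01 : 0 <= (3^-1 : R) <= 1.
Proof. by rewrite invr_ge0 ler0n invf_le1 ?ler1n. Qed.

(** A first digit 0 puts the point in [0, 1/3] and a first digit 1 puts it in [2/3, 1], where
    [ternary_head] is exact. [ternary_shift] then removes that digit and the argument repeats. *)
Lemma ternary_digit_expansion (b : nat -> bool) k :
  ternary_digit k (expansion 3^-1 (fun q => (b q)%:R)) = (b k)%:R.
Proof.
have b01 (c : nat -> bool) q : 0 <= ((c q)%:R : R) <= 1 by case: (c q); rewrite ?lexx ?ler01.
have E (c : nat -> bool) : expansion 3^-1 (fun q => (c q)%:R : R) =
    3^-1 * (2 * (c 0)%:R + expansion 3^-1 (fun q => (c q.+1)%:R)).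
  rewrite (expansion_shift third01 (b01 c)) /comp; set E1 := expansion _ _.
  by field.
have H (c : nat -> bool) : ternary_head (expansion 3^-1 (fun q => (c q)%:R)) = (c 0)%:R.
  have /andP[e0 e1] := expansion01 third01 (b01 (c \o S)).
  rewrite E /ternary_head mulrA mulfV// mul1r; case: (c 0%N) => /=.
    by rewrite clamp_eq1//= mulr1 -addrA addrC; move: e0 => /=; lra.
  by rewrite clamp_eq0//= mulr0 add0r; move: e1 => /=; lra.
elim: k b => [|k IHk] b; first exact: H.
rewrite /ternary_digit iterSr -/(ternary_digit _ _) /ternary_shift H.
by rewrite E mulrA mulfV// mul1r addrC addKr IHk.
Qed.

Definition binary_head y := 2^-1 <= y.
Definition binary_shift y := 2 * y - (binary_head y)%:R.
Definition binary_digit k y := binary_head (iter k binary_shift y).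

Lemma binary_shift01 y : 0 <= y <= 1 -> 0 <= binary_shift y <= 1.
Proof.
move=> y01; rewrite /binary_shift /binary_head; case: (leP 2^-1 y) => y2 /=; lra.
Qed.

(** After N digits the error is 2^-N times the N-th iterate of the shift, which stays in [0, 1]. *)
Lemma expansion_binary_digit y : 0 <= y <= 1 ->
  expansion 2^-1 (fun q => (binary_digit q y)%:R) = y.
Proof.
move=> y01; apply: expansion_cvg_unique.
- by rewrite invr_ge0 ler0n invf_lt1 ?ltr1n.
- by move=> q; case: binary_digit; rewrite ?lexx ?ler01.
move=> N; have yE : y = expansion_sum 2^-1 (fun q => (binary_digit q y)%:R) N +
    2^-1 ^+ N * iter N binary_shift y.
  elim: N => [|N yN]; first by rewrite /expansion_sum big_nil add0r expr0 mul1r.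
  rewrite {1}yN /expansion_sum big_nat_recr//= -addrA; congr (_ + _).
  rewrite /binary_digit [binary_shift (iter _ _ _)]/binary_shift exprS.
  by field.
have : 0 <= iter N binary_shift y <= 1.
  by elim: (N) => // m IHm; rewrite iterS; exact: binary_shift01.
move=> /andP[i0 i1]; rewrite [X in _ <= X <= _]yE lerDl lerD2l.
by rewrite mulr_ge0//= ger_pMr// exprn_gt0.
Qed.

Lemma measurable_binary_head : measurable_fun setT binary_head.
Proof. by apply: measurable_fun_ler. Qed.

Lemma measurable_binary_shift : measurable_fun setT binary_shift.
Proof.
apply: measurable_funB; first exact: measurable_funM.
rewrite (_ : (fun y => _) = (fun y => if binary_head y then 1 else 0)).
  by apply: measurable_fun_ifT => //; exact: measurable_binary_head.
by apply/funext => y; case: binary_head.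
Qed.

Lemma measurable_binary_digit k : measurable_fun setT (binary_digit k).
Proof.
elim: k => [|k IHk]; first exact: measurable_binary_head.
rewrite (_ : binary_digit k.+1 = binary_digit k \o binary_shift); last first.
  by apply/funext => y; rewrite /binary_digit iterSr.
exact: measurableT_comp IHk measurable_binary_shift.
Qed.

End schoenberg.

Lemma continuous_mx (T : topologicalType) (R : realType) m n (f : T -> 'M[R]_(m, n)) :
  (forall i j, continuous (fun x => f x i j)) -> continuous f.
Proof.
move=> cf x A [P Pf PA].
have : \forall y \near x, forall ij : 'I_m * 'I_n, P ij.1 ij.2 (f y ij.1 ij.2).
  by apply: filter_forall => -[i j] /=; apply: (cf i j x); exact: Pf.
by apply: filterS => y Py; apply: PA => i j; exact: (Py (i, j)).
Qed.

Lemma uniform_limit_continuous (T : topologicalType) (R : realType) (f : T -> R) :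
  (forall e, 0 < e -> exists2 g : T -> R, continuous g & forall x, `|f x - g x| <= e) ->
  continuous f.
Proof.
move=> fg x; apply/cvgrPdist_le => e e0.
have e3 : 0 < e / 3 by rewrite divr_gt0.
have [g cg fge] := fg _ e3.
have /cvgrPdist_le/(_ _ e3) := cg x; apply: filterS => y gxy.
have := fge x; have := fge y; move: gxy; rewrite !ler_norml.
by move=> /andP[? ?] /andP[? ?] /andP[? ?]; apply/andP; split; lra.
Qed.

Section schoenberg_curve.
Variables (R : realType) (m n : nat).

Let half01 : 0 <= (2^-1 : R) <= 1.
Proof. by rewrite invr_ge0 ler0n invf_le1 ?ler1n. Qed.

Let third01 : 0 <= (3^-1 : R) <= 1.
Proof. by rewrite invr_ge0 ler0n invf_le1 ?ler1n. Qed.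

(** [pickle] allots to each entry (i, j) its own sequence of ternary places, so that all entries are
    read off one scalar. Places that code no triple are never read and get the digit 0 in
    [schoenberg_code]. *)
Definition schoenberg_curve (z : R) : 'M[R]_(m, n) :=
  \matrix_(i, j) expansion 2^-1 (fun q => ternary_digit (pickle (q, i, j)) z).

Definition schoenberg_digit k (y : 'M[R]_(m, n)) :=
  if (unpickle k : option (nat * 'I_m * 'I_n)) is Some (q, i, j)
  then binary_digit q (y i j) else false.

Definition schoenberg_code (y : 'M[R]_(m, n)) : R :=
  expansion 3^-1 (fun k => (schoenberg_digit k y)%:R).

Lemma schoenberg_curve01 z i j : 0 <= schoenberg_curve z i j <= 1.
Proof. by rewrite mxE; apply: expansion01 => // q; exact: clamp01. Qed.

Let digit01 (b : nat -> bool) q : 0 <= ((b q)%:R : R) <= 1.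
Proof. by case: (b q); rewrite ?lexx ?ler01. Qed.

Lemma schoenberg_code01 y : 0 <= schoenberg_code y <= 1.
Proof. by apply: expansion01 => //; exact: digit01. Qed.

Lemma schoenberg_codeK (y : 'M[R]_(m, n)) : (forall i j, 0 <= y i j <= 1) ->
  schoenberg_curve (schoenberg_code y) = y.
Proof.
move=> y01; apply/matrixP => i j; rewrite mxE -[RHS]expansion_binary_digit//.
congr expansion; apply/funext => q.
by rewrite ternary_digit_expansion /schoenberg_digit pickleK.
Qed.

(** The partial sums are continuous, and the tails are at most 2^-N uniformly in z. *)
Lemma continuous_schoenberg_curve : continuous schoenberg_curve.
Proof.
apply: continuous_mx => i j; apply: uniform_limit_continuous => e e0.
pose d (z : R) (q : nat) : R := ternary_digit (pickle (q, i, j)) z.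
have d01 z q : 0 <= d z q <= 1 by exact: clamp01.
have : (2^-1 : R) ^+ N @[N --> \oo] --> (0 : R).
  by apply: cvg_expr; rewrite ger0_norm ?invr_ge0// invf_lt1 ?ltr1n.
move/cvgrPdist_le => /(_ e e0)[N _ /(_ N (leqnn N))].
rewrite sub0r normrN ger0_norm ?exprn_ge0 ?invr_ge0// => hN.
exists (fun z => expansion_sum 2^-1 (d z) N).
  rewrite /expansion_sum; elim: (N) => [|k IHk].
    by under eq_fun do rewrite big_nil; move=> z; exact: cvg_cst.
  under eq_fun do rewrite big_nat_recr//=.
  move=> z; apply: cvgD; first exact: IHk.
  by apply: cvgM; [exact: cvg_cst|exact: continuous_ternary_digit].
move=> z; rewrite mxE; have /andP[h1 h2] := expansion_tail N half01 (d01 z).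
by rewrite ger0_norm ?subr_ge0// lerBlDl (le_trans h2)// lerD2l.
Qed.

Lemma measurable_schoenberg_code : measurable_fun setT schoenberg_code.
Proof.
apply: (@measurable_fun_cvg _ _ _ _
  (fun N y => expansion_sum 3^-1 (fun k => (schoenberg_digit k y)%:R) N)).
  move=> N; rewrite /expansion_sum; apply: measurable_sum => k.
  apply: measurable_funM => //.
  rewrite /schoenberg_digit; case: unpickle => [[[q i] j]|] //.
  have [] // := bounded_measurable_bool R (b := fun y : 'M[R]_(m, n) => binary_digit q (y i j)).
  exact: measurableT_comp (@measurable_binary_digit R q) (@measurable_coord R m n i j).
move=> y _; exact: (is_cvg_expansion_sum third01 (digit01 (fun k => schoenberg_digit k y))).
Qed.

End schoenberg_curve.

(** * Continuous functions of matrices *)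

Lemma measurable_continuous_mx (R : realType) m n (v : 'M[R]_(m, n) -> R) :
  continuous v -> measurable_fun setT v.
Proof.
move=> cv; apply: (measurability _ (RGenOInfty.measurableE R)) => _ [_ [r ->] <-].
apply: sub_sigma_algebra; rewrite setTI.
apply: open_comp; last exact: rray_open.
by move=> M _; exact: cv.
Qed.

Lemma continuous_mx_eq (T : topologicalType) (R : realType) m n
    (f : T -> 'M[R]_(m, n)) (g : 'I_m -> 'I_n -> T -> R) :
  (forall i j x, f x i j = g i j x) -> (forall i j, continuous (g i j)) ->
  continuous f.
Proof.
move=> fg cg; apply: continuous_mx => i j.
by rewrite (_ : (fun x => _) = g i j)//; apply/funext => x.
Qed.

Lemma mx_norm_le (R : realType) m n (M : 'M[R]_(m, n)) (r : R) : 0 <= r ->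
  (forall i j, `|M i j| <= r) -> `|M| <= r.
Proof. by move=> r0 Mr; rewrite [leLHS]mx_normrE; apply/bigmax_leP; split => // -[i j] _. Qed.

Lemma mx_norm_ge (R : realType) m n (M : 'M[R]_(m, n)) i j : `|M i j| <= `|M|.
Proof. by rewrite [leRHS]mx_normrE; apply: (le_bigmax _ (fun ij => `|M ij.1 ij.2|) (i, j)). Qed.

Section pointwise_continuity.
Variables (R : realType) (T : topologicalType).
Implicit Types (f g : T -> R) (x : T).

Lemma continuous_at_cst (c : R) x : continuous_at x (fun _ : T => c).
Proof. exact: cst_continuous. Qed.

Lemma continuous_at_add f g x : continuous_at x f -> continuous_at x g ->
  continuous_at x (fun y => f y + g y).
Proof. by move=> cf cg; apply: cvgD. Qed.

Lemma continuous_at_sub f g x : continuous_at x f -> continuous_at x g ->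
  continuous_at x (fun y => f y - g y).
Proof. by move=> cf cg; apply: cvgB. Qed.

Lemma continuous_at_mul f g x : continuous_at x f -> continuous_at x g ->
  continuous_at x (fun y => f y * g y).
Proof. by move=> cf cg; apply: cvgM. Qed.

Lemma continuous_at_inv f x : f x != 0 -> continuous_at x f ->
  continuous_at x (fun y => (f y)^-1).
Proof. by move=> fx cf; apply: cvgV. Qed.

Lemma continuous_at_comp (phi : R -> R) f x : continuous_at (f x) phi ->
  continuous_at x f -> continuous_at x (fun y => phi (f y)).
Proof. by move=> cphi cf; apply: (@continuous_comp _ _ _ f phi). Qed.

Lemma continuous_at_normr f x : continuous_at x f ->
  continuous_at x (fun y => `|f y|).
Proof. by apply: continuous_at_comp; exact: norm_continuous. Qed.

Lemma continuous_at_maxr f g x : continuous_at x f -> continuous_at x g ->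
  continuous_at x (fun y => Num.max (f y) (g y)).
Proof. by move=> cf cg; exact: continuous_max. Qed.

Lemma continuous_at_sum I (r : seq I) (P : pred I) (F : I -> T -> R) x :
  (forall i, continuous_at x (F i)) ->
  continuous_at x (fun y => \sum_(i <- r | P i) F i y).
Proof.
by move=> cF; apply: cvg_big => [|i _]; [exact: add_continuous|exact: cF].
Qed.

Lemma continuous_at_prod I (r : seq I) (P : pred I) (F : I -> T -> R) x :
  (forall i, continuous_at x (F i)) ->
  continuous_at x (fun y => \prod_(i <- r | P i) F i y).
Proof.
by move=> cF; apply: cvg_big => [|i _]; [exact: mul_continuous|exact: cF].
Qed.

End pointwise_continuity.

(* [expand] inverts the homeomorphism [contract] from the space of matrices
   onto the open unit ball; [expand_trunc k] is continuous everywhere and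
   agrees with it on the ball of radius 1 - 1/(k+2). *)
Section contraction.
Variables (R : realType) (m n : nat).
Implicit Types (s y : 'M[R]_(m, n)).

Definition contract s : 'M[R]_(m, n) := (1 + `|s|)^-1 *: s.
Definition expand y : 'M[R]_(m, n) := (1 - `|y|)^-1 *: y.
Definition expand_trunc (k : nat) y : 'M[R]_(m, n) :=
  (Num.max (1 - `|y|) k.+2%:R^-1)^-1 *: y.

Lemma norm_contract s : `|contract s| = `|s| / (1 + `|s|).
Proof. by rewrite normrZ gtr0_norm ?invr_gt0 ?ltr_wpDr// mulrC. Qed.

Lemma norm_contract_lt1 s : `|contract s| < 1.
Proof. by rewrite norm_contract ltr_pdivrMr ?ltr_wpDr// mul1r ltrDr. Qed.

Lemma contractK s : expand (contract s) = s.
Proof.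
rewrite /expand norm_contract /contract scalerA -[RHS]scale1r; congr (_ *: _).
have : 1 + `|s| != 0 by rewrite gt_eqF// ltr_wpDr.
by move=> h; field; rewrite h addrK oner_eq0.
Qed.

Lemma continuous_expand_trunc k : continuous (expand_trunc k).
Proof.
apply: (continuous_mx_eq (g := fun i j (y : 'M[R]_(m, n)) =>
  (Num.max (1 - `|y|) k.+2%:R^-1)^-1 * y i j)) => [i j y|i j y].
  by rewrite mxE.
apply: continuous_at_mul; last exact: coord_continuous.
apply: continuous_at_inv.
  by rewrite gt_eqF// lt_max [X in _ || X]invr_gt0 ltr0n orbT.
apply: continuous_at_maxr; last exact: continuous_at_cst.
by apply: continuous_at_sub; [exact: continuous_at_cst|exact: norm_continuous].
Qed.

(** Where the two maps differ, 1 - |y| < 1 / (k + 2). The truncated image then has norm (k + 2) |y|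
    > k + 1 and, inside the open ball, the other image is farther still, so [v] vanishes at both. *)
Lemma expand_truncE (v : 'M[R]_(m, n) -> R) k y : v 0 = 0 ->
  (forall s, k%:R <= `|s| -> v s = 0) -> `|y| <= 1 ->
  v (expand_trunc k y) = v (expand y).
Proof.
move=> v0 vk y1; rewrite /expand_trunc /expand.
have [//|yk] := leP k.+2%:R^-1 (1 - `|y|).
have k1 : k.+1%:R <= k.+2%:R * `|y|.
  move: yk; rewrite -(ltr_pM2l (_ : 0 < k.+2%:R)) ?ltr0n//.
  by rewrite divff// mulrBr mulr1 -natr1; lra.
have kk : (k%:R : R) <= k.+1%:R by rewrite ler_nat.
rewrite vk; last first.
  by rewrite normrZ invrK ger0_norm// (le_trans kk).
(* On the unit sphere the inverse of 0 is 0, so [expand y] is 0; this is where [v 0 = 0] enters. *)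
move: y1; rewrite le_eqVlt => /predU1P[->|y1].
  by rewrite subrr invr0 scale0r v0.
have y0 : 0 <= (1 - `|y|)^-1 by rewrite invr_ge0 subr_ge0 ltW.
rewrite vk// normrZ (ger0_norm y0).
apply: le_trans (_ : k.+2%:R * `|y| <= _); first exact: le_trans k1.
rewrite ler_wpM2r// -[leLHS]invrK lef_pV2 ?posrE ?invr_gt0 ?subr_gt0//.
exact: ltW.
Qed.

(** For the max norm the unit ball is a cube, which an affine change of each entry identifies with
    the cube filled by Schoenberg's curve. *)
Definition unit_code s : R :=
  schoenberg_code (\matrix_(i, j) ((1 + contract s i j) / 2)).
Definition unit_curve (z : R) : 'M[R]_(m, n) :=
  \matrix_(i, j) (2 * schoenberg_curve m n z i j - 1).

Lemma unit_code01 s : 0 <= unit_code s <= 1.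
Proof. exact: schoenberg_code01. Qed.

Lemma unit_codeK s : unit_curve (unit_code s) = contract s.
Proof.
apply/matrixP => i j; rewrite mxE schoenberg_codeK => [|{}i {}j].
  by rewrite mxE; field.
rewrite mxE; have := ltW (norm_contract_lt1 s).
have := mx_norm_ge (contract s) i j.
move=> /le_trans/[apply]; rewrite ler_norml => /andP[h1 h2].
by rewrite divr_ge0 ?ler_pdivrMr//; lra.
Qed.

Lemma norm_unit_curve z : `|unit_curve z| <= 1.
Proof.
apply: mx_norm_le => // i j; rewrite mxE ler_norml.
by have := schoenberg_curve01 z i j; lra.
Qed.

Lemma continuous_unit_curve : continuous unit_curve.
Proof.
apply: (continuous_mx_eq (g := fun i j z => 2 * schoenberg_curve m n z i j - 1))
  => [i j z|i j z]; first by rewrite mxE.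
apply: cvgB; last exact: cvg_cst.
apply: cvgM; first exact: cvg_cst.
apply: (@continuous_comp _ _ _ (schoenberg_curve m n) (fun M => M i j)).
  exact: continuous_schoenberg_curve.
exact: coord_continuous.
Qed.

Lemma measurable_unit_code : measurable_fun setT unit_code.
Proof.
apply: (measurableT_comp (@measurable_schoenberg_code R m n)
  (g := fun s => \matrix_(i, j) ((1 + contract s i j) / 2))).
apply: measurable_fun_mx => i j.
rewrite (_ : (fun s => _) = (fun s : 'M[R]_(m, n) => (1 + (1 + `|s|)^-1 * s i j) / 2)).
  apply: measurable_continuous_mx => s.
  apply: continuous_at_mul; last exact: continuous_at_cst.
  apply: continuous_at_add; first exact: continuous_at_cst.
  apply: continuous_at_mul; last exact: coord_continuous.
  apply: continuous_at_inv; first by rewrite gt_eqF// ltr_wpDr.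
  by apply: continuous_at_add; [exact: continuous_at_cst|exact: norm_continuous].
by apply/funext => s; rewrite !mxE.
Qed.

Lemma measurable_expand_unit_curve :
  measurable_fun setT (fun z : R => expand (unit_curve z)).
Proof.
apply: measurable_fun_mx => i j.
(* [expand] is discontinuous at the unit sphere. Written as a power with exponent -1, the scalar
   factor is Borel there too, with the same value 0 at 0. *)
rewrite (_ : (fun z => _) =
  (fun z => (1 - `|unit_curve z|) `^ (-1) * unit_curve z i j)); last first.
  by apply/funext => z; rewrite mxE powR_inv1// subr_ge0 norm_unit_curve.
apply: measurable_funM.
  apply: (measurableT_comp (@measurable_powR R (-1))
    (g := fun z => 1 - `|unit_curve z|)).
  apply: continuous_measurable_fun => z; apply: cvgB; first exact: cvg_cst.
  by apply: continuous_comp; [exact: continuous_unit_curve|exact: norm_continuous].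
apply: continuous_measurable_fun => z.
apply: (@continuous_comp _ _ _ unit_curve (fun M => M i j)).
  exact: continuous_unit_curve.
exact: coord_continuous.
Qed.

End contraction.

Lemma continuous_at_near_eq (T U : topologicalType) (f g : T -> U) x :
  (\forall y \near x, f y = g y) -> continuous_at x g -> continuous_at x f.
Proof.
move=> fg cg; rewrite /continuous_at (nbhs_singleton fg).
apply: cvg_trans cg; apply: near_eq_cvg; apply: filterS fg => y ->//.
Qed.

Lemma eq_continuous_at (T U : topologicalType) (f g : T -> U) x :
  f =1 g -> continuous_at x g -> continuous_at x f.
Proof. by move=> /funext ->. Qed.

Lemma continuous_at_det (T : topologicalType) (R : realType) n
    (f : T -> 'M[R]_n) x :
  (forall i j, continuous_at x (fun y => f y i j)) ->
  continuous_at x (fun y => \det (f y)).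
Proof.
move=> cf; apply: continuous_at_sum => s; apply: continuous_at_mul.
  exact: continuous_at_cst.
by apply: continuous_at_prod => i; exact: cf.
Qed.

Lemma continuous_at_powR (T : topologicalType) (R : realType) (f : T -> R) (p : R) x :
  0 < f x -> continuous_at x f -> continuous_at x (fun y => f y `^ p).
Proof.
move=> fx cf; apply: (continuous_at_comp (phi := fun t => t `^ p)) => //.
apply: differentiable_continuous; apply/derivable1_diffP.
by apply: derivable_powR; rewrite in_itv/= fx.
Qed.

(** * The Frobenius norm, matrix inversion and the cut-offs *)

Section frobenius.
Variables (R : realType) (n : nat).
Implicit Types (s : 'M[R]_n) (p : R).

Lemma frob_ge0 s : 0 <= frob s. Proof. exact: sqrtr_ge0. Qed.

Lemma mx_norm_le_frob s : `|s| <= frob s.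
Proof.
apply: mx_norm_le; first exact: frob_ge0.
move=> i j; rewrite -sqrtr_sqr ler_wsqrtr//.
rewrite (bigD1 i)//= (bigD1 j)//= -addrA lerDl.
by rewrite addr_ge0// sumr_ge0// => k _; rewrite ?sqr_ge0// sumr_ge0// => l _; exact: sqr_ge0.
Qed.

Lemma continuous_at_frob (T : topologicalType) (f : T -> 'M[R]_n) x :
  (forall i j, continuous_at x (fun y => f y i j)) ->
  continuous_at x (fun y => frob (f y)).
Proof.
move=> cf; apply: (continuous_at_comp (phi := Num.sqrt)); first exact: sqrt_continuous.
apply: continuous_at_sum => i; apply: continuous_at_sum => j.
by under [X in continuous_at _ X]eq_fun do rewrite expr2; exact: continuous_at_mul.
Qed.

Lemma continuous_frob : continuous (@frob R n).
Proof. by move=> s; apply: continuous_at_frob => i j; exact: coord_continuous. Qed.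

Lemma continuous_det : continuous (fun s : 'M[R]_n => \det s).
Proof. by move=> s; apply: continuous_at_det => i j; exact: coord_continuous. Qed.

Lemma invertibleE s : invertible s <-> \det s != 0.
Proof. by rewrite /invertible/= unitmxE unitfE. Qed.

Lemma open_invertible : open (@invertible R n).
Proof.
rewrite (_ : invertible = (fun s => \det s) @^-1` [set x : R | x != 0]).
  by apply: open_comp; [move=> s _; exact: continuous_det|exact: open_neq].
by apply/seteqP; split => s /invertibleE.
Qed.

Lemma measurable_invertible : measurable (@invertible R n).
Proof. apply: sub_sigma_algebra; exact: open_invertible. Qed.

(** Near [s] the inverse is given by the adjugate formula, a quotient of polynomials in the entries
    whose denominator does not vanish. *)
Lemma continuous_at_invmx s i j : invertible s ->
  continuous_at s (fun s : 'M[R]_n => invmx s i j).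
Proof.
move=> is_; apply: (@continuous_at_near_eq _ _ _ (fun y : 'M[R]_n =>
    (\det y)^-1 * ((-1) ^+ (j + i) * \det (row' j (col' i y))))).
  have := open_nbhs_nbhs (conj open_invertible is_).
  by apply: filterS => y iy; rewrite /invmx [_ \in _]iy !mxE.
apply: continuous_at_mul.
  by apply: continuous_at_inv; [exact/invertibleE|exact: continuous_det].
apply: continuous_at_mul; first exact: continuous_at_cst.
apply: continuous_at_det => k l.
apply: (@eq_continuous_at _ _ _ (fun y : 'M[R]_n => y (lift j k) (lift i l))).
  by move=> y; rewrite !mxE.
exact: coord_continuous.
Qed.

Lemma continuous_at_frob_invmx s : invertible s ->
  continuous_at s (fun s => frob (invmx s)).
Proof. by move=> is_; apply: continuous_at_frob => i j; exact: continuous_at_invmx. Qed.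

(** Leibniz's formula has n! terms, each a product of n entries bounded by the norm. Applied to
    s^-1, the estimate bounds |det s| from below. *)
Lemma det_bound s : `|\det s| <= (n`!)%:R * frob s ^+ n.
Proof.
apply: le_trans (ler_norm_sum _ _ _) _.
apply: (@le_trans _ _ (\sum_(i : {perm 'I_n}) frob s ^+ n)); last first.
  by rewrite sumr_const card_Sn -[leLHS]mulr_natl.
apply: ler_sum => i _; rewrite normrM normrX normrN1 expr1n mul1r normr_prod.
apply: (@le_trans _ _ (\prod_(j < n) frob s)); last by rewrite prodr_const card_ord.
apply: ler_prod => j _; rewrite normr_ge0/=.
exact: le_trans (mx_norm_ge s j (i j)) (mx_norm_le_frob s).
Qed.

Lemma frob_gt0 s : (0 < n)%N -> invertible s -> 0 < frob s.
Proof.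
move=> n0 /invertibleE ds; rewrite lt_neqAle frob_ge0 andbT eq_sym.
apply: contra ds => /eqP s0; have := mx_norm_le_frob s; rewrite s0 normr_le0 => /eqP ->.
by case: (n) n0 => // k _; rewrite det0.
Qed.

Lemma invertible_invmx s : invertible s -> invertible (invmx s).
Proof. by rewrite /invertible/= unitmx_inv. Qed.

Lemma invertible1 : invertible (1%:M : 'M[R]_n).
Proof. exact: unitmx1. Qed.

Definition psi p s := frob s `^ p + frob (invmx s) `^ p.

Lemma psi_ge0 p s : 0 <= psi p s.
Proof. by rewrite addr_ge0// powR_ge0. Qed.

Lemma continuous_at_psi p s : (0 < n)%N -> invertible s -> continuous_at s (psi p).
Proof.
move=> n0 is_; apply: continuous_at_add; apply: continuous_at_powR.
- exact: frob_gt0.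
- exact: continuous_frob.
- by apply: frob_gt0 => //; exact: invertible_invmx.
- exact: continuous_at_frob_invmx.
Qed.

(* Cut-offs with compact support in the invertible matrices, increasing to
   their indicator function. *)
Definition eta (j : nat) s :=
  clamp (2 - frob s / j.+1%:R) * clamp (j.+1%:R * `|\det s| - 1).

Lemma eta01 j s : 0 <= eta j s <= 1.
Proof.
have /andP[a0 a1] := clamp01 (2 - frob s / j.+1%:R).
have /andP[b0 b1] := clamp01 (j.+1%:R * `|\det s| - 1).
by rewrite /eta mulr_ge0//= mulr_ile1.
Qed.

Lemma continuous_eta j : continuous (eta j).
Proof.
move=> s; apply: continuous_at_mul.
  apply: continuous_at_comp; first exact: continuous_clamp.
  apply: continuous_at_sub; first exact: continuous_at_cst.
  apply: continuous_at_mul; last exact: continuous_at_cst.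
  exact: continuous_frob.
apply: continuous_at_comp; first exact: continuous_clamp.
apply: continuous_at_sub; last exact: continuous_at_cst.
apply: continuous_at_mul; first exact: continuous_at_cst.
by apply: continuous_at_normr; exact: continuous_det.
Qed.

Lemma eta_eq0 j s : 2 * j.+1%:R <= frob s \/ j.+1%:R * `|\det s| <= 1 -> eta j s = 0.
Proof.
move=> [h|h]; rewrite /eta.
  by rewrite clamp_eq0 ?mul0r// subr_le0 ler_pdivlMr.
by rewrite [X in _ * X]clamp_eq0 ?mulr0// subr_le0.
Qed.

Lemma eta_eq1 j s : frob s <= j.+1%:R -> 2 <= j.+1%:R * `|\det s| -> eta j s = 1.
Proof.
move=> h1 h2; rewrite /eta !clamp_eq1 ?mulr1//; first by move: h2; lra.
have : frob s / j.+1%:R <= 1 by rewrite ler_pdivrMr// mul1r.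
by set x := frob s / _ => x1; lra.
Qed.

Lemma eta_noninvertible j s : ~ invertible s -> eta j s = 0.
Proof.
move=> ns; apply: eta_eq0; right; have : \det s = 0.
  by apply/eqP; apply: contrapT => /negP/invertibleE.
by move=> ->; rewrite normr0 mulr0.
Qed.

Lemma clamp_le (x y : R) : x <= y -> clamp x <= clamp y.
Proof. by move=> xy; rewrite /clamp le_min !ge_min lexx/= ge_max !le_max lexx xy !orbT. Qed.

Lemma eta_le i j s : (i <= j)%N -> eta i s <= eta j s.
Proof.
move=> ij; have ij' : (i.+1%:R : R) <= j.+1%:R by rewrite ler_nat.
have /andP[a0 _] := clamp01 (2 - frob s / i.+1%:R).
have /andP[b0 _] := clamp01 (i.+1%:R * `|\det s| - 1).
apply: ler_pM => //; apply: clamp_le.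
  by rewrite lerD2l lerN2 ler_wpM2l ?frob_ge0// lef_pV2 ?posrE.
by rewrite lerD2r ler_wpM2r.
Qed.

(** A bound m on |s| + |s^-1| gives |det s^-1| <= n! |m|^n, hence a lower bound on |det s|. Both
    factors of [eta j] are then saturated for large j, uniformly in s. *)
Lemma eta_uniform (m : R) : exists J, forall j s, (J <= j)%N -> invertible s ->
  frob s + frob (invmx s) <= m -> eta j s = 1.
Proof.
pose K : R := (n`!)%:R * `|m| ^+ n + 1.
have K0 : 0 < K by rewrite ltr_wpDl// mulr_ge0.
(* j + 1 must exceed |m| for the norm factor and 2 K for the determinant factor. *)
pose J := Num.truncn (`|m| + 2 * K).
have JK : `|m| + 2 * K < J.+1%:R by exact: truncnS_gt.
exists J => j s Jj is_ sm.
have j1 : `|m| + 2 * K < j.+1%:R by apply: lt_le_trans JK _; rewrite ler_nat.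
have s0 := frob_ge0 s; have si0 := frob_ge0 (invmx s); have mm := ler_norm m.
apply: eta_eq1; first by move: K0; lra.
have det1 : \det s * \det (invmx s) = 1 by rewrite -det_mulmx mulmxV// det1.
have dK : `|\det (invmx s)| <= K.
  apply: le_trans (det_bound _) _; rewrite /K.
  apply: (@le_trans _ _ ((n`!)%:R * `|m| ^+ n)); last by rewrite lerDl.
  by rewrite ler_wpM2l// lerXn2r ?nnegrE//; lra.
have : 1 <= `|\det s| * K.
  by rewrite -[leLHS]normr1 -det1 normrM ler_wpM2l.
have d0 := normr_ge0 (\det s).
have : 2 * K * `|\det s| <= j.+1%:R * `|\det s|.
  by rewrite ler_wpM2r//; have := normr_ge0 m; lra.
nra.
Qed.

End frobenius.

(** * Test functions *)

Section test_functions.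
Variables (R : realType) (n : nat) (n_gt0 : (0 < n)%N).
Implicit Types (s : 'M[R]_n) (v : 'M[R]_n -> R) (p : R).

(** The value at 0 is prescribed because [expand] sends the unit sphere to 0, by the convention on
    the inverse of 0. Products with [eta j] satisfy this by themselves, 0 being singular. *)
Definition test_fun v := [/\ continuous v, v 0 = 0 &
  exists k : nat, forall s, k%:R <= frob s -> v s = 0].

(** The first identity describes [v] along the coded sequence and the second along the limit;
    together they carry [young_measure_1D] over to matrices. Truncating [expand] beyond the support
    of [v] makes [f] continuous. *)
Lemma test_fun_unit_curve v : test_fun v -> exists2 f : R -> R, continuous f &
  (forall s, f (unit_code s) = v s) /\
  (forall z, f z = v (expand (unit_curve n n z))).
Proof.
move=> [cv v0 [k vkf]].
have vk s : k%:R <= `|s| -> v s = 0.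
  by move=> ks; apply: vkf; exact: le_trans ks (mx_norm_le_frob s).
exists (fun z => v (expand_trunc k (unit_curve n n z))).
  move=> z; apply: (@continuous_comp _ _ _ (fun z => expand_trunc k (unit_curve n n z)) v);
    last exact: cv.
  apply: (@continuous_comp _ _ _ (unit_curve n n) (expand_trunc k)).
    exact: continuous_unit_curve.
  exact: continuous_expand_trunc.
split=> [s|z]; last by rewrite expand_truncE// norm_unit_curve.
by rewrite unit_codeK expand_truncE ?contractK// ltW// norm_contract_lt1.
Qed.

Lemma test_fun_bounded v : test_fun v -> exists M, forall s, `|v s| <= M.
Proof.
move=> /test_fun_unit_curve[f cf [fv _]].
have [M fM] := continuous_unit_interval_bounded cf.
by exists M => s; rewrite -fv; apply: fM; exact: unit_code01.
Qed.

Lemma test_fun_bounded_measurable v d (T : measurableType d) (Z : T -> 'M[R]_n) :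
  test_fun v -> measurable_fun setT Z -> bounded_measurable (fun x => v (Z x)).
Proof.
move=> tv mZ; have [M vM] := test_fun_bounded tv; split; last by exists M.
by apply: measurableT_comp mZ; apply: measurable_continuous_mx; case: tv.
Qed.

Lemma not_invertible0 : ~ invertible (0 : 'M[R]_n).
Proof.
by move=> /invertibleE; case: (n) n_gt0 => // k _; rewrite det0 eqxx.
Qed.

(** Near a singular matrix |det| stays below 1 / (j + 1), where [eta j] vanishes; the product is
    continuous there whatever the values of [v]. *)
Lemma test_fun_eta v j : (forall s, invertible s -> continuous_at s v) ->
  test_fun (fun s => v s * eta j s).
Proof.
move=> cv; split.
- move=> s; have [is_|nis] := pselect (invertible s).
    by apply: continuous_at_mul; [exact: cv|exact: continuous_eta].
  apply: (@continuous_at_near_eq _ _ _ (fun _ => 0)); last exact: cst_continuous.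
  have ds : \det s = 0.
    by apply/eqP; apply: contrapT => /negP/invertibleE.
  have h : 0 < (j.+1%:R^-1 : R) by rewrite invr_gt0.
  have /cvgrPdist_lt/(_ _ h) := @continuous_det R n s.
  apply: filterS => y /=; rewrite ds sub0r normrN => /ltW yj.
  by rewrite eta_eq0 ?mulr0//; right; rewrite -ler_pdivlMl// mulr1.
- by rewrite eta_noninvertible ?mulr0//; exact: not_invertible0.
- exists (2 * j.+1)%N => s js; rewrite eta_eq0 ?mulr0//; left.
  by rewrite -natrM.
Qed.

Lemma test_fun_eta1 j : test_fun (eta j : 'M[R]_n -> R).
Proof.
have := @test_fun_eta (fun _ => 1) j (fun s _ => @continuous_at_cst _ _ 1 s).
by under [X in test_fun X -> _]eq_fun do rewrite mul1r.
Qed.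

Lemma Cpinv_continuous_at p v : Cpinv p v -> forall s, invertible s -> continuous_at s v.
Proof.
move=> [cv _] s is_; move: cv.
rewrite (continuous_open_subspace v (@open_invertible R n)); apply.
exact: mem_set.
Qed.

(** Where a late cut-off differs from 1, |s| + |s^-1| is so large that |v| <= e psi. Integrated
    against bounded moments, this is the uniform integrability that extends convergence to all of
    C_{p,-p}. *)
Lemma Cpinv_eta_tail p v e : Cpinv p v -> 0 < e -> exists J, forall j s,
  (J <= j)%N -> invertible s -> `|v s - v s * eta j s| <= e * psi p s.
Proof.
move=> [_ vp] e0; have [r _ hr] := vp _ (nbhsx_ballx (0 : R) _ e0).
have [J HJ] := @eta_uniform R n r; exists J => j s Jj is_.
have [sr|rs] := leP (frob s + frob (invmx s)) r.
  by rewrite (HJ j s)// mulr1 subrr normr0 mulr_ge0 ?psi_ge0// ltW.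
have psi0 : 0 < psi p s.
  by rewrite /psi ltr_pwDl ?powR_ge0// powR_gt0// frob_gt0.
have := hr s (conj is_ rs); rewrite /ball/= sub0r normrN -/(psi p s) => /ltW.
rewrite normrM normfV (gtr0_norm psi0) ler_pdivrMr// => vs.
apply: le_trans vs; rewrite -[X in X - _]mulr1 -mulrBr normrM.
have /andP[h0 h1] := eta01 j s.
by rewrite ler_piMr// ger0_norm; lra.
Qed.

Lemma Cpinv_psi_bound p v : Cpinv p v -> exists2 K, 0 <= K &
  forall s, invertible s -> `|v s| <= K + psi p s.
Proof.
move=> cv; have [J HJ] := Cpinv_eta_tail cv ltr01.
have [M vM] := test_fun_bounded (test_fun_eta J (Cpinv_continuous_at cv)).
exists `|M| => // s is_; have := HJ J s (leqnn J) is_; have := vM s.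
have := ler_normD (v s - v s * eta J s) (v s * eta J s).
by have := ler_norm M; rewrite mul1r subrK; lra.
Qed.

(** One of the two norms is at least r >= 1, and t <= t^p for t >= 1. *)
Lemma psi_large p (r : R) s : 1 <= p -> 1 <= r -> 2 * r < frob s + frob (invmx s) ->
  r <= psi p s.
Proof.
move=> p1 r1 rs; have p0 : 0 <= p by rewrite (le_trans ler01).
have h t : r <= t -> r <= t `^ p.
  move=> rt; apply: (le_trans rt); apply: le1r_powR p1.
  exact: le_trans r1 rt.
have [rs1|sr] := leP r (frob s).
  by rewrite /psi (le_trans (h _ rs1))// lerDl powR_ge0.
rewrite /psi (le_trans (h (frob (invmx s)) _))//; first lra.
by rewrite lerDr powR_ge0.
Qed.

(** A pointwise Chebyshev bound: integrated, it limits the mass that can escape from the region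
    where [eta j] is 1. *)
Lemma eta_psi_bound p e : 1 <= p -> 0 < e -> exists J, forall j s,
  (J <= j)%N -> invertible s -> 1 - eta j s <= e * psi p s.
Proof.
move=> p1 e0; pose r := Num.max 1 e^-1.
have r1 : 1 <= r by rewrite le_max lexx.
have er : 1 <= e * r by rewrite -ler_pdivrMl// mulr1 le_max lexx orbT.
have [J HJ] := @eta_uniform R n (2 * r); exists J => j s Jj is_.
have [sr|rs] := leP (frob s + frob (invmx s)) (2 * r).
  by rewrite (HJ j s)// subrr mulr_ge0 ?psi_ge0// ltW.
have /andP[h0 _] := eta01 j s.
apply: le_trans (_ : 1 <= _); first by rewrite gerBl.
by apply: le_trans er _; rewrite ler_pM2l// psi_large.
Qed.

Lemma eta_cvg s : invertible s -> eta j s @[j --> \oo] --> (1 : R).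
Proof.
move=> is_; have [J HJ] := @eta_uniform R n (frob s + frob (invmx s)).
by apply: cvg_near_cst; exists J => // j /= Jj; apply: HJ.
Qed.

End test_functions.

(** * Young measures of sequences with bounded moments *)

Section moments.
Context d (T : measurableType d) (R : realType) (n : nat) (n_gt0 : (0 < n)%N).
Variables (mu : {finite_measure set T -> \bar R}) (p : R) (Z : T -> 'M[R]_n).
Hypotheses (mZ : measurable_fun setT Z) (iZ : forall x, invertible (Z x)).

(** The function is the pointwise limit of (v eta_j) o Z, and each v eta_j is continuous on all
    matrices. *)
Lemma measurable_invertible_comp (v : 'M[R]_n -> R) :
  (forall s, invertible s -> continuous_at s v) -> measurable_fun setT (v \o Z).
Proof.
move=> cv; apply: (@measurable_fun_cvg _ _ _ _ (fun j x => v (Z x) * eta j (Z x))).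
  move=> j; have [] // := test_fun_bounded_measurable (test_fun_eta n_gt0 j cv) mZ.
move=> x _; rewrite -[X in _ --> X]mulr1; apply: cvgM; first exact: cvg_cst.
exact: eta_cvg.
Qed.

Lemma measurable_psi : measurable_fun setT (fun x => psi p (Z x)).
Proof.
by apply: (@measurable_invertible_comp (psi p)) => s; exact: continuous_at_psi.
Qed.

Variable C : R.
Hypothesis psiC : (\int[mu]_x (psi p (Z x))%:E <= C%:E)%E.

Lemma integrable_psi : mu.-integrable setT (EFin \o (fun x => psi p (Z x))).
Proof.
apply/integrableP; split; first exact/measurable_EFinP/measurable_psi.
under eq_integral do rewrite /= ger0_norm ?psi_ge0//.
exact: le_lt_trans psiC (ltry _).
Qed.

Lemma Rintegral_psi : \int[mu]_x psi p (Z x) <= C.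
Proof.
rewrite -lee_fin /Rintegral fineK//.
apply: integrable_fin_num => //; exact: integrable_psi.
Qed.

Lemma integrable_le_psi (v : T -> R) K (c : R) : measurable_fun setT v ->
  (forall x, `|v x| <= K + c * psi p (Z x)) -> mu.-integrable setT (EFin \o v).
Proof.
move=> mv vK; apply: (@le_integrable _ _ _ mu setT measurableT _
  (EFin \o (fun x => K + c * psi p (Z x)))).
- exact/measurable_EFinP.
- by move=> x _; rewrite /= lee_fin (le_trans (vK x))// ler_norm.
- have h1 : mu.-integrable setT (EFin \o cst K).
    exact: finite_measure_integrable_cst.
  exact: (integrableD measurableT h1 (integrableZl measurableT c integrable_psi)).
Qed.

Lemma integrable_Cpinv (v : 'M[R]_n -> R) (g : T -> R) : Cpinv p v ->
  bounded_measurable g -> mu.-integrable setT (EFin \o (fun x => v (Z x) * g x)).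
Proof.
move=> cv [mg [M gM]]; have [K K0 vK] := Cpinv_psi_bound n_gt0 cv.
have mv := measurable_invertible_comp (Cpinv_continuous_at cv).
apply: (@integrable_le_psi _ (K * `|M|) `|M|); first exact: measurable_funM mv mg.
move=> x; rewrite normrM (mulrC `|M|) -mulrDl ler_pM//; first exact: vK.
by rewrite (le_trans (gM x))// ler_norm.
Qed.

(** The estimate depends on [Z] only through the moment bound [C], so it is uniform along a sequence
    and applies equally to the limit. *)
Lemma Cpinv_eta_integral_dist (v : 'M[R]_n -> R) (g : T -> R) j e M :
  Cpinv p v -> bounded_measurable g -> (forall x, `|g x| <= M) -> 0 <= e ->
  (forall s, invertible s -> `|v s - v s * eta j s| <= e * psi p s) ->
  `|\int[mu]_x (v (Z x) * g x) - \int[mu]_x (v (Z x) * eta j (Z x) * g x)| <=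
  e * `|M| * C.
Proof.
move=> cv bg gM e0 ve.
have i1 := integrable_Cpinv cv bg.
have bv := test_fun_bounded_measurable (test_fun_eta n_gt0 j (Cpinv_continuous_at cv)) mZ.
have i2 := bounded_measurable_integrable mu measurableT (bounded_measurableM bv bg).
rewrite -RintegralB//.
have i3 : mu.-integrable setT (EFin \o
    (fun x => v (Z x) * g x - v (Z x) * eta j (Z x) * g x)).
  exact: (integrableB measurableT i1 i2).
apply: le_trans (le_normr_Rintegral measurableT i3) _.
apply: (@le_trans _ _ (\int[mu]_x (e * `|M| * psi p (Z x)))).
  apply: le_Rintegral => //.
  - exact: integrable_norm.
  - exact: (integrableZl measurableT _ integrable_psi).
  - move=> x _ /=; rewrite -mulrBl normrM [leRHS]mulrAC.
    by rewrite ler_pM//; [exact: ve|rewrite (le_trans (gM x))// ler_norm].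
rewrite RintegralZl//; last exact: integrable_psi.
by rewrite ler_wpM2l ?mulr_ge0//; exact: Rintegral_psi.
Qed.

End moments.

Section core.
Context d (T : measurableType d) (R : realType).
Variables (mu : {finite_measure set T -> \bar R})
          (P : probability (measurableTypeR R) R).
Hypothesis P_unif : forall a, 0 <= a <= 1 -> P [set t | a < t] = (1 - a)%:E.
Variables (J : countType) (G : J -> set T).
Hypotheses (GE : @measurable _ T = <<s range G>>) (GI : setI_closed (range G)).
Variables (n : nat) (n_gt0 : (0 < n)%N) (p : R) (p_ge1 : 1 <= p).
Variables (Z : nat -> T -> 'M[R]_n) (C : R).
Hypotheses (mZ : forall k, measurable_fun setT (Z k))
  (iZ : forall k x, invertible (Z k x))
  (psiC : forall k, (\int[mu]_x (psi p (Z k x))%:E <= C%:E)%E).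

Local Notation muP := (finite_product mu P).

Let young_limit (phi : nat -> nat) (S : T * measurableTypeR R -> 'M[R]_n) :=
  measurable_fun setT S /\ forall v g, test_fun v -> bounded_measurable g ->
    weak_limit mu muP (fun _ => g) (fun z => g z.1)
      (fun k x => v (Z (phi k) x)) (fun z => v (S z)).

Let C_ge0 : 0 <= C.
Proof.
rewrite -lee_fin; apply: le_trans (psiC 0).
by apply: integral_ge0 => x _; rewrite lee_fin psi_ge0.
Qed.

Let muPT : muP setT = mu setT.
Proof.
change ((mu \x P) setT = mu setT)%E.
rewrite -setXTT product_measure1E//.
by rewrite [X in (_ * X)%E](@probability_setT _ _ _ P) mule1.
Qed.

Let exists_young_limit : exists2 phi : nat -> nat,
  {homo phi : i j / (i < j)%N} & exists S, young_limit phi S.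
Proof.
have [||phi hphi [tau mtau tauP]] := young_measure_1D mu P_unif GE GI
  (Z := fun k x => unit_code (Z k x)).
- by move=> k; exact: measurableT_comp (@measurable_unit_code R n n) (mZ k).
- by move=> k x; exact: unit_code01.
exists phi => //; exists (fun z => expand (unit_curve n n (tau z))); split.
  exact: measurableT_comp (@measurable_expand_unit_curve R n n) mtau.
move=> v g tv bg; have [f cf [fv fc]] := test_fun_unit_curve tv.
by apply: eq_weak_limit (tauP g f bg cf) => [k x|z]; rewrite ?fv ?fc.
Qed.

Let one_bm : bounded_measurable (fun _ : T => 1 : R).
Proof. exact: bounded_measurable_cst. Qed.

(** By the moment bound, the integral of [eta j0] along the sequence is within e of the full mass,
    and this passes to the limit because [eta j0] is a test function. As [eta j0] vanishes on
    singular matrices, the preimage of the invertible ones has at least that mass. *)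
Let young_limit_mass phi S : young_limit phi S ->
  muP (S @^-1` ~` @invertible R n) = 0%E.
Proof.
move=> [mS SP].
have mI : measurable (S @^-1` @invertible R n).
  by rewrite -[X in measurable X]setTI; apply: mS => //; exact: measurable_invertible.
have mB : measurable (S @^-1` ~` @invertible R n).
  by rewrite preimage_setC; exact: measurableC.
have fB : muP (S @^-1` ~` @invertible R n) \is a fin_num by exact: fin_num_measure.
rewrite -(fineK fB); congr EFin; apply/eqP; rewrite eq_le fine_ge0// andbT.
apply/ler_addgt0Pr => e e0; rewrite add0r.
have C1 : 0 < C + 1 by rewrite ltr_wpDl.
(* Dividing by C + 1 absorbs the moment bound, also when C = 0. *)
have eC : 0 < e / (C + 1) by rewrite divr_gt0.
have [j0 etaP0] := @eta_psi_bound R n p _ p_ge1 eC.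
have {etaP0} etaP s := etaP0 j0 s (leqnn j0).
have teta := test_fun_eta1 R n_gt0 j0.
have [beta bw] := SP _ _ teta one_bm.
under eq_fun do under eq_Rintegral do rewrite mulr1.
under [X in _ --> X -> _]eq_Rintegral do rewrite mulr1.
move=> ceta.
have lb : fine (mu setT) - e <= \int[muP]_z eta j0 (S z).
  apply: (cvgr_to_ge ceta); apply: nearW => k.
  rewrite lerBlDr -lerBlDl -[fine (mu setT)]mul1r -Rintegral_cst//.
  rewrite -RintegralB//; last 2 first.
  - exact: finite_measure_integrable_cst.
  - exact: bounded_measurable_integrable.
  apply: (@le_trans _ _ (\int[mu]_x (e / (C + 1) * psi p (Z (phi k) x)))).
    apply: le_Rintegral => //.
    - apply: bounded_measurable_integrable => //.
      exact: (bounded_measurableB (bounded_measurable_cst _ 1) (beta k)).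
    - exact: (integrableZl measurableT _ (integrable_psi n_gt0 (mZ _) (iZ _) (psiC _))).
    - by move=> x _; exact: etaP.
  rewrite RintegralZl//; last exact: (integrable_psi n_gt0 (mZ _) (iZ _) (psiC _)).
  have := Rintegral_psi n_gt0 (mZ (phi k)) (iZ (phi k)) (psiC (phi k)).
  move=> hC; apply: le_trans (ler_wpM2l (ltW eC) hC) _.
  by rewrite -mulrA ger_pMr// mulrC ler_pdivrMr// mul1r lerDl.
have ub : \int[muP]_z eta j0 (S z) <= fine (muP (S @^-1` @invertible R n)).
  rewrite -[leRHS]mul1r -Rintegral_cst// [leRHS]Rintegral_mkcond.
  apply: le_Rintegral => //.
  - exact: bounded_measurable_integrable.
  - apply: bounded_measurable_integrable => //; split.
      by apply/measurable_restrict; rewrite ?setIidr.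
    exists 1 => z; rewrite patchE; case: ifP => _; rewrite ?normr1 ?normr0//.
  - move=> z _; rewrite patchE; case: ifPn => Sz.
      by have /andP[] := eta01 j0 (S z).
    by rewrite eta_noninvertible//; move: Sz; rewrite notin_setE.
have fI : muP (S @^-1` @invertible R n) \is a fin_num by exact: fin_num_measure.
have : fine (mu setT) = fine (muP (S @^-1` @invertible R n)) +
    fine (muP (S @^-1` ~` @invertible R n)).
  rewrite -muPT -fineD// -measureU//.
    by rewrite preimage_setC setUv.
  by rewrite preimage_setC setICr.
by move: lb ub; lra.
Qed.

(** Replacing the limit by the identity on a null set changes no integral, and makes every fibre law
    live on the invertible matrices, with no exceptional x. *)
Let invertible_young_limit : exists2 phi : nat -> nat,
  {homo phi : i j / (i < j)%N} &
  exists2 S, (forall z, invertible (S z)) & young_limit phi S.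
Proof.
have [phi hphi [S0 yS0]] := exists_young_limit; exists phi => //.
have [mS0 S0P] := yS0.
pose S z := if S0 z \in unitmx then S0 z else 1%:M.
have mI : measurable (S0 @^-1` @invertible R n).
  by rewrite -[X in measurable X]setTI; apply: mS0 => //; exact: measurable_invertible.
have SE : {ae muP, forall z, S0 z = S z}.
  exists (S0 @^-1` ~` @invertible R n); split.
  - by rewrite preimage_setC; exact: measurableC.
  - exact: young_limit_mass yS0.
  - by move=> z /= + iz; apply; rewrite /S iz.
have mS : measurable_fun setT S.
  apply: measurable_fun_ifT => //.
  apply: (measurable_fun_bool true).
  rewrite setTI (_ : _ @^-1` _ = S0 @^-1` @invertible R n)//.
exists S; first by move=> z; rewrite /S; case: ifPn => // _; exact: invertible1.
split => // v g tv bg; have [bu bw cw] := S0P v g tv bg.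
have bS := test_fun_bounded_measurable tv mS.
split => //; have bg1 := bounded_measurable_fst bg.
rewrite (_ : \int[muP]_y (v (S y) * g y.1) = \int[muP]_y (v (S0 y) * g y.1))//.
apply: ae_eq_Rintegral => //.
- by case: (bounded_measurableM bS bg1).
- by case: (bounded_measurableM bw bg1).
- by apply: filterS SE => z ->.
Qed.

Theorem young_measure_core : exists2 phi : nat -> nat,
  {homo phi : i j / (i < j)%N} &
  exists S : T * measurableTypeR R -> 'M[R]_n,
  [/\ measurable_fun setT S, forall z, invertible (S z),
    (\int[muP]_z (psi p (S z))%:E <= C%:E)%E &
    forall v g, Cpinv p v -> bounded_measurable g ->
      \int[mu]_x (v (Z (phi k) x) * g x) @[k --> \oo] -->
      \int[muP]_z (v (S z) * g z.1)].
Proof.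
have [phi hphi [S iS [mS SP]]] := invertible_young_limit.
exists phi => //; exists S.
have cpsi : forall s : 'M[R]_n, invertible s -> continuous_at s (psi p).
  by move=> s; exact: continuous_at_psi.
(* Lower semicontinuity: psi eta_j is a test function below psi, so the bound [C] passes to the
   limit in k; then j tends to infinity by monotone convergence. *)
have psiS : (\int[muP]_z (psi p (S z))%:E <= C%:E)%E.
  have tpsi j := test_fun_eta n_gt0 j cpsi.
  have bj j : (\int[muP]_z (psi p (S z) * eta j (S z))%:E <= C%:E)%E.
    have [bu bw cw] := SP _ _ (tpsi j) one_bm.
    rewrite -[leLHS]fineK; last first.
      apply: integrable_fin_num => //; exact: bounded_measurable_integrable.
    rewrite lee_fin; have -> : fine (\int[muP]_z (psi p (S z) * eta j (S z))%:E)%E =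
        \int[muP]_z (psi p (S z) * eta j (S z) * 1).
      by under [RHS]eq_Rintegral do rewrite mulr1.
    apply: (cvgr_to_le cw); apply: nearW => k.
    apply: le_trans (Rintegral_psi n_gt0 (mZ (phi k)) (iZ (phi k)) (psiC (phi k))).
    apply: le_Rintegral => //.
    - apply: bounded_measurable_integrable => //; exact: bounded_measurableM.
    - exact: (integrable_psi n_gt0 (mZ _) (iZ _) (psiC _)).
    - move=> x _; rewrite mulr1 ler_piMr ?psi_ge0//.
      by have /andP[] := eta01 j (Z (phi k) x).
  have h1 j : measurable_fun setT (fun z => (psi p (S z) * eta j (S z))%:E).
    apply/measurable_EFinP.
    by case: (test_fun_bounded_measurable (tpsi j) mS).
  have h2 j z : setT z -> (0 <= (psi p (S z) * eta j (S z))%:E)%E.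
    by move=> _; rewrite lee_fin mulr_ge0 ?psi_ge0//; have /andP[] := eta01 j (S z).
  have h3 z : setT z -> nondecreasing_seq (fun j => (psi p (S z) * eta j (S z))%:E).
    by move=> _ i j ij; rewrite lee_fin ler_wpM2l ?psi_ge0//; exact: eta_le.
  have := @cvg_monotone_convergence _ _ _ muP setT measurableT _ h1 h2 h3.
  rewrite (@eq_integral _ _ _ muP setT (fun z => (psi p (S z))%:E)); last first.
    move=> z _; apply: cvg_lim => //; apply: cvg_EFin; first exact: nearW.
    rewrite -[X in _ --> X]mulr1; apply: cvgM; first exact: cvg_cst.
    exact: eta_cvg.
  move=> cv; rewrite -(cvg_lim _ cv)//; apply: lime_le; last exact: nearW.
  by apply/cvg_ex; eexists; exact: cv.
split => // v g cv bg; have [_ [M gM]] := bg.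
apply/cvgrPdist_le => e e0.
have K0 : 0 < `|M| * C + 1 by rewrite ltr_wpDl// mulr_ge0.
(* Three errors of e / 3: the tail along the sequence, the tail of the limit, and the convergence
   for the test function v eta_j0. *)
pose a := e / 3 / (`|M| * C + 1).
have a0 : 0 < a by rewrite !divr_gt0.
have aK : a * `|M| * C <= e / 3.
  have h : `|M| * C <= `|M| * C + 1 by rewrite lerDl.
  rewrite -mulrA (le_trans (ler_wpM2l (ltW a0) h))//.
  by rewrite /a divfK// gt_eqF.
have [j0 vj0] := Cpinv_eta_tail n_gt0 cv a0.
have {}vj0 s := vj0 j0 s (leqnn j0).
have tv := test_fun_eta n_gt0 j0 (Cpinv_continuous_at cv).
have [bu bw cw] := SP _ _ tv bg.
have gM1 (z : T * measurableTypeR R) : `|g z.1| <= M by exact: gM.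
have hS := Cpinv_eta_integral_dist n_gt0 mS iS psiS cv (bounded_measurable_fst bg)
  gM1 (ltW a0) vj0.
have e3 : 0 < e / 3 by rewrite divr_gt0.
move/cvgrPdist_le : cw => /(_ _ e3); apply: filterS => k hk.
have hZ := Cpinv_eta_integral_dist n_gt0 (mZ (phi k)) (iZ (phi k)) (psiC (phi k))
  cv bg gM (ltW a0) vj0.
have := le_trans hS aK; have := le_trans hZ aK; move: hk.
rewrite !ler_norml => /andP[? ?] /andP[? ?] /andP[? ?]; apply/andP; split; lra.
Qed.

End core.

(** * Integrals over the domain *)

Section nonmeasurable_integrals.
Context d (T : measurableType d) (R : realType).
Variable mu : {measure set T -> \bar R}.
Local Open Scope ereal_scope.
Import HBNNSimple.

(** The integral of a nonnegative function is a supremum over simple functions below it, and setting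
    a simple function to 0 on a null set keeps its integral. Almost everywhere equal integrands can
    thus be exchanged without measurability. *)
Lemma le_nonmeasurable_integral (f g : T -> \bar R) :
  (forall x, 0 <= f x) -> (forall x, 0 <= g x) ->
  {ae mu, forall x, f x <= g x} -> \int[mu]_x f x <= \int[mu]_x g x.
Proof.
move=> f0 g0 [N [mN N0 fgN]]; rewrite (ge0_integralTE _ f0) (ge0_integralTE _ g0).
apply: ge_ereal_sup => _ [h hf <-].
have mNC : measurable (~` N) by exact: measurableC.
pose h' := mul_nnsfun h (indic_nnsfun R mNC).
have h'E x : h' x = (h x * \1_(~` N) x)%R by [].
apply: ereal_sup_ubound; exists h'.
  move=> x; rewrite h'E indicE; have [xN|xN] := boolP (x \in ~` N).
    rewrite mulr1 (le_trans (hf x))//; apply: contrapT => fg.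
    by move: xN; rewrite inE; apply; exact: fgN.
  by rewrite mulr0.
rewrite -!integralT_nnsfun; apply: ge0_ae_eq_integral => //.
- by apply/measurable_EFinP.
- by apply/measurable_EFinP.
- by move=> x _; rewrite lee_fin.
- by move=> x _; rewrite lee_fin.
exists N; split => // x /= hx; apply: contrapT => xN; apply: hx => _.
congr EFin; transitivity (h x * \1_(~` N) x)%R => //.
by rewrite indicE mem_set// mulr1.
Qed.

Lemma ae_eq_nonmeasurable_integral (f g : T -> \bar R) :
  {ae mu, forall x, f x = g x} -> \int[mu]_x f x = \int[mu]_x g x.
Proof.
have ge0 (u v : T -> \bar R) : (forall x, 0 <= u x) -> (forall x, 0 <= v x) ->
    {ae mu, forall x, u x = v x} -> \int[mu]_x u x = \int[mu]_x v x.
  move=> u0 v0 uv; apply/eqP; rewrite eq_le; apply/andP.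
  by split; apply: le_nonmeasurable_integral => //; apply: filterS uv => x ->.
move=> fg; rewrite integralE [RHS]integralE; congr (_ - _); apply: ge0.
- by move=> x; exact: funepos_ge0.
- by move=> x; exact: funepos_ge0.
- by apply: filterS fg => x fg; rewrite !funeposE fg.
- by move=> x; exact: funeneg_ge0.
- by move=> x; exact: funeneg_ge0.
- by apply: filterS fg => x fg; rewrite !funenegE fg.
Qed.

End nonmeasurable_integrals.

Section restriction.
Context d (T : measurableType d) (R : realType).
Variables (m : {measure set T -> \bar R}) (D : set T) (mD : measurable D)
  (mfin : (m D < +oo)%E).

Local Notation mu := (mfrestr mD mfin).

Lemma ae_restriction (Q : T -> Prop) :
  {ae m, forall x, D x -> Q x} <-> {ae mu, forall x, Q x}.
Proof.
split=> [[N [mN N0 QN]]|[N [mN N0 QN]]].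
  have mDN : measurable (~` D `|` N) by apply: measurableU => //; exact: measurableC.
  exists (~` D `|` N); split => //.
    change (m ((~` D `|` N) `&` D) = 0)%E.
    apply: (subset_measure0 _ mN _ N0); first exact: measurableI.
    by move=> x [[]].
  move=> x /= Qx; have [Dx|] := pselect (D x); last by left.
  by right; apply: QN => /= /(_ Dx).
exists (N `&` D); split => //; first exact: measurableI.
by move=> x /= /not_implyP[Dx Qx]; split => //; exact: QN.
Qed.

(** Moves the integral to a finite measure on the whole space, the setting of the general results
    above, and at the same time replaces the integrand by a representative. *)
Lemma ae_integral_restriction (f h : T -> \bar R) :
  {ae m, forall x, D x -> f x = h x} -> (\int[m]_(x in D) f x = \int[mu]_x h x)%E.
Proof.
move=> fh; rewrite (eq_measure_integral mu); last first.
  by move=> A mA AD; change (m A = m (A `&` D)); rewrite setIidl.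
rewrite integral_mkcond; apply: ae_eq_nonmeasurable_integral.
have aeD : {ae mu, forall x, D x} by apply/ae_restriction; exact: aeW.
have /ae_restriction fh' := fh.
by apply: filterS2 aeD fh' => x Dx fhx; rewrite patchE mem_set.
Qed.

Lemma ae_Rintegral_restriction (f h : T -> R) :
  {ae m, forall x, D x -> f x = h x} -> \int[m]_(x in D) f x = \int[mu]_x h x.
Proof.
move=> fh; rewrite /Rintegral; congr fine; apply: ae_integral_restriction.
by apply: filterS fh => x fh Dx; rewrite fh.
Qed.

End restriction.

Lemma uniform01_gt (R : realType) (a : R) : 0 <= a <= 1 ->
  uniform_prob (@ltr01 R) [set t | a < t] = (1 - a)%:E.
Proof.
move=> /andP[a0 a1]; rewrite /uniform_prob integral_uniform_pdf.
rewrite (_ : _ `&` _ = `]a, 1]%classic); last first.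
  apply/seteqP; split => x /=; rewrite !in_itv/=.
    by move=> [-> /andP[_ ->]].
  by move=> /andP[ax ->]; rewrite ax (le_trans a0 (ltW ax)).
rewrite (eq_integral (fun=> 1%:E)); last first.
  move=> x; rewrite inE/= in_itv/= => /andP[ax x1].
  by rewrite /uniform_pdf x1 (le_trans a0 (ltW ax))/= subr0 invr1.
rewrite integral_cst//= mul1e lebesgue_measure_itv/= lte_fin.
have [_|] := ltP a 1; first by rewrite -EFinB.
move=> a1'; have -> : a = 1 by apply/eqP; rewrite eq_le a1 a1'.
by rewrite subrr.
Qed.

Section rV_measure.
Variables (R : realType) (n : nat).

(** Finite intersections are taken to obtain a pi-system; indexed by lists, it remains countable, as
    the diagonal extraction requires. *)
Definition rat_ball_inter (s : seq ('M[rat]_(1, n) * nat)) : set 'rV[R]_n :=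
  [set x | forall k, k \in s -> ball (map_mx ratr k.1 : 'M[R]_(1, n)) k.2.+1%:R^-1 x].

Lemma open_rat_ball_inter s : open (rat_ball_inter s).
Proof.
elim: s => [|k s IHs].
  by rewrite (_ : rat_ball_inter _ = setT); [exact: openT|apply/seteqP; split].
rewrite (_ : rat_ball_inter _ =
    ball (map_mx ratr k.1 : 'M[R]_(1, n)) k.2.+1%:R^-1 `&` rat_ball_inter s).
  by apply: openI => //; apply: ball_open; rewrite invr_gt0.
apply/seteqP; split => x /= xks.
  by split => [|l ls]; apply: xks; rewrite inE ?eqxx// ls orbT.
by case: xks => xk xs l; rewrite inE => /predU1P[->//|]; exact: xs.
Qed.

Lemma rat_ball_inter_setI : setI_closed (range rat_ball_inter).
Proof.
move=> _ _ [s _ <-] [t _ <-]; exists (s ++ t) => //.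
apply/seteqP; split => [x xst|x [xs xt] k].
  by split=> k ks; apply: xst; rewrite mem_cat ks ?orbT.
by rewrite mem_cat => /orP[]; [exact: xs|exact: xt].
Qed.

Lemma rat_ball_inter_generates :
  @measurable _ 'rV[R]_n = <<s range rat_ball_inter >>.
Proof.
apply/seteqP; split; apply: smallest_sub.
- exact: smallest_sigma_algebra.
- move=> U oU; rewrite (open_rat_ball oU) bigcup_mkcond.
  rewrite -[X in X (\bigcup_(_ in _) _)]
    /(@measurable _ (g_sigma_algebraType (range rat_ball_inter))).
  apply: (@countable_bigcupT_measurable _ (g_sigma_algebraType (range rat_ball_inter))).
    exact: countableP.
  move=> k; case: ifP => // _.
  apply: sub_sigma_algebra; exists [:: k] => //.
  apply/seteqP; split => x /=; first by apply; rewrite inE.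
  by move=> xk l; rewrite inE => /eqP ->.
- exact: smallest_sigma_algebra.
- by move=> _ [s _ <-]; apply: sub_sigma_algebra; exact: open_rat_ball_inter.
Qed.

Lemma bounded_lebesgue_rV_lty (Omega : set 'rV[R]_n) : measurable Omega ->
  bounded_set Omega -> (lebesgue_rV R n Omega < +oo)%E.
Proof.
(* [bounded_set] bounds the norm only by the numbers strictly above [M0], hence the summand 1. *)
move=> mO [M0 [_ OM]]; pose M := M0 + 1.
have {}OM x : Omega x -> `|x| <= M by apply: OM; rewrite ltrDl.
pose A (_ : 'I_n) : set (measurableTypeR R) := `[- M, M]%classic.
have mA i : measurable (A i) by exact: measurable_itv.
apply: (@le_lt_trans _ _ (lebesgue_rV R n [set x | forall i, A i (x 0 i)])).
  apply: le_measure; rewrite ?inE//; first exact: measurable_rV_box.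
  move=> x /OM xM i; rewrite /A/= in_itv/= -ler_norml.
  exact: le_trans (mx_norm_ge x 0 i) xM.
rewrite lebesgue_rV_box// ltey_eq; apply/orP; left.
apply: (big_ind (fun x : \bar R => x \is a fin_num)) => //.
  by move=> x y; exact: fin_numM.
by move=> i _; rewrite /A lebesgue_measure_itv; case: ifP.
Qed.

End rV_measure.

(** * Lebesgue spaces *)

Section Lp_spaces.
Variables (R : realType) (n : nat) (Omega : set 'rV[R]_n).
Hypothesis mO : measurable Omega.
Local Notation leb := (lebesgue_rV R n).

Lemma lebesgue_measurable_rep d (U : measurableType d) (f : 'rV[R]_n -> U) (c : U) :
  lebesgue_measurable_fun Omega f -> exists2 h : 'rV[R]_n -> U,
    measurable_fun setT h & {ae leb, forall x, Omega x -> f x = h x}.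
Proof.
move=> [h mh fh]; exists (fun x => if x \in Omega then h x else c).
  apply: measurable_fun_if => //.
  - apply: (measurable_fun_bool true); rewrite setTI.
    rewrite (_ : _ @^-1` _ = Omega)//; apply/seteqP; split => x /=.
      exact: set_mem.
    exact: mem_set.
  - rewrite setTI (_ : _ @^-1` _ = Omega)//.
    by apply/seteqP; split => x /=; [exact: set_mem|exact: mem_set].
by apply: filterS fh => x fh Ox; rewrite mem_set// fh.
Qed.

(** The Borel representative is clipped at an essential bound, so that the bound holds
    everywhere. *)
Lemma Linfty_rep (g : 'rV[R]_n -> R) : in_Lp Omega +oo%E g ->
  exists2 h : 'rV[R]_n -> R, bounded_measurable h &
    {ae leb, forall x, Omega x -> g x = h x}.
Proof.
move=> [/(lebesgue_measurable_rep (0 : R))[h mh gh]]; rewrite /Lpnorm unlock/=.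
case: ifPn => [_ bg|].
  have [M hM] : exists M, {ae leb, forall x, `|(g \_ Omega) x| <= M}.
    apply: ess_supr_bounded; apply: le_lt_trans bg.
    by apply: le_ess_sup; apply: aeW => x /=.
  exists (fun x => Num.min `|M| (Num.max (- `|M|) (h x))).
    split; first by apply: measurable_minr => //; exact: measurable_maxr.
    exists `|M| => x; rewrite ler_norml ge_min lexx andbT le_min le_max lexx/= andbT.
    by rewrite (le_trans _ (normr_ge0 M))// oppr_le0.
  apply: filterS2 gh hM => x gh hM Ox; have := hM.
  rewrite patchE mem_set// gh// => xM.
  have := le_trans xM (ler_norm M); rewrite ler_norml => /andP[h1 h2].
  by rewrite max_r// min_r.
(* When the whole space is null the norm is 0 by convention; any function then represents [g]. *)
rewrite -leNgt measure_le0 => /eqP leb0 _.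
exists (cst 0); first exact: bounded_measurable_cst.
by exists setT; split.
Qed.

Lemma poweR_LpnormM (p : R) (Y : 'rV[R]_n -> 'M[R]_n) : p != 0 ->
  (LpnormM Omega p Y `^ p = \int[leb]_(x in Omega) (frob (Y x) `^ p)%:E)%E.
Proof.
move=> p0; rewrite /LpnormM /Lpnorm poweR_Lnorm// [RHS]integral_mkcond.
apply: eq_integral => x _ /=; rewrite !patchE; case: ifPn => _.
  by rewrite /= ger0_norm// frob_ge0.
by rewrite (_ : point = 0 :> R)// normr0 powR0.
Qed.

Lemma LpnormM_le (p C : R) (Y : 'rV[R]_n -> 'M[R]_n) : 0 < p ->
  (LpnormM Omega p Y <= C%:E)%E ->
  (\int[leb]_(x in Omega) (frob (Y x) `^ p)%:E <= (C `^ p)%:E)%E.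
Proof.
move=> p0 YC; rewrite -poweR_LpnormM ?gt_eqF// -poweR_EFin.
have Y0 : (0 <= LpnormM Omega p Y)%E by exact: Lnorm_ge0.
apply: gt0_ler_poweR => //; first exact: ltW.
- by rewrite in_itv/= Y0 leey.
- by rewrite in_itv/= (le_trans Y0 YC) leey.
Qed.

Lemma LpnormM_ge (p C : R) (Y : 'rV[R]_n -> 'M[R]_n) : 0 < p ->
  (\int[leb]_(x in Omega) (frob (Y x) `^ p)%:E <= C%:E)%E ->
  (LpnormM Omega p Y <= (C `^ p^-1)%:E)%E.
Proof.
move=> p0; rewrite -poweR_LpnormM ?gt_eqF// => YC.
have Y0 : (0 <= LpnormM Omega p Y)%E by exact: Lnorm_ge0.
have -> : LpnormM Omega p Y = ((LpnormM Omega p Y `^ p) `^ p^-1)%E.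
  by rewrite -poweRrM mulfV ?gt_eqF// poweRe1.
rewrite -poweR_EFin; apply: gt0_ler_poweR => //.
- by rewrite invr_ge0 ltW.
- by rewrite in_itv/= poweR_ge0 leey.
- by rewrite in_itv/= (le_trans (poweR_ge0 _ _) YC) leey.
Qed.

Lemma in_L1 (f : 'rV[R]_n -> R) : lebesgue_measurable_fun Omega f ->
  (\int[leb]_(x in Omega) `|f x|%:E < +oo)%E -> in_Lp Omega 1%E f.
Proof.
move=> mf fi; split => //; rewrite /Lpnorm Lnorm1.
rewrite (eq_integral ((fun x => `|f x|%:E) \_ Omega)%E) -?integral_mkcond// => x _.
by rewrite /= !patchE; case: ifPn => // _; rewrite normr0.
Qed.

End Lp_spaces.

Section Cp_functions.
Variables (R : realType) (n : nat) (n_gt0 : (0 < n)%N).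
Implicit Types (v : 'M[R]_n -> R) (p : R).

(** On the ball, v - v(0) agrees with its product by a radial cut-off, which is a test function and
    therefore bounded. *)
Lemma continuous_bounded_frob v (r : R) : continuous v ->
  exists M, forall s, frob s <= r -> `|v s| <= M.
Proof.
move=> cv; pose k := Num.truncn `|r|.
have rk : r <= k.+1%:R by rewrite (le_trans (ler_norm r))// ltW// truncnS_gt.
have tw : test_fun (fun s => (v s - v 0) * clamp (2 - frob s / k.+1%:R)).
  split.
  - move=> s; apply: continuous_at_mul.
      by apply: continuous_at_sub; [exact: cv|exact: continuous_at_cst].
    apply: continuous_at_comp; first exact: continuous_clamp.
    apply: continuous_at_sub; first exact: continuous_at_cst.
    apply: continuous_at_mul; last exact: continuous_at_cst.
    exact: continuous_frob.
  - by rewrite subrr mul0r.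
  - exists (2 * k.+1)%N => s ks; rewrite clamp_eq0 ?mulr0// subr_le0.
    by rewrite ler_pdivlMr// -natrM.
have [M wM] := test_fun_bounded tw; exists (`|M| + `|v 0|) => s sr.
have := wM s; rewrite clamp_eq1 ?mulr1.
  move=> h; rewrite -(subrK (v 0) (v s)) (le_trans (ler_normD _ _))// lerD2r.
  exact: le_trans h (ler_norm M).
have : frob s / k.+1%:R <= 1 by rewrite ler_pdivrMr// mul1r (le_trans sr).
by set x := frob s / _ => x1; lra.
Qed.

Lemma at_infty_invP (w : 'M[R]_n -> R) :
  (forall e, 0 < e -> exists r, forall s, invertible s ->
    r < frob s + frob (invmx s) -> `|w s| <= e) ->
  w s @[s --> at_infty_inv] --> (0 : R).
Proof.
move=> hw A /nbhs_ballP[e /= e0 eA].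
have [r hr] := hw _ (divr_gt0 e0 (ltr0n R 2)); exists r => // s [is_ rs].
apply: eA; rewrite /ball/= sub0r normrN (le_lt_trans (hr s is_ rs))//.
by rewrite ltr_pdivrMr// ltr_pMr// ltr1n.
Qed.

(** The new case is |s| bounded with |s^-1| large: there [v] is bounded and the denominator is
    large. For |s| large, the term |s^-1|^p only increases the denominator. *)
Lemma Cp_Cpinv p v : 1 <= p -> Cp p v -> Cpinv p v.
Proof.
move=> p1 [cv vp]; split; first exact: continuous_subspaceT.
apply: at_infty_invP => e e0.
have [r _ hr] := vp _ (nbhsx_ballx (0 : R) _ e0).
have [M vM] := continuous_bounded_frob r cv.
pose K := Num.max 1 (`|M| / e).
have K1 : 1 <= K by rewrite le_max lexx.
exists (2 * K) => s is_ sK; have psiK := psi_large p1 K1 sK.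
have psi0 : 0 < psi p s by apply: lt_le_trans psiK; exact: lt_le_trans K1.
rewrite -/(psi p s) normrM normfV (gtr0_norm psi0) ler_pdivrMr//.
have [sr|rs] := leP (frob s) r.
  apply: le_trans (vM s sr) _; apply: le_trans (ler_norm M) _.
  apply: (@le_trans _ _ (e * K)); last by rewrite ler_pM2l.
  by rewrite mulrC -ler_pdivrMr// le_max lexx orbT.
have fs := frob_gt0 n_gt0 is_.
have := hr s rs; rewrite /ball/= sub0r normrN normrM normfV.
rewrite (ger0_norm (powR_ge0 _ _)) ltr_pdivrMr ?powR_gt0// => /ltW/le_trans; apply.
by rewrite ler_pM2l// lerDl powR_ge0.
Qed.

Lemma C0_Cp p v : 1 <= p -> C0 v -> Cp p v.
Proof.
move=> p1 [cv vi]; split => // A /nbhs_ballP[e /= e0 eA].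
have [r _ hr] := vi _ (nbhsx_ballx (0 : R) _ e0).
exists (Num.max r 1) => // s; rewrite /= gt_max => /andP[rs s1].
apply: eA; rewrite /ball/= sub0r normrN normrM normfV.
have := hr s rs; rewrite /ball/= sub0r normrN; apply: le_lt_trans.
have sp : 1 <= frob s `^ p.
  by apply: le_trans (ltW s1) _; apply: le1r_powR => //; exact: ltW.
by rewrite (ger0_norm (powR_ge0 _ _)) ler_pdivrMr ?(lt_le_trans ltr01 sp)// ler_peMr.
Qed.

Lemma test_fun_C0 v : test_fun v -> C0 v.
Proof.
move=> [cv _ [k vk]]; split => // A /nbhs_singleton A0; exists k%:R => // s /= ks.
by rewrite vk// ltW.
Qed.

End Cp_functions.

(** * Disintegration *)

Lemma measurable_fun_invertible (R : realType) n (v : 'M[R]_n -> R) : (0 < n)%N ->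
  (forall s, invertible s -> continuous_at s v) -> measurable_fun invertible v.
Proof.
move=> n0 cv; apply: (@measurable_fun_cvg _ _ _ _ (fun j s => v s * eta j s)).
  move=> j; apply: measurable_funTS; apply: measurable_continuous_mx.
  by case: (test_fun_eta n0 j cv).
move=> s is_; rewrite -[X in _ --> X]mulr1; apply: cvgM; first exact: cvg_cst.
exact: eta_cvg.
Qed.

Section section_law.
Context d (T : measurableType d) (R : realType) (n : nat) (n_gt0 : (0 < n)%N).
Variables (mu : {finite_measure set T -> \bar R})
          (P : probability (measurableTypeR R) R).
Variables (S : T * measurableTypeR R -> 'M[R]_n).
Hypotheses (mS : measurable_fun setT S) (iS : forall z, invertible (S z)).

Local Notation muP := (finite_product mu P).

Let measurable_section x : measurable_fun setT (fun t => S (x, t)).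
Proof. exact: measurableT_comp mS (pair1_measurable x). Qed.

Let section_mfun x : {mfun measurableTypeR R >-> 'M[R]_n} :=
  MeasurableFun.Pack (MeasurableFun.Class
    (isMeasurableFun.Build _ _ _ _ _ (@measurable_section x))).

(** With the Young measure given as the law of [S (x, t)] for t distributed by [P], integrals
    against it are partial integrals over t, and no abstract disintegration is called for. *)
Definition section_law x : probability 'M[R]_n R := distribution P (section_mfun x).

Lemma section_law_integral x D (f : 'M[R]_n -> \bar R) : measurable D ->
  invertible `<=` D -> measurable_fun D f ->
  (\int[section_law x]_(s in D) f s = \int[P]_t f (S (x, t)))%E.
Proof.
move=> mD iD mf; have DT : (fun t => S (x, t)) @^-1` D = setT.
  by apply/seteqP; split => // t _; apply: iD; exact: iS.
rewrite integralE [RHS]integralE; congr (_ - _)%E.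
  rewrite (ge0_integral_pushforward (@measurable_section x))//.
  - by rewrite DT; apply: eq_integral => t _; rewrite /= !funeposE.
  - exact: measurable_funepos.
rewrite (ge0_integral_pushforward (@measurable_section x))//.
- by rewrite DT; apply: eq_integral => t _; rewrite /= !funenegE.
- exact: measurable_funeneg.
Qed.

Lemma section_law_invertible x : section_law x invertible = 1%E.
Proof.
transitivity (P ((fun t => S (x, t)) @^-1` invertible)) => //.
rewrite (_ : _ @^-1` _ = setT) ?probability_setT//.
by apply/seteqP; split => // t _; exact: iS.
Qed.

Variables (p C : R).
Hypothesis psiS : (\int[muP]_z (psi p (S z))%:E <= C%:E)%E.

Let cpsi s : invertible s -> continuous_at s (@psi R n p).
Proof. exact: continuous_at_psi. Qed.

Lemma section_law_psi :
  (\int[mu]_x \int[section_law x]_(s in invertible) (psi p s)%:E <= C%:E)%E.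
Proof.
apply: le_trans psiS; rewrite le_eqVlt; apply/orP; left; apply/eqP.
transitivity (\int[mu]_x \int[P]_t (psi p (S (x, t)))%:E)%E.
  apply: eq_integral => x _; rewrite section_law_integral//.
    exact: measurable_invertible.
  by apply/measurable_EFinP; exact: measurable_fun_invertible.
rewrite -(fubini_tonelli1 (m1 := mu) (m2 := P) (fun z => (psi p (S z))%:E))//.
  by apply/measurable_EFinP; exact: measurable_psi.
by move=> z; rewrite lee_fin psi_ge0.
Qed.

Section Cpinv_integrals.
Variables (v : 'M[R]_n -> R) (cv : Cpinv p v).

Let integrable_vS : (mu \x P)%E.-integrable setT (EFin \o (v \o S)).
Proof.
have := integrable_Cpinv n_gt0 mS iS psiS cv (bounded_measurable_cst _ 1).
by apply: eq_integrable => // z _; rewrite /= mulr1.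
Qed.

Lemma section_law_RintegralE x :
  \int[section_law x]_(s in invertible) v s = \int[P]_t v (S (x, t)).
Proof.
rewrite /Rintegral section_law_integral//; first exact: measurable_invertible.
apply/measurable_EFinP; apply: measurable_fun_invertible => //.
exact: Cpinv_continuous_at cv.
Qed.

Lemma section_law_RintegralT x : continuous v ->
  \int[section_law x]_(s in setT) v s = \int[section_law x]_(s in invertible) v s.
Proof.
move=> ctv; rewrite section_law_RintegralE /Rintegral section_law_integral//.
by apply/measurable_EFinP; exact: measurable_continuous_mx.
Qed.

Lemma measurable_section_law_integral :
  measurable_fun setT (fun x => \int[section_law x]_(s in invertible) v s).
Proof.
under eq_fun do rewrite section_law_RintegralE.
exact: measurableT_comp (fine_measurable _) (measurable_fubini_F integrable_vS).
Qed.

Lemma integrable_section_law_integral : mu.-integrable setT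
  (EFin \o (fun x => \int[section_law x]_(s in invertible) v s)).
Proof.
apply: (le_integrable measurableT _ _ (integrable_fubini_F integrable_vS)).
  exact/measurable_EFinP/measurable_section_law_integral.
move=> x _ /=; rewrite section_law_RintegralE /Rintegral /fubini_F/=.
(* If the inner integral is infinite its real value is 0 by convention, so the bound holds in every
   case. *)
by case: (\int[P]_y _)%E => [r| |] //=; rewrite ?normr0 ?leey.
Qed.

Lemma ae_section_law_integrable :
  {ae mu, forall x, P.-integrable setT (EFin \o (fun t => v (S (x, t))))}.
Proof. exact: (ae_integrable1 integrable_vS). Qed.

Lemma ae_section_law_integrableT : continuous v ->
  {ae mu, forall x, (section_law x).-integrable setT (EFin \o v)}.
Proof.
move=> ctv; apply: filterS ae_section_law_integrable => x ix.
apply: (integrable_pushforward (@measurable_section x)) => //.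
by apply/measurable_EFinP; exact: measurable_continuous_mx.
Qed.

Lemma section_law_Fubini (g : T -> R) : bounded_measurable g ->
  \int[mu]_x ((\int[section_law x]_(s in invertible) v s) * g x) =
  \int[muP]_z (v (S z) * g z.1).
Proof.
move=> bg; have ivg := integrable_Cpinv n_gt0 mS iS psiS cv (bounded_measurable_fst bg).
rewrite /Rintegral; congr fine.
rewrite -(integral12_prod_meas1 (m1 := mu) (m2 := P)
  (f := fun z => (v (S z) * g z.1)%:E) ivg).
(* The factor g(x) is pulled out of the inner integral only where v(S(x, .)) is integrable, that is,
   for almost every x. *)
apply: ae_eq_nonmeasurable_integral; apply: filterS ae_section_law_integrable => x ix.
rewrite -/(Rintegral _ _ _) section_law_RintegralE /fubini_F/=.
under [RHS]eq_integral do rewrite EFinM muleC.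
rewrite integralZl// muleC EFinM /Rintegral fineK//.
exact: integrable_fin_num.
Qed.

End Cpinv_integrals.
End section_law.

(** * From bounded sequences to Young measures *)

Section theorem_i.
Variables (R : realType) (n : nat) (n_gt0 : (0 < n)%N) (p : R) (p_ge1 : 1 <= p).
Variables (Omega : set 'rV[R]_n) (openO : open Omega) (boundedO : bounded_set Omega).
Local Notation leb := (lebesgue_rV R n).

Let p_gt0 : 0 < p. Proof. exact: lt_le_trans p_ge1. Qed.

Lemma open_measurable_rV : measurable Omega.
Proof. exact: sub_sigma_algebra. Qed.

Lemma open_bounded_lebesgue_lty : (leb Omega < +oo)%E.
Proof. exact: bounded_lebesgue_rV_lty open_measurable_rV boundedO. Qed.

Local Notation mO := open_measurable_rV.
Local Notation mu := (mfrestr open_measurable_rV open_bounded_lebesgue_lty).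

(** Borel representatives with the identity put in wherever they are singular, so that the later
    arguments meet no exceptional points. *)
Lemma invertible_rep (Y : nat -> 'rV[R]_n -> 'M[R]_n) :
  bounded_seq_LpM Omega p Y -> (forall k, ae_invertible Omega (Y k)) ->
  bounded_seq_LpM Omega p (fun k x => invmx (Y k x)) ->
  exists2 Z : nat -> 'rV[R]_n -> 'M[R]_n,
    [/\ forall k, measurable_fun setT (Z k), forall k x, invertible (Z k x) &
      forall k, {ae leb, forall x, Omega x -> Y k x = Z k x}] &
    exists C, forall k, (\int[mu]_x (psi p (Z k x))%:E <= C%:E)%E.
Proof.
move=> [YL [CY YC]] iY [_ [CI IC]].
have /choice[h hP] k : exists h : 'rV[R]_n -> 'M[R]_n, measurable_fun setT h /\
    {ae leb, forall x, Omega x -> Y k x = h x}.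
  have [mY _] := YL k.
  by have [h mh Yh] := lebesgue_measurable_rep mO (1%:M : 'M[R]_n) mY; exists h.
pose Z k x := if h k x \in unitmx then h k x else 1%:M.
have mh k : measurable_fun setT (h k) by case: (hP k).
have mZ k : measurable_fun setT (Z k).
  apply: measurable_fun_ifT => //; apply: (measurable_fun_bool true).
  rewrite (_ : _ @^-1` _ = h k @^-1` @invertible R n)//.
  by apply: mh => //; exact: measurable_invertible.
have iZ k x : invertible (Z k x).
  by rewrite /Z; case: ifPn => // _; exact: invertible1.
have YZ k : {ae leb, forall x, Omega x -> Y k x = Z k x}.
  have [_ Yh] := hP k; apply: filterS2 Yh (iY k) => x Yh iYx Ox.
  by have := iYx Ox; rewrite /Z /invertible/= Yh// => ->.
exists Z => //; exists (CY `^ p + CI `^ p) => k.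
have mf : measurable_fun setT (fun x => (frob (Z k x) `^ p)%:E).
  apply/measurable_EFinP; apply: (measurableT_comp (@measurable_powR R p)).
  apply: measurableT_comp (mZ k).
  by apply: measurable_continuous_mx; exact: continuous_frob.
have mfi : measurable_fun setT (fun x => (frob (invmx (Z k x)) `^ p)%:E).
  apply/measurable_EFinP; apply: (measurableT_comp (@measurable_powR R p)).
  apply: (measurable_invertible_comp n_gt0 (mZ k) (iZ k) (v := fun s => frob (invmx s))).
  by move=> s; exact: continuous_at_frob_invmx.
under eq_integral do rewrite /psi EFinD.
rewrite ge0_integralD//; last 2 first.
- by move=> x _; rewrite lee_fin powR_ge0.
- by move=> x _; rewrite lee_fin powR_ge0.
rewrite EFinD; apply: leeD.
  rewrite -(@ae_integral_restriction _ _ _ leb Omega mO open_bounded_lebesgue_lty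
    (fun x => (frob (Y k x) `^ p)%:E)).
    exact: LpnormM_le (YC k).
  by apply: filterS (YZ k) => x YZ' Ox; rewrite YZ'.
rewrite -(@ae_integral_restriction _ _ _ leb Omega mO open_bounded_lebesgue_lty
  (fun x => (frob (invmx (Y k x)) `^ p)%:E)).
  exact: (LpnormM_le (Y := fun x => invmx (Y k x)) p_gt0 (IC k)).
by apply: filterS (YZ k) => x YZ' Ox; rewrite YZ'.
Qed.

Theorem theorem_i (Y : nat -> 'rV[R]_n -> 'M[R]_n) :
  bounded_seq_LpM Omega p Y -> (forall k, ae_invertible Omega (Y k)) ->
  bounded_seq_LpM Omega p (fun k x => invmx (Y k x)) ->
  exists (phi : nat -> nat) (nu : 'rV[R]_n -> probability 'M[R]_n R),
    [/\ {homo phi : i j / (i < j)%N}, Ypinv Omega p nu &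
      generates_inv Omega p (fun k => Y (phi k)) nu].
Proof.
move=> bY iY bI; have [Z [mZ iZ YZ] [C psiZ]] := invertible_rep bY iY bI.
pose P : probability (measurableTypeR R) R := uniform_prob (@ltr01 R).
have [phi hphi [S [mS iS psiS SP]]] := young_measure_core (P := P)
  (@uniform01_gt R) (@rat_ball_inter_generates R n) (@rat_ball_inter_setI R n)
  n_gt0 p_ge1 mZ iZ psiZ.
pose nu := section_law P mS.
have gen : generates_inv Omega p (fun k => Y (phi k)) nu.
  move=> g v /(Linfty_rep mO)[h bh gh] cv.
  rewrite (@ae_Rintegral_restriction _ _ _ leb Omega mO open_bounded_lebesgue_lty _
    (fun x => \int[nu x]_(s in invertible) v s * h x)); last first.
    by apply: filterS gh => x gh Ox; rewrite gh.
  rewrite (section_law_Fubini n_gt0 mS iS psiS cv bh).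
  rewrite (_ : (fun k => _) = (fun k => \int[mu]_x (v (Z (phi k) x) * h x))).
    exact: SP.
  apply/funext => k; apply: ae_Rintegral_restriction.
  by apply: filterS2 gh (YZ (phi k)) => x gh YZ' Ox; rewrite gh// YZ'.
have L1 v : Cpinv p v -> in_Lp Omega 1%E (fun x => \int[nu x]_(s in invertible) v s).
  move=> cv; apply: in_L1.
    exists (fun x => \int[nu x]_(s in invertible) v s); last exact: aeW.
    apply: measurable_funTS.
    exact: (measurable_section_law_integral n_gt0 mS iS psiS cv).
  rewrite (@ae_integral_restriction _ _ _ leb Omega mO open_bounded_lebesgue_lty _
    (fun x => `|\int[nu x]_(s in invertible) v s|%:E)); last exact: aeW.
  by have /integrableP[_] := integrable_section_law_integral n_gt0 mS iS psiS cv.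
have nuT v x : continuous v -> Cpinv p v ->
    \int[nu x]_(s in setT) v s = \int[nu x]_(s in invertible) v s.
  by move=> ctv cv; rewrite (section_law_RintegralT n_gt0 P mS iS cv).
exists phi, nu; split => //; split; last 2 first.
- rewrite (@ae_integral_restriction _ _ _ leb Omega mO open_bounded_lebesgue_lty _
    (fun x => \int[nu x]_(s in invertible) (psi p s)%:E)%E); last exact: aeW.
  by apply: le_lt_trans (section_law_psi n_gt0 mS iS psiS) _; exact: ltry.
- by apply: aeW => x _; exact: section_law_invertible.
(* Functions in C_0 and C_p lie in C_{p,-p}, and [nu x] lives on the invertible matrices, so
   membership in Y^p follows from the convergence already obtained; the subsequence itself is the
   generating sequence. *)
split.
  move=> v c0; have cp := C0_Cp p_ge1 c0; have cv := Cp_Cpinv n_gt0 p_ge1 cp.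
  have [ctv _] := c0; have [mL _] := L1 v cv.
  by rewrite (_ : (fun x => _) = fun x => \int[nu x]_(s in invertible) v s)//;
    apply/funext => x; exact: nuT.
exists (fun k => Y (phi k)); split.
  by have [YL [CY YC]] := bY; split => //; exists CY => k; exact: YC.
move=> v cp; have cv := Cp_Cpinv n_gt0 p_ge1 cp; have [ctv _] := cp.
have nuE : (fun x => \int[nu x]_(s in setT) v s) =
    (fun x => \int[nu x]_(s in invertible) v s).
  by apply/funext => x; exact: nuT.
rewrite nuE; split.
  have ai := ae_section_law_integrableT n_gt0 mS iS psiS cv ctv.
  exact: (iffRL (ae_restriction open_measurable_rV open_bounded_lebesgue_lty _) ai).
split; [|exact: L1|by move=> g gL; exact: gen].
move=> k; have YZk : {ae leb, forall x, Omega x -> (v \o Y (phi k)) x = v (Z (phi k) x)}.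
  by apply: filterS (YZ (phi k)) => x YZ' Ox /=; rewrite YZ'.
apply: in_L1.
  exists (fun x => v (Z (phi k) x)) => //; apply: measurable_funTS.
  by apply: measurableT_comp (mZ _); exact: measurable_continuous_mx.
rewrite (@ae_integral_restriction _ _ _ leb Omega mO open_bounded_lebesgue_lty _
  (fun x => `|v (Z (phi k) x) * 1|%:E)); last first.
  by apply: filterS YZk => x YZ' Ox; rewrite YZ'// mulr1.
have /integrableP[_] := integrable_Cpinv n_gt0 (mZ (phi k)) (iZ (phi k)) (psiZ (phi k))
  cv (bounded_measurable_cst _ 1).
by [].
Qed.

End theorem_i.

(** * Realisation by sequences of invertible matrices *)

Section truncation.
Context d (T : measurableType d) (R : realType) (n : nat) (n_gt0 : (0 < n)%N).
Variables (mu : {finite_measure set T -> \bar R}) (p : R) (C : R).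
Variables (Y : nat -> T -> 'M[R]_n) (I : ('M[R]_n -> R) -> T -> R).
Hypotheses (mY : forall k, measurable_fun setT (Y k))
  (YI : forall v g, test_fun v -> bounded_measurable g ->
    \int[mu]_x (v (Y k x) * g x) @[k --> \oo] --> \int[mu]_x (I v x * g x))
  (psiI : forall j, \int[mu]_x I (fun s => psi p s * eta j s) x <= C)
  (etaI : \int[mu]_x I (eta j) x @[j --> \oo] --> fine (mu setT)).

Let YI1 v : test_fun v ->
  \int[mu]_x v (Y k x) @[k --> \oo] --> \int[mu]_x I v x.
Proof.
move=> tv; have := YI tv (bounded_measurable_cst _ 1).
rewrite (@eq_Rintegral _ _ _ mu setT (I v)) => [|x _]; last by rewrite mulr1.
by under eq_fun do under eq_Rintegral do rewrite mulr1.
Qed.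

Let test_psi j : test_fun (fun s : 'M[R]_n => psi p s * eta j s).
Proof. by apply: test_fun_eta => // s is_; exact: continuous_at_psi. Qed.

(** [I v] stands for x |-> \int v dnu_x. For each cut-off j the integrals of psi eta_j and eta_j
    along [Y] converge, so some k >= j is late enough for both. An error 1 is enough to bound the
    moments, while the error 1 / (j + 1) in the mass has to vanish as j grows. *)
Let exists_index j : exists k, [/\ (j <= k)%N,
  \int[mu]_x (psi p (Y k x) * eta j (Y k x)) <= C + 1 &
  \int[mu]_x I (eta j) x - j.+1%:R^-1 <= \int[mu]_x eta j (Y k x)].
Proof.
have /cvgrPdist_le/(_ _ ltr01)[k1 _ h1] := YI1 (test_psi j).
have j0 : 0 < (j.+1%:R^-1 : R) by rewrite invr_gt0.
have /cvgrPdist_le/(_ _ j0)[k2 _ h2] := YI1 (test_fun_eta1 R n_gt0 j).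
exists (maxn j (maxn k1 k2)); split; first exact: leq_maxl.
  have := psiI j; have := h1 (maxn j (maxn k1 k2)).
  rewrite /= !leq_max leqnn !orbT ler_norml => /(_ isT)/andP[]; lra.
have := h2 (maxn j (maxn k1 k2)).
rewrite /= !leq_max leqnn !orbT ler_norml => /(_ isT)/andP[_]; by rewrite !lerBlDr addrC.
Qed.

(* Keep the values where the cut-off is at least 1/2, replace the others by the
   identity; the two sequences differ on a set of small measure. *)
Lemma truncation : exists2 Z : nat -> T -> 'M[R]_n,
  [/\ forall k, measurable_fun setT (Z k), forall k x, invertible (Z k x) &
      exists K, forall k, (\int[mu]_x (psi p (Z k x))%:E <= K%:E)%E] &
  forall v g, test_fun v -> bounded_measurable g ->
    \int[mu]_x (v (Z k x) * g x) @[k --> \oo] --> \int[mu]_x (I v x * g x).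
Proof.
have /choice[k hk] := exists_index.
pose Z j x := if 2^-1 <= eta j (Y (k j) x) then Y (k j) x else 1%:M.
have metaY j : measurable_fun setT (fun x => eta j (Y (k j) x)).
  by have [] := test_fun_bounded_measurable (test_fun_eta1 R n_gt0 j) (mY (k j)).
have mZ j : measurable_fun setT (Z j).
  by apply: measurable_fun_ifT => //; exact: measurable_fun_ler.
exists Z; [split => // [j x|]|].
- rewrite /Z; case: ifPn => [h|_]; last exact: invertible1.
  apply: contrapT => nis; move: h; rewrite eta_noninvertible// invr_le0.
  by rewrite leNgt ltr0n.
(* Where the value of [Y] is kept, eta >= 1/2 gives psi <= 2 psi eta, whose integral is at most 2 (C
   + 1); elsewhere psi takes its value at the identity. *)
- exists (2 * (C + 1) + psi p (1%:M : 'M[R]_n) * fine (mu setT)) => j.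
  have ib : mu.-integrable setT (EFin \o (fun x => psi p (Y (k j) x) * eta j (Y (k j) x))).
    exact/bounded_measurable_integrable/(test_fun_bounded_measurable (test_psi j)).
  have ic : mu.-integrable setT (EFin \o cst (psi p (1%:M : 'M[R]_n))).
    exact/bounded_measurable_integrable/bounded_measurable_cst.
  have i2 : mu.-integrable setT
      (EFin \o (fun x => 2 * (psi p (Y (k j) x) * eta j (Y (k j) x)))).
    by have := integrableZl measurableT 2 ib.
  apply: (@le_trans _ _ (\int[mu]_x (2 * (psi p (Y (k j) x) * eta j (Y (k j) x)) +
      psi p (1%:M : 'M[R]_n))%:E)%E).
    apply: ge0_le_integral => //.
    - by move=> x _; rewrite lee_fin psi_ge0.
    - apply/measurable_EFinP; apply: (measurable_psi n_gt0) => // x.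
      rewrite /Z; case: ifPn => [h|_]; last exact: invertible1.
      apply: contrapT => nis; move: h; rewrite eta_noninvertible// invr_le0.
      by rewrite leNgt ltr0n.
    - by have /measurable_int := integrableD measurableT i2 ic.
    - move=> x _; rewrite lee_fin /Z; have p1 := psi_ge0 p (1%:M : 'M[R]_n).
      have pY := psi_ge0 p (Y (k j) x); have /andP[e0 e1] := eta01 j (Y (k j) x).
      rewrite (fun_if (psi p)).
      move: (psi p (Y (k j) x)) (eta j (Y (k j) x)) (psi p 1%:M) p1 pY e0 => a b c c0 a0 b0.
      by case: ifPn => h; nra.
  have [_ hpsi _] := hk j.
  have := RintegralD measurableT i2 ic.
  rewrite RintegralZl// Rintegral_cst// => E.
  have /integrable_fin_num fi := integrableD measurableT i2 ic.
  rewrite -(fineK (fi measurableT)) lee_fin.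
  have := lexx (2 * \int[mu]_x (psi p (Y (k j) x) * eta j (Y (k j) x)) +
    psi p (1%:M : 'M[R]_n) * fine (mu setT)).
  rewrite -{1}E => /le_trans; apply.
  by rewrite lerD2r ler_pM2l.
move=> v g tv bg; have [M vM] := test_fun_bounded tv; have [_ [G gG]] := bg.
have M0 : 0 <= M by exact: le_trans (vM 0).
(* Where a value was replaced, |v(Z) - v(Y)| <= 2 M and 1 <= 2 (1 - eta_j), hence the factor 4 M.
   The parenthesis bounds the integral of 1 - eta_j and tends to 0 by [etaI]. *)
pose r j : R := 4 * M * `|G| * (fine (mu setT) - \int[mu]_x I (eta j) x + j.+1%:R^-1).
have r0 : r j @[j --> \oo] --> (0 : R).
  rewrite -[X in _ --> X](mulr0 (4 * M * `|G|)); apply: cvgM; first exact: cvg_cst.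
  rewrite -[X in _ --> X]addr0; apply: cvgD; last exact: cvg_harmonic.
  rewrite -(subrr (fine (mu setT))); apply: cvgB => //; exact: cvg_cst.
have bZ j := test_fun_bounded_measurable tv (mZ j).
have bY j := test_fun_bounded_measurable tv (mY (k j)).
have bE j := test_fun_bounded_measurable (test_fun_eta1 R n_gt0 j) (mY (k j)).
have ii f : bounded_measurable f -> mu.-integrable setT (EFin \o f).
  by move=> bf; exact: bounded_measurable_integrable.
have dist j : `|\int[mu]_x (v (Z j x) * g x) - \int[mu]_x (v (Y (k j) x) * g x)| <= r j.
  rewrite -RintegralB//; [|exact/ii/bounded_measurableM..].
  apply: le_trans (le_normr_Rintegral measurableT _) _.
    exact/ii/bounded_measurableB/bounded_measurableM/bg/bY/bounded_measurableM.
  apply: (@le_trans _ _ (\int[mu]_x (4 * M * `|G| * (1 - eta j (Y (k j) x))))).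
    apply: le_Rintegral => //.
    - have := ii _ (bounded_measurableB (bounded_measurableM (bZ j) bg)
        (bounded_measurableM (bY j) bg)).
      by move=> /integrable_norm.
    - apply/ii/bounded_measurableM; first exact: bounded_measurable_cst.
      by apply: bounded_measurableB => //; exact: bounded_measurable_cst.
    move=> x _; rewrite -mulrBl normrM mulrAC ler_pM//; last first.
      by rewrite (le_trans (gG x))// ler_norm.
    have /andP[e0 e1] := eta01 j (Y (k j) x).
    have vY := vM (Y (k j) x); have v1 := vM 1%:M.
    rewrite /Z; case: ifPn => [_|]; first by rewrite subrr normr0; nra.
    rewrite -ltNge => h; apply: le_trans (ler_normB _ _) _.
    by apply: le_trans (lerD v1 vY) _; nra.
  rewrite RintegralZl//; last first.
    by apply/ii/bounded_measurableB => //; exact: bounded_measurable_cst.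
  rewrite RintegralB//; [|exact/ii/bounded_measurable_cst|exact/ii].
  rewrite Rintegral_cst// mul1r /r ler_wpM2l ?mulr_ge0//.
  have [_ _] := hk j; move: (j.+1%:R^-1 : R) => e; lra.
have YIk : \int[mu]_x (v (Y (k j) x) * g x) @[j --> \oo] --> \int[mu]_x (I v x * g x).
  apply/cvgrPdist_le => e e0; have /cvgrPdist_le/(_ _ e0)[N _ hN] := YI tv bg.
  exists N => // j /= Nj; apply: hN => /=.
  by have [jk _ _] := hk j; exact: leq_trans Nj jk.
rewrite -[X in _ --> X]add0r.
rewrite (_ : (fun j => _) = (fun j => (\int[mu]_x (v (Z j x) * g x) -
  \int[mu]_x (v (Y (k j) x) * g x)) + \int[mu]_x (v (Y (k j) x) * g x))); last first.
  by apply/funext => j; rewrite subrK.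
apply: cvgD YIk.
apply: (@squeeze_cvgr _ _ _ _ (fun j => - r j) r) => //.
  by apply: nearW => j; rewrite -ler_norml.
by rewrite -[X in _ --> X]oppr0; exact: cvgN.
Qed.

End truncation.

(** Monotone convergence. The limit may be infinite, so the result applies to positive and negative
    parts without integrability. *)
Lemma integral_eta_cvg (R : realType) n (n_gt0 : (0 < n)%N)
    (m : probability 'M[R]_n R) (w : 'M[R]_n -> R) :
  (forall s, invertible s -> continuous_at s w) -> (forall s, 0 <= w s) ->
  (\int[m]_(s in setT) (w s * eta j s))%:E @[j --> \oo] -->
  (\int[m]_(s in invertible) (w s)%:E)%E.
Proof.
move=> cw w0; have tw j := test_fun_eta n_gt0 j cw.
have mI := @measurable_invertible R n.
rewrite (eq_integral (fun s => limn (fun j => (w s * eta j s)%:E))); last first.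
  move=> s; rewrite inE => is_; apply/esym/cvg_lim => //; apply: cvg_EFin.
    exact: nearW.
  rewrite -[X in _ --> X]mulr1; apply: cvgM; first exact: cvg_cst.
  exact: eta_cvg.
rewrite (_ : (fun j => _) = (fun j => \int[m]_(s in invertible) (w s * eta j s)%:E)%E).
  apply: cvg_monotone_convergence => //.
  - move=> j; apply/measurable_EFinP; apply: measurable_funTS.
    by apply: measurable_continuous_mx; case: (tw j).
  - by move=> j s _; rewrite lee_fin mulr_ge0//; have /andP[] := eta01 j s.
  - by move=> s _ i j ij; rewrite lee_fin ler_wpM2l// eta_le.
apply/funext => j; rewrite /Rintegral fineK.
  rewrite [RHS]integral_mkcond; apply: eq_integral => s _; rewrite patchE.
  case: ifPn => // /negP sI; rewrite eta_noninvertible ?mulr0//.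
  by move=> is_; apply: sI; exact: mem_set.
apply: integrable_fin_num => //; apply: bounded_measurable_integrable => //.
exact: (test_fun_bounded_measurable (tw j) (@measurable_id _ _ setT)).
Qed.

Lemma integral_eta_determined (R : realType) n (n_gt0 : (0 < n)%N)
    (m m' : probability 'M[R]_n R) (w : 'M[R]_n -> R) :
  (forall s, invertible s -> continuous_at s w) -> (forall s, 0 <= w s) ->
  (forall j, \int[m]_(s in setT) (w s * eta j s) = \int[m']_(s in setT) (w s * eta j s)) ->
  (\int[m]_(s in invertible) (w s)%:E = \int[m']_(s in invertible) (w s)%:E)%E.
Proof.
move=> cw w0 mm'; have := integral_eta_cvg n_gt0 (m := m') cw w0.
under eq_fun do rewrite -mm'.
by move=> h; exact: (cvg_unique _ (integral_eta_cvg n_gt0 (m := m) cw w0) h).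
Qed.

Lemma ae_eq_of_Rintegral d (T : measurableType d) (R : realType)
    (mu : {finite_measure set T -> \bar R}) (f h : T -> R) :
  bounded_measurable f -> bounded_measurable h ->
  (forall g, bounded_measurable g -> \int[mu]_x (f x * g x) = \int[mu]_x (h x * g x)) ->
  {ae mu, forall x, f x = h x}.
Proof.
move=> bf bh fh.
have fhA A : measurable A -> \int[mu]_(x in A) f x = \int[mu]_(x in A) h x.
  move=> mA; rewrite Rintegral_mkcond [RHS]Rintegral_mkcond.
  have restrictE (w : T -> R) : w \_ A = (fun x => w x * (x \in A)%:R).
    by apply/funext => x; rewrite patchE; case: ifPn; rewrite ?mulr1 ?mulr0.
  rewrite !restrictE; apply: fh; apply: bounded_measurable_bool.
  apply: (measurable_fun_bool true); rewrite setTI (_ : _ @^-1` _ = A)//.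
  by apply/seteqP; split => x /=; [exact: set_mem|exact: mem_set].
have ii w : bounded_measurable w -> mu.-integrable setT (EFin \o w).
  by move=> bw; exact: bounded_measurable_integrable.
have [mf _] := bf; have [mh _] := bh.
have h1 : {ae mu, forall x, f x <= h x}.
  by apply: ae_le_of_Rintegral => //; [exact: ii|exact: ii|move=> A mA; rewrite fhA].
have h2 : {ae mu, forall x, h x <= f x}.
  by apply: ae_le_of_Rintegral => //; [exact: ii|exact: ii|move=> A mA; rewrite fhA].
by apply: filterS2 h1 h2 => x xfh xhf; apply/eqP; rewrite eq_le xfh.
Qed.

Lemma bounded_in_Linfty (R : realType) n (Omega : set 'rV[R]_n) (f : 'rV[R]_n -> R) (M : R) :
  lebesgue_measurable_fun Omega f -> (forall x, `|f x| <= M) -> in_Lp Omega +oo%E f.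
Proof.
move=> mf fM; split=> //; rewrite /Lpnorm unlock/=; case: ifPn => // _.
apply: (@le_lt_trans _ _ M%:E); last exact: ltry.
apply/ess_supP; apply: aeW => x /=; rewrite lee_fin patchE; case: ifPn => _ //.
by rewrite (_ : point = 0 :> R)// normr0 (le_trans _ (fM x)).
Qed.

(** * Integrals of test functions against a Young measure *)

Section test_function_integrals.
Variables (R : realType) (n : nat) (n_gt0 : (0 < n)%N) (p : R) (p_ge1 : 1 <= p).
Variables (Omega : set 'rV[R]_n) (openO : open Omega) (boundedO : bounded_set Omega).
Local Notation leb := (lebesgue_rV R n).
Local Notation mO := (open_measurable_rV openO).
Local Notation fO := (open_bounded_lebesgue_lty openO boundedO).
Local Notation mu := (mfrestr mO fO).

Lemma test_fun_integrable (m : probability 'M[R]_n R) v D : measurable D ->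
  test_fun v -> m.-integrable D (EFin \o v).
Proof.
move=> mD tv; apply: bounded_measurable_integrable => //.
exact: (test_fun_bounded_measurable tv (@measurable_id _ _ setT)).
Qed.

(** Probability measures preserve the bound of [v], so the measurability granted for functions in
    C_0 puts the integral in L^oo, where bounded Borel representatives exist. *)
Lemma test_fun_rep (nu : 'rV[R]_n -> probability 'M[R]_n R) v :
  young_measure Omega nu -> test_fun v -> exists h : 'rV[R]_n -> R,
    bounded_measurable h /\
    {ae leb, forall x, Omega x -> \int[nu x]_(s in setT) v s = h x}.
Proof.
move=> ym tv; have [M vM] := test_fun_bounded tv.
have [|h bh nuh] := @Linfty_rep _ _ _ mO (fun x => \int[nu x]_(s in setT) v s).
  apply: (@bounded_in_Linfty _ _ _ _ M); first exact/ym/test_fun_C0.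
  move=> x; have iv := test_fun_integrable (nu x) measurableT tv.
  apply: le_trans (le_normr_Rintegral measurableT iv) _.
  have -> : M = \int[nu x]_(s in setT) (cst M) s.
    by rewrite Rintegral_cst// [X in fine X](@probability_setT _ _ _ (nu x)) mulr1.
  apply: le_Rintegral => //; first exact: integrable_norm.
  by apply: bounded_measurable_integrable => //; exact: bounded_measurable_cst.
by exists h.
Qed.

Lemma test_fun_Rintegral_cvg (nu : 'rV[R]_n -> probability 'M[R]_n R) :
  {ae leb, forall x, Omega x -> nu x invertible = 1%E} ->
  {ae leb, forall x, Omega x ->
    \int[nu x]_(s in setT) eta j s @[j --> \oo] --> (1 : R)}.
Proof.
apply: filterS => x + Ox => /(_ Ox) nu1.
have := @integral_eta_cvg _ _ n_gt0 (nu x) (fun=> 1) (fun s _ => @continuous_at_cst _ _ 1 s)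
  (fun=> ler01).
rewrite (_ : (\int[nu x]_(s in invertible) 1%:E = 1%:E)%E); last first.
  by rewrite integral_cst ?mul1e//; exact: measurable_invertible.
move=> /fine_cvgP[_]; under eq_fun do under eq_Rintegral do rewrite mul1r.
by [].
Qed.


Lemma Rintegral_off_invertible (m : probability 'M[R]_n R) (v : 'M[R]_n -> R) :
  (forall s, ~ invertible s -> v s = 0) ->
  \int[m]_(s in setT) v s = \int[m]_(s in invertible) v s.
Proof.
move=> vI; rewrite [RHS]Rintegral_mkcond; apply: eq_Rintegral => s _; rewrite patchE.
by case: ifPn => // /negP sI; rewrite vI// => is_; apply: sI; exact: mem_set.
Qed.

Lemma test_fun_Rintegral_le (m : probability 'M[R]_n R) (v w : 'M[R]_n -> R) :
  test_fun v -> (forall s, 0 <= v s) -> (forall s, ~ invertible s -> v s = 0) ->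
  measurable_fun invertible w -> (forall s, invertible s -> v s <= w s) ->
  ((\int[m]_(s in setT) v s)%:E <= \int[m]_(s in invertible) (w s)%:E)%E.
Proof.
move=> tv v0 vI mw vw; have mI := @measurable_invertible R n.
rewrite (Rintegral_off_invertible _ vI) /Rintegral fineK; last first.
  by apply: integrable_fin_num => //; exact: test_fun_integrable.
apply: ge0_le_integral => //.
- by move=> s _; rewrite lee_fin.
- apply/measurable_EFinP; apply: measurable_funTS.
  by apply: measurable_continuous_mx; case: tv.
- exact/measurable_EFinP.
Qed.

Section Young_limits.
Variables (nu : 'rV[R]_n -> probability 'M[R]_n R) (I : ('M[R]_n -> R) -> 'rV[R]_n -> R).
Hypotheses (bI : forall v, test_fun v -> bounded_measurable (I v))
  (nuI : forall v, test_fun v ->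
    {ae leb, forall x, Omega x -> \int[nu x]_(s in setT) v s = I v x}).

Lemma test_fun_rep_psi j :
  (\int[leb]_(x in Omega) \int[nu x]_(s in invertible)
     (frob s `^ p + frob (invmx s) `^ p)%:E < +oo)%E ->
  \int[mu]_x I (fun s => psi p s * eta j s) x <=
  fine (\int[leb]_(x in Omega) \int[nu x]_(s in invertible) (psi p s)%:E)%E.
Proof.
move=> psioo; set A := (\int[leb]_(x in Omega) _)%E.
have cpsi (s : 'M[R]_n) : invertible s -> continuous_at s (psi p).
  by move=> is_; exact: continuous_at_psi.
have tv := test_fun_eta n_gt0 j cpsi.
have A0 : (0 <= A)%E.
  by apply: integral_ge0 => x _; apply: integral_ge0 => s _; rewrite lee_fin psi_ge0.
have Afin : A \is a fin_num by rewrite ge0_fin_numE.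
rewrite -lee_fin (fineK Afin) /Rintegral fineK; last first.
  apply: integrable_fin_num => //.
  by apply: bounded_measurable_integrable => //; exact: bI.
have vpsi (s : 'M[R]_n) : 0 <= psi p s * eta j s <= psi p s.
  have /andP[e0 e1] := eta01 j s; have p0 := psi_ge0 p s.
  by rewrite mulr_ge0//= ler_piMr.
rewrite /A -(@ae_integral_restriction _ _ _ leb Omega mO fO
  (fun x => (\int[nu x]_(s in setT) (psi p s * eta j s))%:E)); last first.
  by apply: filterS (nuI tv) => x nuI' Ox; rewrite nuI'.
rewrite !(@ae_integral_restriction _ _ _ leb Omega mO fO _ _ (aeW _ (fun x _ => erefl))).
(* The comparison holds for suprema over simple functions, so measurability in x of the integral of
   psi is not called upon. *)
apply: le_nonmeasurable_integral => [x|x|].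
- by rewrite lee_fin; apply: Rintegral_ge0 => s _; have /andP[] := vpsi s.
- by apply: integral_ge0 => s _; rewrite lee_fin psi_ge0.
apply: aeW => x; apply: test_fun_Rintegral_le => //.
- by move=> s; have /andP[] := vpsi s.
- by move=> s ns; rewrite eta_noninvertible ?mulr0.
- exact: measurable_fun_invertible.
- by move=> s _; have /andP[] := vpsi s.
Qed.

(** Dominated convergence with the constant 1: at almost every x the integrals of [eta j] tend to
    the mass 1 of the invertible matrices. *)
Lemma test_fun_rep_eta : {ae leb, forall x, Omega x -> nu x invertible = 1%E} ->
  \int[mu]_x I (eta j) x @[j --> \oo] --> fine (mu setT).
Proof.
move=> inv; have te j := test_fun_eta1 R n_gt0 j.
have ie j : mu.-integrable setT (EFin \o I (eta j)).
  by apply: bounded_measurable_integrable => //; exact: bI.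
have nuIall : {ae leb, forall x, Omega x ->
    forall j, \int[nu x]_(s in setT) eta j s = I (eta j) x}.
  have : {ae leb, forall x, forall j, Omega x ->
      \int[nu x]_(s in setT) eta j s = I (eta j) x}.
    by apply: ae_forall_countable => j; exact/nuI/te.
  by apply: filterS => x h Ox j; exact: h.
have cI : {ae mu, forall x, I (eta j) x @[j --> \oo] --> (1 : R)}.
  apply: (iffLR (ae_restriction mO fO _)).
  apply: filterS2 nuIall (test_fun_Rintegral_cvg inv) => x nuI' c1 Ox.
  by have := c1 Ox; under eq_fun do rewrite nuI'//.
have bound : {ae mu, forall x, forall j, `|I (eta j) x| <= 1}.
  apply: (iffLR (ae_restriction mO fO _)); apply: filterS nuIall => x nuI' Ox j.
  rewrite -nuI'//; have it := test_fun_integrable (nu x) measurableT (te j).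
  apply: le_trans (le_normr_Rintegral measurableT it) _.
  have -> : 1 = \int[nu x]_(s in setT) (cst 1) s.
    by rewrite Rintegral_cst// [X in fine X](@probability_setT _ _ _ (nu x)) mulr1.
  apply: le_Rintegral => //; first exact: integrable_norm.
    by apply: bounded_measurable_integrable => //; exact: bounded_measurable_cst.
  by move=> s _; have /andP[e0 e1] := eta01 j s; rewrite ger0_norm.
have [|||||_ _] := @dominated_convergence _ _ _ mu setT measurableT
  (fun j x => (I (eta j) x)%:E) (fun=> 1%:E) (fun=> 1%:E).
- by move=> j; have /measurable_int := ie j.
- exact: measurable_cst.
- by apply: filterS cI => x c1 _; apply: cvg_EFin => //; exact: nearW.
- by apply: bounded_measurable_integrable => //; exact: bounded_measurable_cst.
- by apply: filterS bound => x b j _; rewrite lee_fin.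
rewrite integral_cst// mul1e -[X in _ --> X](@fineK _ (mu setT)) ?fin_num_measure//.
by move=> /fine_cvg.
Qed.

End Young_limits.

End test_function_integrals.

(** * From Young measures to bounded sequences *)

Section theorem_ii.
Variables (R : realType) (n : nat) (n_gt0 : (0 < n)%N) (p : R) (p_ge1 : 1 <= p).
Variables (Omega : set 'rV[R]_n) (openO : open Omega) (boundedO : bounded_set Omega).
Local Notation leb := (lebesgue_rV R n).
Local Notation mO := (open_measurable_rV openO).
Local Notation fO := (open_bounded_lebesgue_lty openO boundedO).
Local Notation mu := (mfrestr mO fO).

(** Serves twice, with [W] the sequence itself and with [W] its inverses, since psi dominates both
    norms. *)
Lemma bounded_seq_LpM_le_psi (Z W : nat -> 'rV[R]_n -> 'M[R]_n) (K : R) :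
  (forall k, measurable_fun setT (Z k)) -> (forall k x, invertible (Z k x)) ->
  (forall k, measurable_fun setT (W k)) ->
  (forall k x, frob (W k x) `^ p <= psi p (Z k x)) ->
  (forall k, \int[mu]_x (psi p (Z k x))%:E <= K%:E)%E ->
  bounded_seq_LpM Omega p W.
Proof.
move=> mZ iZ mW WZ psiK.
have WK k : (LpnormM Omega p (W k) <= (K `^ p^-1)%:E)%E.
  apply: LpnormM_ge; first exact: lt_le_trans p_ge1.
  apply: le_trans (psiK k).
  rewrite (@ae_integral_restriction _ _ _ leb Omega mO fO _ _ (aeW _ (fun x _ => erefl))).
  apply: ge0_le_integral => //.
  - by move=> x _; rewrite lee_fin powR_ge0.
  - apply/measurable_EFinP; apply: (measurableT_comp (@measurable_powR R p)).
    apply: measurableT_comp (mW k).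
    by apply: measurable_continuous_mx; exact: continuous_frob.
  - by apply/measurable_EFinP; exact: measurable_psi.
  - by move=> x _; rewrite lee_fin.
split; last by exists (K `^ p^-1).
move=> k; split; last exact: le_lt_trans (WK k) (ltry _).
by exists (W k); [exact: measurable_funTS|exact: aeW].
Qed.

Lemma Cpinv_continuous_pos (v : 'M[R]_n -> R) s : Cpinv p v -> invertible s ->
  continuous_at s (fun s => Num.max (v s) 0).
Proof.
move=> cv is_; apply: continuous_at_maxr; last exact: continuous_at_cst.
exact: Cpinv_continuous_at cv s is_.
Qed.

Lemma Cpinv_continuous_neg (v : 'M[R]_n -> R) s : Cpinv p v -> invertible s ->
  continuous_at s (fun s => Num.max (- v s) 0).
Proof.
move=> cv is_; apply: continuous_at_maxr; last exact: continuous_at_cst.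
apply: (@eq_continuous_at _ _ _ (fun s => 0 - v s)).
  by move=> y; rewrite sub0r.
apply: continuous_at_sub; first exact: continuous_at_cst.
exact: Cpinv_continuous_at cv s is_.
Qed.

(** Only countably many integrals are compared, which keeps the exceptional set null when [m] and
    [m'] depend on x. *)
Lemma Rintegral_Cpinv_determined (m m' : probability 'M[R]_n R) (v : 'M[R]_n -> R) :
  Cpinv p v ->
  (forall j, \int[m]_(s in setT) (Num.max (v s) 0 * eta j s) =
    \int[m']_(s in setT) (Num.max (v s) 0 * eta j s)) ->
  (forall j, \int[m]_(s in setT) (Num.max (- v s) 0 * eta j s) =
    \int[m']_(s in setT) (Num.max (- v s) 0 * eta j s)) ->
  \int[m]_(s in invertible) v s = \int[m']_(s in invertible) v s.
Proof.
move=> cv hp hn; rewrite /Rintegral; congr fine; rewrite integralE [RHS]integralE.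
congr (_ - _)%E.
  have pE (q : probability 'M[R]_n R) : (\int[q]_(s in invertible) (EFin \o v)^\+ s =
      \int[q]_(s in invertible) (Num.max (v s) 0)%:E)%E.
    by apply: eq_integral => s _; rewrite funeposE/= EFin_max.
  rewrite !pE; apply: integral_eta_determined => // s; first exact: Cpinv_continuous_pos.
  by rewrite le_max lexx orbT.
have nE (q : probability 'M[R]_n R) : (\int[q]_(s in invertible) (EFin \o v)^\- s =
    \int[q]_(s in invertible) (Num.max (- v s) 0)%:E)%E.
  by apply: eq_integral => s _; rewrite funenegE/= EFin_max.
rewrite !nE; apply: integral_eta_determined => // s; first exact: Cpinv_continuous_neg.
by rewrite le_max lexx orbT.
Qed.

(** Representatives are fixed for all test functions at once, each with its own null set; these
    uncountably many null sets are never united. *)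
Lemma choose_test_fun_rep (nu : 'rV[R]_n -> probability 'M[R]_n R) :
  young_measure Omega nu -> exists I : ('M[R]_n -> R) -> 'rV[R]_n -> R,
    (forall v, test_fun v -> bounded_measurable (I v)) /\
    (forall v, test_fun v ->
      {ae leb, forall x, Omega x -> \int[nu x]_(s in setT) v s = I v x}).
Proof.
move=> ym; have /choice[I hI] v : exists h : 'rV[R]_n -> R, test_fun v ->
    bounded_measurable h /\
    {ae leb, forall x, Omega x -> \int[nu x]_(s in setT) v s = h x}.
  have [tv|ntv] := pselect (test_fun v); last by exists (cst 0).
  by have [h hh] := test_fun_rep openO ym tv; exists h.
by exists I; split=> v /hI[].
Qed.

Theorem theorem_ii (nu : 'rV[R]_n -> probability 'M[R]_n R) :
  Ypinv Omega p nu ->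
  exists Y : nat -> 'rV[R]_n -> 'M[R]_n,
    [/\ bounded_seq_LpM Omega p Y, forall k, ae_invertible Omega (Y k),
      bounded_seq_LpM Omega p (fun k x => invmx (Y k x)) &
      generates_inv Omega p Y nu].
Proof.
move=> [[ym [Y [[YL _] gen]]] psioo inv].
have /choice[Yb hYb] k : exists h : 'rV[R]_n -> 'M[R]_n, measurable_fun setT h /\
    {ae leb, forall x, Omega x -> Y k x = h x}.
  have [mY _] := YL k.
  by have [h mh Yh] := lebesgue_measurable_rep mO (1%:M : 'M[R]_n) mY; exists h.
have [I [bI nuI]] := choose_test_fun_rep ym.
have YI v g : test_fun v -> bounded_measurable g ->
    \int[mu]_x (v (Yb k x) * g x) @[k --> \oo] --> \int[mu]_x (I v x * g x).
  move=> tv bg; have [_ [_ _ wc]] := gen v (C0_Cp p_ge1 (test_fun_C0 tv)).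
  have gL : in_Lp Omega +oo%E g.
    have [mg [G gG]] := bg; apply: (@bounded_in_Linfty _ _ _ _ G) => //.
    by exists g; [exact: measurable_funTS|exact: aeW].
  have := wc g gL.
  rewrite (@ae_Rintegral_restriction _ _ _ leb Omega mO fO _ (fun x => I v x * g x)).
    rewrite (_ : (fun k => _) = (fun k => \int[mu]_x (v (Yb k x) * g x)))//.
    apply/funext => k; apply: ae_Rintegral_restriction.
    by have [_] := hYb k; apply: filterS => x YYb Ox /=; rewrite YYb.
  by apply: filterS (nuI v tv) => x nuI' Ox; rewrite nuI'.
(* [Z] is invertible with bounded moments and has the same weak limits as [Y] on test functions;
   convergence for C_{p,-p} is still to be gained. *)
have [Z [mZ iZ [K psiZ]] ZI] := truncation n_gt0 (fun k => (hYb k).1) YI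
  (fun j => test_fun_rep_psi n_gt0 openO boundedO bI nuI j psioo)
  (test_fun_rep_eta n_gt0 bI nuI inv).
(* Stated for any reindexing: the identity feeds the first part, and the subsequence that it returns
   is the final sequence. *)
have bZ (phi : nat -> nat) : bounded_seq_LpM Omega p (fun k => Z (phi k)).
  apply: (bounded_seq_LpM_le_psi (fun k => mZ (phi k)) (fun k => iZ (phi k))
    (fun k => mZ (phi k)) _ (fun k => psiZ (phi k))) => k x.
  by rewrite /psi lerDl powR_ge0.
have bZi (phi : nat -> nat) : bounded_seq_LpM Omega p (fun k x => invmx (Z (phi k) x)).
  have mZi k : measurable_fun setT (fun x => invmx (Z (phi k) x)).
    apply: measurable_fun_mx => i j.
    apply: (measurable_invertible_comp n_gt0 (mZ _) (iZ _) (v := fun s => invmx s i j)).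
    by move=> s; exact: continuous_at_invmx.
  apply: (bounded_seq_LpM_le_psi (fun k => mZ (phi k)) (fun k => iZ (phi k))
    mZi _ (fun k => psiZ (phi k))) => k x.
  by rewrite /psi lerDr powR_ge0.
have iZae k : ae_invertible Omega (Z k) by apply: aeW => x _; exact: iZ.
have [phi [nu' [hphi [[ym' _] _ _] gen']]] :=
  theorem_i n_gt0 p_ge1 openO boundedO (bZ id) iZae (bZi id).
have [I' [bI' nuI']] := choose_test_fun_rep ym'.
(* Convergence to [nu'] concerns integrals over the invertible matrices, hence the condition that
   [v] vanish elsewhere. Both representatives are weak limits of one subsequence, so they agree
   almost everywhere. *)
have nunu' v : test_fun v -> (forall s, ~ invertible s -> v s = 0) ->
    {ae leb, forall x, Omega x ->
      \int[nu x]_(s in setT) v s = \int[nu' x]_(s in setT) v s}.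
  move=> tv vI; have II' : {ae mu, forall x, I v x = I' v x}.
    apply: ae_eq_of_Rintegral; [exact: bI|exact: bI'|move=> g bg].
    have gL : in_Lp Omega +oo%E g.
      have [mg [G gG]] := bg; apply: (@bounded_in_Linfty _ _ _ _ G) => //.
      by exists g; [exact: measurable_funTS|exact: aeW].
    have := gen' g v gL (Cp_Cpinv n_gt0 p_ge1 (C0_Cp p_ge1 (test_fun_C0 tv))).
    rewrite (@ae_Rintegral_restriction _ _ _ leb Omega mO fO _ (fun x => I' v x * g x)).
      rewrite (_ : (fun k => _) = (fun k => \int[mu]_x (v (Z (phi k) x) * g x))).
        move=> c'; apply: (cvg_unique _ _ c') => //.
        exact: (cvg_comp _ _ (homo_cvg_infty hphi) (ZI v g tv bg)).
      by apply/funext => k; apply: ae_Rintegral_restriction; exact: aeW.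
    apply: filterS (nuI' v tv) => x nuI'x Ox.
    by rewrite -Rintegral_off_invertible// nuI'x.
  have {}II' := iffRL (ae_restriction mO fO _) II'.
  apply: filterS3 II' (nuI v tv) (nuI' v tv) => x h1 h2 h3 Ox.
  by rewrite h2// h3// h1.
exists (fun k => Z (phi k)); split; [exact: bZ|by move=> k; exact: iZae|exact: bZi|].
move=> g v gL cv.
rewrite (@ae_Rintegral_restriction _ _ _ leb Omega mO fO _
  (fun x => \int[nu' x]_(s in invertible) v s * g x)).
  rewrite -(@ae_Rintegral_restriction _ _ _ leb Omega mO fO
    (fun x => \int[nu' x]_(s in invertible) v s * g x)); last exact: aeW.
  exact: gen'.
(* A single null set serves all j; it is used for the positive and the negative part of the given
   [v]. *)
have aej (w : 'M[R]_n -> R) : (forall s, invertible s -> continuous_at s w) ->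
    {ae leb, forall x, forall j, Omega x ->
      \int[nu x]_(s in setT) (w s * eta j s) = \int[nu' x]_(s in setT) (w s * eta j s)}.
  move=> cw; apply: ae_forall_countable => j; apply: nunu'.
    exact: test_fun_eta.
  by move=> s ns; rewrite eta_noninvertible ?mulr0.
apply: filterS2 (aej _ (fun s => Cpinv_continuous_pos cv))
  (aej _ (fun s => Cpinv_continuous_neg cv)) => x hp hn Ox; congr (_ * _).
by apply: Rintegral_Cpinv_determined cv _ _ => j; [exact: hp|exact: hn].
Qed.

End theorem_ii.

Unset Implicit Arguments.
Set Strict Implicit.

Theorem theorem2p1 (R : realType) (n : nat) (n_gt0 : (0 < n)%N) (p : R)
    (p_ge1 : 1 <= p) (Omega : set 'rV[R]_n) (openO : open Omega)
    (boundedO : bounded_set Omega) :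
  (forall Y : nat -> 'rV[R]_n -> 'M[R]_n,
     bounded_seq_LpM Omega p Y ->
     (forall k, ae_invertible Omega (Y k)) ->
     bounded_seq_LpM Omega p (fun k x => invmx (Y k x)) ->
     exists (phi : nat -> nat) (nu : 'rV[R]_n -> probability 'M[R]_n R),
       [/\ {homo phi : i j / (i < j)%N}, Ypinv Omega p nu &
         generates_inv Omega p (fun k => Y (phi k)) nu])
  /\
  (forall nu : 'rV[R]_n -> probability 'M[R]_n R,
     Ypinv Omega p nu ->
     exists Y : nat -> 'rV[R]_n -> 'M[R]_n,
       [/\ bounded_seq_LpM Omega p Y,
         forall k, ae_invertible Omega (Y k),
         bounded_seq_LpM Omega p (fun k x => invmx (Y k x)) &
         generates_inv Omega p Y nu]).
Proof.
split=> [Y bY iY bI|nu nuY].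
  exact: theorem_i bY iY bI.
exact: theorem_ii nuY.
Qed.
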